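(* Let $\mathbb{R}^n$ be endowed with the distance induced by a norm $|\cdot|$, let $I=(0,T)$ with $0<T<\infty$, and let $\mu\in\mathcal{M}^+(I\times\mathbb{R}^n)$. (1) Let $\boldsymbol\nu\in\mathcal{M}(I\times\mathbb{R}^n;\mathbb{R}^n)$ be such that $(\mu,\boldsymbol\nu)$ is a solution to the continuity equation $\partial_t\mu+\mathrm{div}(\boldsymbol\nu)=0$ in $I\times\mathbb{R}^n$. Then there exists a unique weak$^*$-type continuous measure-valued derivation $\mathcal{D}_{\boldsymbol\nu}$ which is a $\boldsymbol\nu$-directional derivation, and the pair $(\mu,\mathcal{D}_{\boldsymbol\nu})$ solves the continuity equation $\partial_t\mu+\mathrm{div}(\mathcal{D}_{\boldsymbol\nu})=0$ in $I\times\mathbb{R}^n$. (2) Conversely, let $\mathcal{D}$ be a finite-mass measure-valued derivation such that $(\mu,\mathcal{D})$ is a solution to the continuity equation $\partial_t\mu+\mathrm{div}(\mathcal{D})=0$. Then $\mathcal{D}$ is a $\boldsymbol\nu$-directional derivation for some $\boldsymbol\nu\in\mathcal{M}(I\times\mathbb{R}^n;\mathbb{R}^n)$ such that $(\mu,\boldsymbol\nu)$ solves the continuity equation $\partial_t\mu+\mathrm{div}(\boldsymbol\nu)=0$.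
   Context: Throughout $X=\mathbb{R}^n$. $\mathcal{M}^+$: nonnegative finite Borel measures; $\mathcal{M}(\cdot;\mathbb{R}^k)$: $\mathbb{R}^k$-valued Borel measures of finite total variation. $\mathrm{Lip}_{\mathrm b}(X)$: bounded real Lipschitz functions, with norm $\|f\|_\infty+\mathrm{Lip}(f)$. $\mathrm{lip}_{\rm a}(f)(x)=\lim_{r\to0^+}\sup_{y\ne z\in B(x,r)}\frac{|f(y)-f(z)|}{|y-z|}$. A measure-valued derivation is a linear map $\mathcal{D}:\mathrm{Lip}_{\mathrm b}(X)\to\mathcal{M}(I\times X;\mathbb{R})$ with $\mathcal{D}(fg)=f\mathcal{D}(g)+g\mathcal{D}(f)$. It is weak$^*$-type continuous if $\int g\,\mathrm{d}\mathcal{D}(f_k)\to\int g\,\mathrm{d}\mathcal{D}(f)$ for all $g\in C_b(I\times X)$ whenever $(f_k)$ is norm-bounded in $\mathrm{Lip}_{\mathrm b}(X)$ and converges pointwise to $f\in\mathrm{Lip}_{\mathrm b}(X)$. It has finite mass if there is $\lambda\in\mathcal{M}^+(I\times X)$ with $|\mathcal{D}(f)|\le\mathrm{lip}_{\rm a}(f)\lambda$ for all $f$. It is $\boldsymbol\nu$-directional if $\mathcal{D}(f)=\nabla f\cdot\boldsymbol\nu$ for all $f\in C^1_c(\mathbb{R}^n)$. $(\mu,\mathcal{D})$ solves $\partial_t\mu+\mathrm{div}(\mathcal{D})=0$ if for all $\xi\in C^1_c(I)$, $f\in\mathrm{Lip}_{\mathrm b}(X)$: $\int\xi'(t)f(x)\,\mathrm{d}\mu+\int\xi(t)\,\mathrm{d}\mathcal{D}(f)=0$.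 $(\mu,\boldsymbol\nu)$ solves $\partial_t\mu+\mathrm{div}(\boldsymbol\nu)=0$ if for all $\varphi\in C^1_c(I\times\mathbb{R}^n)$: $\int\partial_t\varphi\,\mathrm{d}\mu+\int\nabla\varphi\cdot\mathrm{d}\boldsymbol\nu=0$ ($\nabla$ spatial gradient). *)

(* Defs.v *)
From HB Require Import structures.
From mathcomp Require Import all_boot all_order all_algebra.
From mathcomp Require Import all_classical all_reals all_analysis.

Set Implicit Arguments.
Unset Strict Implicit.
Unset Printing Implicit Defensive.

Import Order.TTheory GRing.Theory Num.Theory.
Import numFieldNormedType.Exports.

Local Open Scope classical_set_scope.
Local Open Scope ring_scope.

(* The norm |.| of R^n is a plain function: the library's own norm and topology
   on 'rV[R]_n come from the max norm. All norms on R^n are equivalent, so only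
   the metric notions (Lipschitz constants, balls) have to refer to N. *)
Definition is_norm (R : realType) (n : nat) (N : 'rV[R]_n -> R) : Prop :=
  [/\ forall x, 0 <= N x,
      forall x, N x = 0 -> x = 0,
      forall a x, N (a *: x) = `|a| * N x &
      forall x y, N (x + y) <= N x + N y].

(* R x R^n with its Borel sigma-algebra. *)
Definition spacetime (R : realType) (n : nat) :=
  g_sigma_algebraType (@open (R * 'rV[R]_n)%type).

Definition slab (R : realType) (n : nat) (T : R) : set (R * 'rV[R]_n) :=
  `]0, T[ `*` setT.
Arguments slab {R} n T _.

(* The Borel measures on I x R^n, I = ]0, T[, are represented by the Borel
   measures on R x R^n that vanish outside I x R^n (extension by zero). A charge
   takes finite values and thus has finite total variation; an R^n-valued
   measure of finite total variation is the n-tuple of its components. *)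
Definition on_slab (R : realType) (n : nat) (T : R)
    (m : set (spacetime R n) -> \bar R) : Prop :=
  forall A : set (spacetime R n), measurable A -> m A = m (A `&` slab n T).

Section charge_integral.
Context {d : measure_display} {X : measurableType d} {R : realType}.
Variable nu : {charge set X -> \bar R}.

Definition hahn_pos : set X := projT1 (cid (Hahn_decomposition nu)).

Definition hahn_neg : set X :=
  projT1 (cid (projT2 (cid (Hahn_decomposition nu)))).

Definition hahnP : hahn_decomposition nu hahn_pos hahn_neg :=
  projT2 (cid (projT2 (cid (Hahn_decomposition nu)))).

(* The total variation measure of nu, and the integral of g against nu; on
   measurable sets neither depends on the chosen Hahn decomposition. *)
Definition total_variation : set X -> \bar R := charge_variation hahnP.

Definition charge_int (A : set X) (g : X -> R) : R :=
  Rintegral (jordan_pos hahnP) A g - Rintegral (jordan_neg hahnP) A g.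

End charge_integral.

Section lipschitz.
Context {R : realType} {n : nat}.
Variable N : 'rV[R]_n -> R.
Implicit Type f : 'rV[R]_n -> R.

Definition lip_b f : Prop :=
  (exists M : R, forall x, `|f x| <= M) /\
  (exists L : R, forall x y, `|f x - f y| <= L * N (x - y)).

(* Meaningful on Lip_b functions only, since sup is 0 on unbounded sets; it is
   also 0 on the empty set, which is the right value when A is a point. *)
Definition lip_const (A : set 'rV[R]_n) f : R :=
  sup [set r | exists y z, [/\ A y, A z, y != z &
                               r = `|f y - f z| / N (y - z)]].

Definition lip_b_norm f : R :=
  sup [set `|f x| | x in setT] + lip_const setT f.

Definition lip_a f (x : 'rV[R]_n) : R :=
  lim (lip_const [set y | N (y - x) < r] f @[r --> 0^'+]).

End lipschitz.

(* In finite dimension, differentiability everywhere together with continuity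
   of all directional derivatives is continuous differentiability. *)
Definition C1 (R : realType) (V : normedModType R) (f : V -> R^o) : Prop :=
  (forall x, differentiable f x) /\
  (forall v, continuous (fun x => 'D_v f x)).

(* C^1_c(U) for U open, its elements being extended by zero to V. *)
Definition C1c (R : realType) (V : normedModType R) (U : set V)
    (f : V -> R^o) : Prop :=
  [/\ C1 f, compact (closure [set x | f x != 0]) &
      closure [set x | f x != 0] `<=` U].

Section continuity_equation.
Context {R : realType} {n : nat}.
Variable T : R.
Implicit Types (mu : {finite_measure set (spacetime R n) -> \bar R})
  (nu : 'I_n -> {charge set (spacetime R n) -> \bar R}).

Definition basis_vec (i : 'I_n) : 'rV[R]_n := delta_mx ord0 i.

Definition d_t (phi : R^o * 'rV[R]_n -> R^o) (p : R^o * 'rV[R]_n) : R :=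
  'D_((1 : R^o), (0 : 'rV[R]_n)) phi p.

Definition d_x (i : 'I_n) (phi : R^o * 'rV[R]_n -> R^o)
    (p : R^o * 'rV[R]_n) : R :=
  'D_((0 : R^o), basis_vec i) phi p.

Definition solves_field mu nu : Prop :=
  forall phi : R^o * 'rV[R]_n -> R^o, C1c (slab n T) phi ->
    Rintegral mu (slab n T) (d_t phi) +
    \sum_(i < n) charge_int (nu i) (slab n T) (d_x i phi) = 0.

End continuity_equation.

(* A map D from functions on R^n to charges stands for a map on Lip_b(R^n): only
   the D f with lip_b N f are ever considered. Charges are compared on
   measurable sets, as their values on other sets are arbitrary. *)
Section derivations.
Context {R : realType} {n : nat}.
Variables (N : 'rV[R]_n -> R) (T : R).
Implicit Types (D : ('rV[R]_n -> R) -> {charge set (spacetime R n) -> \bar R})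
  (mu : {finite_measure set (spacetime R n) -> \bar R})
  (nu : 'I_n -> {charge set (spacetime R n) -> \bar R})
  (A : set (spacetime R n)) (p : R * 'rV[R]_n).

Definition derivation D : Prop :=
  [/\ forall f, lip_b N f -> on_slab T (D f),
      forall (a : R) f g A, lip_b N f -> lip_b N g -> measurable A ->
        D (fun x => a * f x + g x) A = (a%:E * D f A + D g A)%E &
      forall f g A, lip_b N f -> lip_b N g -> measurable A ->
        D (fun x => f x * g x) A =
        (charge_int (D g) A (fun p => f p.2) +
         charge_int (D f) A (fun p => g p.2))%:E].

Definition weak_star_continuous D : Prop :=
  forall (f_ : nat -> 'rV[R]_n -> R) (f : 'rV[R]_n -> R),
    (forall k, lip_b N (f_ k)) -> lip_b N f ->
    (exists C : R, forall k, lip_b_norm N (f_ k) <= C) ->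
    (forall x, f_ k x @[k --> \oo] --> f x) ->
    forall g : R * 'rV[R]_n -> R,
      {within slab n T, continuous g} ->
      (exists M : R, forall p, slab n T p -> `|g p| <= M) ->
      charge_int (D (f_ k)) (slab n T) g @[k --> \oo] -->
        charge_int (D f) (slab n T) g.

Definition finite_mass D : Prop :=
  exists lambda : {finite_measure set (spacetime R n) -> \bar R},
    on_slab T lambda /\
    forall f A, lip_b N f -> measurable A ->
      (total_variation (D f) A <= \int[lambda]_(p in A) (lip_a N f p.2)%:E)%E.

Definition directional nu D : Prop :=
  forall f : 'rV[R]_n -> R^o, C1c setT f ->
  forall A, measurable A ->
    D f A =
    (\sum_(i < n) charge_int (nu i) A (fun p => 'D_(basis_vec i) f p.2))%:E.

Definition solves_derivation mu D : Prop :=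
  forall (xi : R^o -> R^o) (f : 'rV[R]_n -> R),
    C1c `]0, T[ xi -> lip_b N f ->
    Rintegral mu (slab n T) (fun p => derive1 xi p.1 * f p.2) +
    charge_int (D f) (slab n T) (fun p => xi p.1) = 0.

Definition eq_on_lip_b D D' : Prop :=
  forall f A, lip_b N f -> measurable A -> D f A = D' f A.

End derivations.

(* Main.v *)
(* (1) For smooth f, the continuity equation turns the integral of
   phi against grad f . nu into the distribution
   - (f d_t phi dmu + f grad phi . dnu), which only sees the values of f. A
   Lipschitz f is a pointwise limit of C^1_c functions f_k with bounded Lipschitz
   constants (soft minima of finitely many cones, cut off at infinity). The
   charges grad f_k . nu are dominated by a fixed measure, so their distributional
   convergence improves to setwise convergence; the limit is D f. Linearity, the
   Leibniz rule, weak-* continuity and uniqueness pass to the limit.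
   (2) The component nu_i is the limit of the charges D (clamp_k x_i), and it is
   D (clamp_k x_i) on bounded sets, by locality. Cutting space-time into cells
   where grad f is e-close to a constant a, the function f - a . x has asymptotic
   Lipschitz constant O(e) there, so D f and grad f . nu differ by O(e) lambda.
   The equation holds for test functions b(t) f(x); a general phi is approximated,
   together with its first derivatives, by sums of b_j(t) phi(t_j, x) where the
   b_j are B-splines in time. *)
Require Import Defs.
From HB Require Import structures.
From mathcomp Require Import all_boot all_order all_algebra.
From mathcomp Require Import all_classical all_reals all_analysis.
From mathcomp Require Import measurable_realfun.
From mathcomp Require Import ring lra.

Set Implicit Arguments.
Unset Strict Implicit.
Unset Printing Implicit Defensive.

Import Order.TTheory GRing.Theory Num.Theory.
Import numFieldNormedType.Exports.

Local Open Scope classical_set_scope.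
Local Open Scope ring_scope.

(** * Functionals continuous under bounded pointwise convergence *)

(** The obstacle in (1) is that distributional convergence only tests charges against C^1_c
    functions, whereas a derivation needs values on all Borel sets. Charges are therefore handled as
    linear functionals on bounded measurable functions that are continuous under bounded pointwise
    convergence. The functionals of all the f_k are dominated by one gauge, a multiple of the
    integral of [|g|] against the variations of the nu_i. Hence the class of g on which they
    converge is closed under linear combinations and bounded pointwise limits, and a monotone class
    argument starting from C^1_c reaches every bounded Borel function. This is why the approximants
    need a Lipschitz constant that depends on the bounds of f alone; the McShane formula provides
    it. In (2) the available tool is the bound by [lip_a], which is local: D f on a set is
    controlled by f near the points of that set, and it is small where f has small local
    oscillation. The equation for D only offers products b(t) f(x). Splines suit this because, after
    summation by parts, their time derivatives turn node values into difference quotients, which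
    converge to the time derivative. *)

Section bounded_measurable.
Context {d : measure_display} {X : measurableType d} {R : realType}.
Implicit Types (f g : X -> R) (A : set X).

Definition bmeas g := measurable_fun setT g /\ exists M : R, forall x, `|g x| <= M.

(* The prefix [bp] refers to bounded pointwise convergence. *)
Definition bp_closed (P : (X -> R) -> Prop) :=
  (forall a f g, bmeas f -> bmeas g -> P f -> P g ->
     P (fun x => a * f x + g x)) /\
  (forall (g_ : nat -> X -> R) g, (exists M : R, forall k x, `|g_ k x| <= M) ->
     (forall k, bmeas (g_ k)) -> (forall k, P (g_ k)) ->
     (forall x, g_ k x @[k --> \oo] --> g x) -> P g).

Lemma bmeas_cst (c : R) : bmeas (cst c).
Proof. by split; [exact: measurable_cst|exists `|c|]. Qed.

Lemma bmeas_lin (a : R) f g : bmeas f -> bmeas g ->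
  bmeas (fun x => a * f x + g x).
Proof.
move=> [mf [M fM]] [mg [M' gM']]; split.
  apply: measurable_funD => //.
  exact: measurable_funM.
exists (`|a| * M + M') => x; rewrite (le_trans (ler_normD _ _))// normrM.
by rewrite lerD// ler_wpM2l.
Qed.

Lemma bmeasM f g : bmeas f -> bmeas g -> bmeas (fun x => f x * g x).
Proof.
move=> [mf [M fM]] [mg [M' gM']]; split; first exact: measurable_funM.
by exists (M * M') => x; rewrite normrM ler_pM.
Qed.

Lemma bmeasD f g : bmeas f -> bmeas g -> bmeas (fun x => f x + g x).
Proof.
move=> /(bmeas_lin 1) /[apply].
by under [X in bmeas X]eq_fun do rewrite mul1r.
Qed.

Lemma bmeasZ (a : R) f : bmeas f -> bmeas (fun x => a * f x).
Proof. by move=> bf; apply: bmeasM => //; exact: bmeas_cst. Qed.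

Lemma bmeasN f : bmeas f -> bmeas (fun x => - f x).
Proof. by move/(bmeasZ (-1)); under [X in bmeas X]eq_fun do rewrite mulN1r. Qed.

Lemma bmeasB f g : bmeas f -> bmeas g -> bmeas (fun x => f x - g x).
Proof. by move=> bf /bmeasN; exact: bmeasD. Qed.

Lemma bmeas_norm f : bmeas f -> bmeas (fun x => `|f x|).
Proof.
move=> [mf [M fM]]; split; first exact: measurableT_comp.
by exists M => x; rewrite normr_id.
Qed.

Lemma bmeas_sum (I : Type) (r : seq I) (F : I -> X -> R) :
  (forall i, bmeas (F i)) -> bmeas (fun x => \sum_(i <- r) F i x).
Proof.
move=> bF; elim: r => [|i r IH].
  by under [X in bmeas X]eq_fun do rewrite big_nil; exact: bmeas_cst.
by under [X in bmeas X]eq_fun do rewrite big_cons; exact: bmeasD.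
Qed.

Lemma bmeas_indic A : measurable A -> bmeas (\1_A : X -> R).
Proof.
move=> mA; split; first exact: measurable_indic.
by exists 1 => x; rewrite indicE; case: (_ \in _); rewrite ?normr0 ?normr1.
Qed.

Lemma bmeas_restrict A g : measurable A -> bmeas g -> bmeas (g \_ A).
Proof.
move=> mA bg; have -> : g \_ A = (fun x => g x * \1_A x).
  by apply/funext => x; rewrite patch_indic.
by apply: bmeasM => //; exact: bmeas_indic.
Qed.

Lemma bmeas_lim (g_ : nat -> X -> R) g : (exists M : R, forall k x, `|g_ k x| <= M) ->
  (forall k, bmeas (g_ k)) -> (forall x, g_ k x @[k --> \oo] --> g x) -> bmeas g.
Proof.
move=> [M gM] bg gg; split.
  apply: (@measurable_fun_cvg _ _ _ _ (fun k => g_ k)) => // k; exact: (bg k).1.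
exists M => x; have <- := cvg_lim (@Rhausdorff R) (cvg_norm (gg x)).
apply: limr_le; first by apply/cvg_ex; exists (`|g x|); exact: cvg_norm.
by apply: nearW => k; exact: gM.
Qed.

Lemma bmeas_integrable (m : {finite_measure set X -> \bar R}) A g :
  measurable A -> bmeas g -> m.-integrable A (EFin \o g).
Proof.
move=> mA [mg [M gM]]; apply: measurable_bounded_integrable => //.
- by rewrite ltey_eq fin_num_measure.
- exact: measurable_funTS.
- exists M; split; first exact: num_real.
  by move=> x Mx y _ /=; rewrite (le_trans (gM y))// ltW.
Qed.

Import HBNNSimple.

(** Monotone class argument: simple functions by linearity, nonnegative functions as increasing
    limits of simple functions, the general case by adding a bound of g, which costs one more
    indicator. *)
Lemma bp_closed_ind (P : (X -> R) -> Prop) : bp_closed P ->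
  (forall A, measurable A -> P \1_A) -> forall g, bmeas g -> P g.
Proof.
move=> [Plin Plim] Pind.
have P0 : P (cst 0) by rewrite -indic0; exact: Pind.
have Psum (r : seq R) (A : R -> set X) : (forall y, measurable (A y)) ->
    P (fun x => \sum_(y <- r) y * \1_(A y) x).
  move=> mA; elim: r => [|y r IH].
    by under [X in P X]eq_fun do rewrite big_nil.
  under [X in P X]eq_fun do rewrite big_cons.
  apply: Plin; [exact: bmeas_indic| |exact: Pind|exact: IH].
  by apply: bmeas_sum => z; apply: bmeasZ; exact: bmeas_indic.
suff Pge0 g : bmeas g -> (forall x, 0 <= g x) -> P g.
  move=> g bg; have [M gM] := bg.2.
  have -> : g = fun x => - M * \1_setT x + (g x + M).
    by apply/funext => x; rewrite indicT mulr1 addrC addrK.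
  have bgM : bmeas (fun x => g x + M) by apply: bmeasD => //; exact: bmeas_cst.
  apply: Plin => //; [exact: bmeas_indic|exact: Pind|].
  apply: Pge0 => // x; rewrite -lerBlDr sub0r.
  by have := gM x; rewrite ler_norml => /andP[].
move=> bg g0; have [M gM] := bg.2.
have mg : measurable_fun setT (EFin \o g) by apply/measurable_EFinP; exact: bg.1.
pose h := nnsfun_approx measurableT mg.
have hg x : h k x @[k --> \oo] --> g x.
  suff /fine_cvgP[] : (h k x)%:E @[k --> \oo] --> (g x)%:E by [].
  by apply: (cvg_nnsfun_approx measurableT mg) => // y _; rewrite lee_fin.
have hleg k x : h k x <= g x.
  have <- := cvg_lim (@Rhausdorff R) (hg x).
  apply: nondecreasing_cvgn_le; last by apply/cvg_ex; exists (g x); exact: hg.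
  by move=> i j ij; have /lefP := nd_nnsfun_approx measurableT mg ij; exact.
have bh k : bmeas (h k).
  split; first exact: measurable_funPT.
  by exists M => x; rewrite ger0_norm// (le_trans (hleg _ _))// (le_trans (ler_norm _)).
apply: (Plim (fun k => h k)) => //.
  exists M => k x.
  by rewrite ger0_norm// (le_trans (hleg _ _))// (le_trans (ler_norm _)).
move=> k; have -> : (h k : X -> R) =
    fun x => \sum_(y <- finmap.enum_fset (fset_set (range (h k)))) y * \1_(h k @^-1` [set y]) x.
  by apply/funext => x; rewrite [LHS]fimfunE fsbig_finite//; exact: fimfunP.
by apply: Psum => y; exact: measurable_funPTI.
Qed.

End bounded_measurable.

Section cvg_approximation.
Context {R : realType}.

(** Interchange of limits: u is uniformly close to convergent sequences whose limits are close to l,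
    and three errors of [e / 3] add up. *)
Lemma cvg_approx_lim (u : nat -> R) (l : R) :
  (forall e, 0 < e -> exists v : nat -> R, exists l' : R,
    [/\ v k @[k --> \oo] --> l', forall k, `|u k - v k| <= e & `|l - l'| <= e]) ->
  u k @[k --> \oo] --> l.
Proof.
move=> H; apply/cvgrPdist_lt => e e0.
have e30 : 0 < e / 3 by rewrite divr_gt0.
have [v [l' [vl' uv ll']]] := H _ e30.
have /cvgrPdist_lt/(_ _ e30) vl := vl'.
near=> k.
have : `|l' - v k| < e / 3 by near: k.
have := uv k.
rewrite !ler_norml !ltr_norml; move: ll'; rewrite !ler_norml.
by move=> /andP[? ?] /andP[? ?] /andP[? ?]; apply/andP; split; lra.
Unshelve. all: by end_near. Qed.

(** The same interchange without a candidate for the limit: u is a Cauchy sequence, and completeness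
    of R provides the limit. *)
Lemma is_cvg_approx (u : nat -> R) :
  (forall e, 0 < e -> exists2 v : nat -> R,
    cvg (v k @[k --> \oo]) & forall k, `|u k - v k| <= e) ->
  cvg (u k @[k --> \oo]).
Proof.
move=> H; apply/cauchy_cvgP/cauchy_exP => e e0.
have e30 : 0 < e / 3 by rewrite divr_gt0.
have [v vl uv] := H _ e30; exists (lim (v k @[k --> \oo])).
have /cvgrPdist_lt/(_ _ e30) := vl => vle.
suff : \forall k \near \oo, `|lim (v k @[k --> \oo]) - u k| < e by [].
apply: filterS vle => k.
have := uv k.
rewrite !ler_norml !ltr_norml.
by move=> /andP[? ?] /andP[? ?]; apply/andP; split; lra.
Qed.

End cvg_approximation.

(** * Functionals continuous under bounded pointwise convergence, and domination by a gauge *)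

Section bp_functionals.
Context {d : measure_display} {X : measurableType d} {R : realType}.
Implicit Types (f g h : X -> R) (A : set X) (L : (X -> R) -> R).

Definition bp_fun L :=
  (forall a f g, bmeas f -> bmeas g -> L (fun x => a * f x + g x) = a * L f + L g) /\
  (forall (g_ : nat -> X -> R) g, (exists M : R, forall k x, `|g_ k x| <= M) ->
     (forall k, bmeas (g_ k)) ->
     (forall x, g_ k x @[k --> \oo] --> g x) -> L (g_ k) @[k --> \oo] --> L g).

Lemma bp_fun0 L : bp_fun L -> L (cst 0) = 0.
Proof.
move=> [lin _]; have := lin 1 (cst 0) (cst 0) (bmeas_cst _) (bmeas_cst _).
under [X in L X]eq_fun do rewrite mulr0 addr0.
by rewrite mul1r => /eqP; rewrite -subr_eq0 opprD addNKr oppr_eq0 => /eqP.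
Qed.

Lemma bp_funD L f g : bp_fun L -> bmeas f -> bmeas g ->
  L (fun x => f x + g x) = L f + L g.
Proof.
move=> [lin _] bf bg; have := lin 1 f g bf bg; rewrite mul1r => <-.
by congr L; apply/funext => x; rewrite mul1r.
Qed.

Lemma bp_funZ L (a : R) f : bp_fun L -> bmeas f -> L (fun x => a * f x) = a * L f.
Proof.
move=> bL bf; rewrite -[RHS]addr0 -(bp_fun0 bL) -bL.1//; last exact: bmeas_cst.
by congr L; apply/funext => x; rewrite addr0.
Qed.

Lemma bp_funN L f : bp_fun L -> bmeas f -> L (fun x => - f x) = - L f.
Proof.
by move=> bL /(bp_funZ (-1) bL); under [X in L X]eq_fun do rewrite mulN1r; rewrite mulN1r.
Qed.

Lemma bp_funB L f g : bp_fun L -> bmeas f -> bmeas g ->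
  L (fun x => f x - g x) = L f - L g.
Proof. by move=> bL bf bg; rewrite bp_funD// ?bp_funN//; exact: bmeasN. Qed.

Lemma bp_fun_sum L (I : Type) (r : seq I) (F : I -> X -> R) : bp_fun L ->
  (forall i, bmeas (F i)) ->
  L (fun x => \sum_(i <- r) F i x) = \sum_(i <- r) L (F i).
Proof.
move=> bL bF; elim: r => [|i r IH].
  by under [X in L X]eq_fun do rewrite big_nil; rewrite big_nil (bp_fun0 bL).
under [X in L X]eq_fun do rewrite big_cons.
by rewrite big_cons bp_funD ?IH//; exact: bmeas_sum.
Qed.

Lemma bp_fun_add L L' : bp_fun L -> bp_fun L' -> bp_fun (fun g => L g + L' g).
Proof.
move=> [l c] [l' c']; split.
  by move=> a f g bf bg; rewrite l// l'// mulrDr addrACA.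
by move=> g_ g bd b gg; apply: cvgD; [exact: c|exact: c'].
Qed.

Lemma bp_fun_scale (a : R) L : bp_fun L -> bp_fun (fun g => a * L g).
Proof.
move=> [l c]; split; first by move=> b f g bf bg; rewrite l// mulrDr mulrCA.
by move=> g_ g bd b gg; apply: cvgM; [exact: cvg_cst|exact: c].
Qed.

Lemma bp_fun_bigsum (I : Type) (r : seq I) (L : I -> (X -> R) -> R) :
  (forall i, bp_fun (L i)) -> bp_fun (fun g => \sum_(i <- r) L i g).
Proof.
move=> bL; elim: r => [|i r IH].
  under [X in bp_fun X]eq_fun do rewrite big_nil.
  by split; [move=> *; rewrite mulr0 addr0|move=> *; exact: cvg_cst].
by under [X in bp_fun X]eq_fun do rewrite big_cons; exact: bp_fun_add.
Qed.

Lemma bp_fun_mul h L : bmeas h -> bp_fun L -> bp_fun (fun g => L (fun x => h x * g x)).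
Proof.
move=> bh [l c]; split.
  move=> a f g bf bg; rewrite -l; [|exact: bmeasM..].
  by congr L; apply/funext => x; rewrite mulrDr mulrCA.
move=> g_ g [M gM] bg gg; apply: c.
- have [K hK] := bh.2; exists (K * M) => k x.
  by rewrite normrM ler_pM.
- by move=> k; exact: bmeasM.
- by move=> x; apply: cvgM => //; exact: cvg_cst.
Qed.

Lemma bp_closed_eq L L' : bp_fun L -> bp_fun L' -> bp_closed (fun g => L g = L' g).
Proof.
move=> [l c] [l' c']; split.
  by move=> a f g bf bg e e'; rewrite l// l'// e e'.
move=> g_ g bd bg eg gg.
have := c _ _ bd bg gg; under eq_fun do rewrite eg.
by move=> /cvg_lim <-//; apply: cvg_lim => //; exact: c'.
Qed.

Lemma bp_fun_eq L L' : bp_fun L -> bp_fun L' ->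
  (forall A, measurable A -> L \1_A = L' \1_A) ->
  forall g, bmeas g -> L g = L' g.
Proof. by move=> bL bL' ind; apply: bp_closed_ind => //; exact: bp_closed_eq. Qed.

(** An abstract integral of [|g|] against a fixed finite measure. Continuity at 0 makes the
    approximation of g uniform over all functionals dominated by q. *)
Definition bp_gauge (q : (X -> R) -> R) :=
  forall g_ : nat -> X -> R, (exists M : R, forall k x, `|g_ k x| <= M) ->
     (forall k, bmeas (g_ k)) -> (forall x, g_ k x @[k --> \oo] --> 0) ->
     q (g_ k) @[k --> \oo] --> 0.

Section dominated_sequences.
Variables (L_ : nat -> (X -> R) -> R) (q : (X -> R) -> R).
Hypothesis bL_ : forall k, bp_fun (L_ k).
Hypothesis bq : bp_gauge q.
Hypothesis Lq : forall k g, bmeas g -> `|L_ k g| <= q g.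

Lemma gauge_diff (g_ : nat -> X -> R) g : (exists M : R, forall k x, `|g_ k x| <= M) ->
  (forall k, bmeas (g_ k)) -> (forall x, g_ k x @[k --> \oo] --> g x) ->
  q (fun x => g x - g_ k x) @[k --> \oo] --> 0.
Proof.
move=> bd bg gg; have bG := bmeas_lim bd bg gg.
apply: (bq (g_ := fun k x => g x - g_ k x)).
- have [M gM] := bd; have [M' gM'] := bG.2; exists (M' + M) => k x.
  by rewrite (le_trans (ler_normB _ _))// lerD.
- by move=> k; exact: bmeasB.
- by move=> x; rewrite -(subrr (g x)); apply: cvgB => //; exact: cvg_cst.
Qed.

(** The index m is chosen before L, so one approximant serves a whole sequence of functionals at
    once. *)
Lemma gauge_approx (g_ : nat -> X -> R) g : (exists M : R, forall k x, `|g_ k x| <= M) ->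
  (forall k, bmeas (g_ k)) -> (forall x, g_ k x @[k --> \oo] --> g x) ->
  forall e, 0 < e -> exists m, forall L, bp_fun L ->
    (forall h, bmeas h -> `|L h| <= q h) -> `|L g - L (g_ m)| <= e.
Proof.
move=> bd bg gg e e0; have bG := bmeas_lim bd bg gg.
have /cvgr0Pnorm_lt/(_ _ e0)[m _ /(_ m (leqnn m)) /= qm] := gauge_diff bd bg gg.
exists m => L bL Ldom; rewrite -bp_funB//.
rewrite (le_trans (Ldom _ _))//; first exact: bmeasB.
by rewrite (le_trans (ler_norm _))// ltW.
Qed.

Lemma bp_closed_cvg : bp_closed (fun g => cvg (L_ k g @[k --> \oo])).
Proof.
split.
  move=> a f g bf bg cf cg; under eq_fun do rewrite (bL_ _).1//.
  by apply: is_cvgD => //; apply: is_cvgM => //; exact: is_cvg_cst.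
move=> g_ g bd bg cg gg; apply: is_cvg_approx => e e0.
have [m mP] := gauge_approx bd bg gg e0.
by exists (fun k => L_ k (g_ m)) => // k; apply: mP => // h; exact: Lq.
Qed.

Lemma bp_closed_cvg_to L : bp_fun L -> (forall g, bmeas g -> `|L g| <= q g) ->
  bp_closed (fun g => L_ k g @[k --> \oo] --> L g).
Proof.
move=> bL Ldom; split.
  move=> a f g bf bg cf cg; under eq_fun do rewrite (bL_ _).1//.
  by rewrite bL.1//; apply: cvgD => //; apply: cvgM => //; exact: cvg_cst.
move=> g_ g bd bg cg gg; apply: cvg_approx_lim => e e0.
have [m mP] := gauge_approx bd bg gg e0.
exists (fun k => L_ k (g_ m)), (L (g_ m)); split => //; last exact: mP.
by move=> k; apply: mP => // h; exact: Lq.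
Qed.

(** Domination by q survives the limit and yields the continuity of the limit functional, with no
    appeal to a Vitali-Hahn-Saks theorem. *)
Lemma bp_fun_lim : (forall g, bmeas g -> cvg (L_ k g @[k --> \oo])) ->
  bp_fun (fun g => lim (L_ k g @[k --> \oo])).
Proof.
move=> cL.
have dL g : bmeas g -> `|lim (L_ k g @[k --> \oo])| <= q g.
  move=> bg; have <- := cvg_lim (@Rhausdorff R) (cvg_norm (cL _ bg)).
  apply: limr_le; last by apply: nearW => k; exact: Lq.
  by apply/cvg_ex; exists `|lim (L_ k g @[k --> \oo])|; exact: cvg_norm (cL _ bg).
have llin a f g : bmeas f -> bmeas g ->
    lim (L_ k (fun x => a * f x + g x) @[k --> \oo]) =
    a * lim (L_ k f @[k --> \oo]) + lim (L_ k g @[k --> \oo]).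
  move=> bf bg; apply: (cvg_lim (@Rhausdorff R)).
  under eq_fun do rewrite (bL_ _).1//.
  apply: cvgD; last exact: cL.
  by apply: cvgM; [exact: cvg_cst|exact: cL].
split => // g_ g bd bg gg; have bG := bmeas_lim bd bg gg.
apply/cvgrPdist_le => e e0.
have /cvgr0Pnorm_le/(_ _ e0) := gauge_diff bd bg gg.
apply: filterS => k qk; apply: le_trans qk.
rewrite (le_trans _ (ler_norm _))//.
have -> : lim (L_ k g @[k --> \oo]) - lim (L_ k0 (g_ k) @[k0 --> \oo]) =
  lim (L_ k0 (fun x => g x - g_ k x) @[k0 --> \oo]).
  apply/esym; rewrite addrC -mulN1r -(llin _ _ _ (bg k) bG).
  have -> : (fun x => g x - g_ k x) = fun x => -1 * g_ k x + g x by apply/funext => x; rewrite mulN1r addrC.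
  by [].
by apply: dL; exact: bmeasB.
Qed.

End dominated_sequences.

End bp_functionals.

(** * Charges as functionals, and back *)

Section charge_functional.
Context {d : measure_display} {X : measurableType d} {R : realType}.
Implicit Types (f g h : X -> R) (A : set X) (s : {charge set X -> \bar R}).

Lemma bp_fun_Rintegral (m : {finite_measure set X -> \bar R}) :
  bp_fun (Rintegral m setT).
Proof.
split.
  move=> a f g bf bg.
  rewrite RintegralD//; last 2 first.
  - by apply: bmeas_integrable => //; exact: bmeasZ.
  - exact: bmeas_integrable.
  by rewrite RintegralZl//; exact: bmeas_integrable.
move=> g_ g bd bg gg; have bG := bmeas_lim bd bg gg.
have [M gM] := bd.
have [] := @dominated_convergence _ _ _ m setT measurableT
  (fun k => EFin \o g_ k) (EFin \o g) (cst M%:E).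
- by move=> k; apply/measurable_EFinP; exact: (bg k).1.
- by apply/measurable_EFinP; exact: bG.1.
- by apply: aeW => x _; apply: cvg_EFin; [exact: nearW|exact: gg].
- exact: (bmeas_integrable m measurableT (bmeas_cst M)).
- by apply: aeW => x k _; rewrite lee_fin.
move=> ig _ /= cv; rewrite /Rintegral; apply: fine_cvg.
rewrite fineK//; exact: integrable_fin_num.
Qed.

(** Integrals over subsets are turned into integrals of restricted functions, so that every charge
    acts on functions of the whole space. *)
Definition cint s g := charge_int s setT g.

Lemma charge_int_restrict s A g : charge_int s A g = cint s (g \_ A).
Proof. by rewrite /cint /charge_int !(Rintegral_mkcond _ A). Qed.

Lemma bp_fun_cint s : bp_fun (cint s).
Proof.
have -> : cint s = fun g => Rintegral (jordan_pos (hahnP s)) setT g +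
    -1 * Rintegral (jordan_neg (hahnP s)) setT g.
  by apply/funext => g; rewrite mulN1r.
apply: bp_fun_add; first exact: bp_fun_Rintegral.
by apply: bp_fun_scale; exact: bp_fun_Rintegral.
Qed.

Lemma cint_indic s A : measurable A -> cint s \1_A = fine (s A).
Proof.
move=> mA; rewrite /cint /charge_int /Rintegral !integral_indic// !setIT.
rewrite (jordan_decomp (hahnP s) mA) /cadd/= cscaleN1.
by rewrite fineB// fin_num_measure.
Qed.

Lemma cint_indicE s A : measurable A -> s A = (cint s \1_A)%:E.
Proof. by move=> mA; rewrite cint_indic// fineK//; exact: fin_num_measure. Qed.

(** The integral of [|g|] against the total variation, kept as two terms so that each is an integral
    against a finite measure. *)
Definition charge_norm s g :=
  Rintegral (jordan_pos (hahnP s)) setT (fun x => `|g x|) +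
  Rintegral (jordan_neg (hahnP s)) setT (fun x => `|g x|).

Lemma bp_gauge_Rintegral (m : {finite_measure set X -> \bar R}) :
  bp_gauge (fun g => Rintegral m setT (fun x => `|g x|)).
Proof.
move=> g_ [M gM] bg gg.
have [_ /(_ (fun k x => `|g_ k x|) (cst 0))] := bp_fun_Rintegral m.
rewrite (_ : Rintegral m setT (cst 0) = 0); last exact: bp_fun0 (bp_fun_Rintegral m).
apply.
- by exists M => k x; rewrite normr_id.
- by move=> k; exact: bmeas_norm.
- by move=> x; rewrite -[cst 0 x]/0 -(@normr0 _ R); apply: cvg_norm; exact: gg.
Qed.

Lemma bp_gauge_add (q q' : (X -> R) -> R) : bp_gauge q -> bp_gauge q' ->
  bp_gauge (fun g => q g + q' g).
Proof.
by move=> bq bq' g_ bd bg gg; rewrite -(addr0 0); apply: cvgD; [exact: bq|exact: bq'].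
Qed.

Lemma bp_gauge_scale (a : R) (q : (X -> R) -> R) : bp_gauge q ->
  bp_gauge (fun g => a * q g).
Proof.
move=> bq g_ bd bg gg; rewrite -(mulr0 a); apply: cvgM; first exact: cvg_cst.
exact: bq.
Qed.

Lemma bp_gauge_bigsum (I : Type) (r : seq I) (q : I -> (X -> R) -> R) :
  (forall i, bp_gauge (q i)) -> bp_gauge (fun g => \sum_(i <- r) q i g).
Proof.
move=> bq; elim: r => [|i r IH].
  under [X in bp_gauge X]eq_fun do rewrite big_nil.
  by move=> *; exact: cvg_cst.
by under [X in bp_gauge X]eq_fun do rewrite big_cons; exact: (bp_gauge_add (bq i) IH).
Qed.

Lemma bp_gauge_charge_norm s : bp_gauge (charge_norm s).
Proof. by apply: bp_gauge_add; exact: bp_gauge_Rintegral. Qed.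

Lemma le_charge_norm s f g : bmeas f -> bmeas g -> (forall x, `|f x| <= `|g x|) ->
  charge_norm s f <= charge_norm s g.
Proof.
by move=> bf bg fg; apply: lerD; apply: le_Rintegral => //;
  apply: bmeas_integrable => //; exact: bmeas_norm.
Qed.

Lemma charge_normZ s (a : R) g : bmeas g ->
  charge_norm s (fun x => a * g x) = `|a| * charge_norm s g.
Proof.
move=> bg; rewrite /charge_norm mulrDr.
have -> : (fun x => `|a * g x|) = fun x => `|a| * `|g x|.
  by apply/funext => x; rewrite normrM.
by rewrite !bp_funZ//; solve [exact: bp_fun_Rintegral|exact: bmeas_norm].
Qed.

Lemma cint_charge_norm s g : bmeas g -> `|cint s g| <= charge_norm s g.
Proof.
move=> bg; rewrite (le_trans (ler_normB _ _))// lerD//;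
  by apply: le_normr_Rintegral => //; exact: bmeas_integrable.
Qed.

Lemma cint_unique s (L : (X -> R) -> R) : bp_fun L ->
  (forall A, measurable A -> s A = (L \1_A)%:E) -> forall g, bmeas g -> cint s g = L g.
Proof.
move=> bL sL; apply: bp_fun_eq => //; first exact: bp_fun_cint.
by move=> A mA; rewrite cint_indic// sL.
Qed.

(* Total variation is not needed up to a constant: the factor 2 accounts for
   bounding the positive and negative parts separately. *)
Lemma cint_dominated s (m : {finite_measure set X -> \bar R}) (C : R) g :
  0 <= C -> (forall A, measurable A -> (Defs.total_variation s A <= C%:E * m A)%E) ->
  bmeas g -> `|cint s g| <= 2 * C * Rintegral m setT (fun x => `|g x|).
Proof.
move=> C0 sm bg; apply: (le_trans (cint_charge_norm s bg)).
have bng := bmeas_norm bg.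
have H (m' : {finite_measure set X -> \bar R}) :
    (forall A, measurable A -> (m' A <= C%:E * m A)%E) ->
    Rintegral m' setT (fun x => `|g x|) <= C * Rintegral m setT (fun x => `|g x|).
  move=> mm; rewrite -lee_fin EFinM /Rintegral !fineK; last 2 first.
  - exact: (integrable_fin_num measurableT (bmeas_integrable m measurableT bng)).
  - exact: (integrable_fin_num measurableT (bmeas_integrable m' measurableT bng)).
  have := @ge0_integral_mscale _ _ _ m setT measurableT (NngNum C0)
    (fun x => `|g x|%:E).
  move=> <-//; last first.
  - by apply/measurable_EFinP; exact: bng.1.
  apply: ge0_le_measure_integral => //.
  by apply/measurable_EFinP; exact: bng.1.
rewrite -mulrA mulr2n mulrDl !mul1r lerD//; apply: H => A mA;
  apply: le_trans (sm _ mA).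
- by rewrite leeDl.
- by rewrite leeDr.
Qed.

(** Countable additivity on disjoint sets is the continuity of L along the partial sums of their
    indicators. *)
Lemma charge_of_bp_fun (L : (X -> R) -> R) : bp_fun L ->
  exists s : {charge set X -> \bar R},
    forall A, measurable A -> s A = (L \1_A)%:E.
Proof.
move=> bL.
pose m A := (L \1_A)%:E.
have m0 : m set0 = 0%E by rewrite /m indic0 (bp_fun0 bL).
have mfin A : measurable A -> m A \is a fin_num by [].
have msadd : semi_sigma_additive m.
  move=> F mF tF mUF.
  (* By disjointness only the indicator of [F i] is nonzero at x: the partial sums are bounded by 1
     and constant once i has been passed. *)
  have part x i n : F i x -> \sum_(0 <= j < n) \1_(F j) x = (i < n)%:R :> R.
    move=> Fix; have F0 j : j != i -> \1_(F j) x = 0 :> R.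
      move=> ji; rewrite indicE memNset// => Fjx.
      by move/eqP : ji; apply; apply: tF => //; exists x.
    rewrite big_mkord; have [lt_in|le_ni] := ltnP i n.
      rewrite (bigD1 (Ordinal lt_in))//= indicE mem_set// big1 ?addr0// => j ji.
      by rewrite F0.
    rewrite big1// => j _; rewrite F0//.
    by rewrite neq_ltn (leq_trans _ le_ni).
  have part0 x n : ~ (exists i, F i x) -> \sum_(0 <= j < n) \1_(F j) x = 0 :> R.
    move=> NF; rewrite big1// => j _; rewrite indicE memNset// => Fjx.
    by apply: NF; exists j.
  rewrite (_ : (fun _ => _) = EFin \o (fun n => L (fun x => \sum_(0 <= i < n) \1_(F i) x))).
    apply: cvg_EFin; first exact: nearW.
    apply: bL.2.
    - exists 1 => n x; have [[i Fi]|NF] := pselect (exists i, F i x).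
        by rewrite (part _ _ _ Fi); case: (_ < _)%N; rewrite ?normr0 ?normr1.
      by rewrite part0// normr0.
    - by move=> k; apply: bmeas_sum => i; exact: bmeas_indic.
    - move=> x; have [[i Fi]|NF] := pselect (exists i, F i x).
        rewrite indicE mem_set; last by exists i.
        apply: cvg_near_cst; exists i.+1 => // n /= lt_in.
        by rewrite (part _ _ _ Fi) lt_in.
      rewrite indicE memNset; last by move=> [i _ Fi]; apply: NF; exists i.
      by under eq_fun do rewrite part0//; exact: cvg_cst.
  apply/funext => n /=; rewrite bp_fun_sum//; last by move=> i; exact: bmeas_indic.
  by rewrite sumEFin.
pose c := @isCharge.Build _ _ _ m m0 mfin msadd.
pose s := HB.pack_for (Charge.type X R) m c.
by exists s.
Qed.

End charge_functional.

(** * C^1 calculus *)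

Section C1_calculus.
Context {R : realType} {V : normedModType R}.
Implicit Types (f g : V -> R^o) (x v : V).

Lemma C1_continuous f : C1 f -> continuous f.
Proof. by move=> [df _] x; exact: differentiable_continuous. Qed.

Lemma C1_derivable f x v : C1 f -> derivable f x v.
Proof. by move=> [df _]; exact: diff_derivable. Qed.

Lemma C1_cst (c : R) : C1 (fun _ : V => c : R^o).
Proof.
split; first by move=> x; exact: differentiable_cst.
move=> v; have -> : (fun x => 'D_v (fun _ : V => c : R^o) x) = cst 0.
  by apply/funext => x; rewrite derive_cst.
exact: cst_continuous.
Qed.

Lemma C1D f g : C1 f -> C1 g -> C1 (fun x => f x + g x).
Proof.
move=> cf cg; split; first by move=> x; apply: differentiableD; [exact: cf.1|exact: cg.1].
move=> v; have -> : (fun x => 'D_v (fun y => f y + g y : R^o) x) =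
    (fun x => 'D_v f x + 'D_v g x).
  by apply/funext => x; rewrite deriveD//; exact: C1_derivable.
by move=> x; apply: cvgD; [exact: cf.2|exact: cg.2].
Qed.

Lemma derive_mul f g x v : C1 f -> C1 g ->
  'D_v (fun y => f y * g y : R^o) x = f x * 'D_v g x + g x * 'D_v f x.
Proof. by move=> cf cg; rewrite deriveM//; exact: C1_derivable. Qed.

Lemma C1M f g : C1 f -> C1 g -> C1 (fun x => f x * g x).
Proof.
move=> cf cg; split; first by move=> x; apply: differentiableM; [exact: cf.1|exact: cg.1].
move=> v; have -> : (fun x => 'D_v (fun y => f y * g y : R^o) x) =
    (fun x => f x * 'D_v g x + g x * 'D_v f x).
  by apply/funext => x; rewrite derive_mul.
move=> x; apply: cvgD; apply: cvgM.
- exact: (C1_continuous cf).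
- exact: (cg.2 v x).
- exact: (C1_continuous cg).
- exact: (cf.2 v x).
Qed.

Lemma C1Z (c : R) f : C1 f -> C1 (fun x => c * f x).
Proof. by move=> cf; exact: (C1M (C1_cst c) cf). Qed.

Lemma C1N f : C1 f -> C1 (fun x => - f x).
Proof.
move=> /(C1Z (-1)); congr C1; apply/funext => x; by rewrite mulN1r.
Qed.

Lemma C1_sum (I : Type) (r : seq I) (F : I -> V -> R^o) :
  (forall i, C1 (F i)) -> C1 (fun x => \sum_(i <- r) F i x).
Proof.
move=> cF; elim: r => [|i r IH].
  by under [X in C1 X]eq_fun do rewrite big_nil; exact: C1_cst.
by under [X in C1 X]eq_fun do rewrite big_cons; exact: C1D.
Qed.

Lemma derive_lin (a : R) f g x v : C1 f -> C1 g ->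
  'D_v (fun y => a * f y + g y : R^o) x = a * 'D_v f x + 'D_v g x.
Proof.
move=> cf cg; rewrite deriveD; [|exact/C1_derivable/C1Z|exact: C1_derivable].
by rewrite (derive_mul _ _ (C1_cst a) cf) derive_cst mulr0 addr0.
Qed.

Lemma C1_comp_derive (h dh : R -> R) f x v : derivable (h : R^o -> R^o) (f x) 1 ->
  'D_1 (h : R^o -> R^o) (f x) = dh (f x) -> differentiable f x ->
  differentiable (fun y => h (f y) : R^o) x /\
  'D_v (fun y => h (f y) : R^o) x = dh (f x) * 'D_v f x.
Proof.
move=> /derivable1_diffP dhf hE df.
have dhf' := differentiable_comp df dhf; split => //.
rewrite deriveE// diff_comp//= -hE deriveE// (deriveE v df).
by rewrite -[X in 'd h _ X]mulr1 linearZ/= mulrC.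
Qed.

(* The outer function only has to be C^1 on the range of the inner one. *)
Lemma C1_comp (h dh : R -> R) f : (forall x, is_derive (f x) 1 (h : R^o -> R^o) (dh (f x))) ->
  (forall x, {for f x, continuous dh}) -> C1 f ->
  C1 (fun x => h (f x)) /\
  forall x v, 'D_v (fun y => h (f y) : R^o) x = dh (f x) * 'D_v f x.
Proof.
move=> hdh cdh cf.
have H x v : differentiable (fun y => h (f y) : R^o) x /\
  'D_v (fun y => h (f y) : R^o) x = dh (f x) * 'D_v f x.
  by apply: C1_comp_derive; [exact: (@ex_derive _ _ _ _ _ _ _ (hdh x))
    |exact: derive_val|exact: cf.1].
split; last by move=> x v; exact: (H x v).2.
split; first by move=> x; exact: (H x 0).1.
move=> v; have -> : (fun x => 'D_v (fun y => h (f y) : R^o) x) =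
    (fun x => dh (f x) * 'D_v f x) by apply/funext => x; exact: (H x v).2.
move=> x; apply: cvgM; last exact: (cf.2 v x).
by apply: (continuous_comp (f := f) (g := dh)); [exact: (C1_continuous cf)|exact: cdh].
Qed.

End C1_calculus.

Section C1_affine.
Context {R : realType} {V W : normedModType R}.
Variables (l : {linear V -> W}) (c : W).
Hypothesis cl : continuous l.

Lemma derive_affine (f : W -> R^o) (x v : V) :
  'D_v (fun y => f (l y + c)) x = 'D_(l v) f (l x + c).
Proof.
rewrite /derive.
have -> // : (fun h : R => h^-1 *: (((fun y => f (l y + c)) \o shift x) (h *: v) - f (l x + c))) =
  (fun h : R => h^-1 *: ((f \o shift (l x + c)) (h *: l v) - f (l x + c))).
by apply/funext => h /=; rewrite linearP addrA.
Qed.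

Lemma C1_affine (f : W -> R^o) : C1 f -> C1 (fun x => f (l x + c)).
Proof.
move=> cf; have dl x : differentiable (fun y => l y + c) x.
  by apply: differentiableD => //; exact: linear_differentiable.
split; first by move=> x; exact: (differentiable_comp (dl x) (cf.1 _)).
move=> v; have -> : (fun x => 'D_v (fun y => f (l y + c)) x) = fun x => 'D_(l v) f (l x + c).
  by apply/funext => x; exact: derive_affine.
move=> x; apply: (continuous_comp (f := fun y => l y + c) (g := fun y => 'D_(l v) f y)).
  exact: differentiable_continuous.
exact: (cf.2 (l v)).
Qed.

End C1_affine.

Section compact_support.
Context {R : realType} {V : normedModType R}.
Implicit Types (f g : V -> R^o) (x v : V) (K U : set V).

Lemma C1c_intro U K f : C1 f -> compact K -> K `<=` U ->
  (forall x, ~ K x -> f x = 0) -> C1c U f.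
Proof.
move=> cf cK KU f0.
have sK : closure [set x | f x != 0] `<=` K.
  rewrite [X in _ `<=` X](closure_id K).1; last exact: compact_closed (@norm_hausdorff _ _) cK.
  by apply: closureS => x /= fx; apply: contrapT => /f0; exact/eqP.
split => //; last exact: subset_trans sK KU.
by apply: subclosed_compact sK => //; exact: closed_closure.
Qed.

Lemma compact_support_bounded K f : continuous f -> compact K ->
  (forall x, ~ K x -> f x = 0) -> exists M : R, forall x, `|f x| <= M.
Proof.
move=> cf cK f0.
have : compact (f @` K) by apply: continuous_compact => //; exact: continuous_subspaceT.
move=> /compact_bounded[M [_ /(_ (M + 1))]].
rewrite ltrDl => /(_ ltr01) fM; exists (Num.max (M + 1) 0) => x.
have [Kx|/f0 ->] := pselect (K x); last by rewrite normr0 le_max lexx orbT.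
by rewrite le_max; apply/orP; left; apply: fM; exists x.
Qed.

Lemma C1c_eq0 U f x : C1c U f -> ~ closure [set x | f x != 0] x -> f x = 0.
Proof.
move=> _; apply: contra_notP => /eqP fx; exact: subset_closure.
Qed.

Lemma C1c_derive_eq0 U f x v : C1c U f -> ~ closure [set x | f x != 0] x ->
  'D_v f x = 0.
Proof.
move=> cf ncx; rewrite -[RHS](derive_cst (0 : R^o) x v); apply: near_eq_derive.
have : open (~` closure [set x | f x != 0]) by apply: closed_openC; exact: closed_closure.
rewrite openE => /(_ x ncx); apply: filterS => y ncy.
exact: C1c_eq0 cf ncy.
Qed.

Lemma C1c_bounded U f : C1c U f -> exists M : R, forall x, `|f x| <= M.
Proof.
move=> cf; have [c1 cK _] := cf.
apply: (compact_support_bounded (K := closure [set x | f x != 0])) => //.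
  exact: C1_continuous.
by move=> x; exact: C1c_eq0 cf.
Qed.

Lemma C1c_derive_bounded U f v : C1c U f -> exists M : R, forall x, `|'D_v f x| <= M.
Proof.
move=> cf; have [c1 cK _] := cf.
apply: (compact_support_bounded (K := closure [set x | f x != 0])) => //.
  exact: c1.2.
by move=> x; exact: C1c_derive_eq0 cf.
Qed.

Lemma C1cM U f g : C1c U f -> C1 g -> C1c U (fun x => f x * g x).
Proof.
move=> cf cg; have [c1 cK KU] := cf.
apply: (C1c_intro (K := closure [set x | f x != 0])) => //; first exact: C1M.
by move=> x ncx; rewrite (C1c_eq0 cf ncx) mul0r.
Qed.

Lemma C1c_sub U U' f : C1c U f -> U `<=` U' -> C1c U' f.
Proof. by move=> [c1 cK KU] UU'; split => //; exact: subset_trans UU'. Qed.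

(** One-dimensional mean value theorem along the segment. The intermediate point is kept on the
    segment so that gradient bounds valid only in a ball can be used. *)
Lemma C1_mvt f x y : C1 f -> exists2 s, 0 <= s <= 1 &
  f y - f x = 'D_(y - x) f (x + s *: (y - x)).
Proof.
move=> cf; pose v := y - x.
pose a (s : R^o) : V := s *: v + x.
have da (s : R^o) : is_diff s a (fun h : R^o => h *: v).
  have H := @is_diffD R R^o V ( *:%R ^~ v) (cst x) ( *:%R ^~ v) 0 s
    (@is_diff_scalel R V s v) (@is_diff_cst R R^o V x s).
  have -> : (fun h : R^o => h *: v) = ( *:%R ^~ v : R^o -> V) + 0.
    by apply/funext => h; rewrite !fctE addr0.
  exact: H.
pose g (s : R) : R := f (a s).
have dg (s : R) : is_derive s 1 g ('D_v f (x + s *: v)).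
  have ea : differentiable a (s : R^o) by exact: (@ex_diff _ _ _ _ _ _ _ (da s)).
  have dfa : differentiable (g : R^o -> R^o) (s : R^o) := differentiable_comp ea (cf.1 (a s)).
  have gE : 'd (g : R^o -> R^o) (s : R^o) = 'd f (a s) \o 'd a (s : R^o) :> (R^o -> R^o) :=
    diff_comp ea (cf.1 (a s)).
  apply: DeriveDef; first exact: diff_derivable.
  rewrite (deriveE _ dfa) gE /= (@diff_val _ _ _ _ _ _ _ (da s)) scale1r.
  by rewrite /a addrC deriveE//; exact: cf.1.
have cg : {within `[0, 1], continuous g}.
  apply: continuous_subspaceT => s; apply: differentiable_continuous.
  by apply/derivable1_diffP; exact: (@ex_derive _ _ _ _ _ _ _ (dg s)).
have [s] := MVT_segment ler01 (fun s _ => dg s) cg.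
rewrite in_itv/= => s01; rewrite subr0 mulr1 /g /a scale1r scale0r add0r subrK => E.
by exists s.
Qed.

End compact_support.

Section coordinates.
Context {R : realType} {n : nat}.
Implicit Types (f : 'rV[R]_n -> R^o) (x v : 'rV[R]_n).

Lemma derive_coord (i : 'I_n) x v : 'D_v (fun x : 'rV[R]_n => x ord0 i : R^o) x = v ord0 i.
Proof.
rewrite /derive.
apply: (cvg_lim (@norm_hausdorff R R^o)); apply: cvg_near_cst.
near=> h.
have h0 : h != 0 by near: h; exact: nbhs_dnbhs_neq.
rewrite /= !mxE addrK -[h^-1 *: _]/(h^-1 * (h * _)).
by rewrite mulKf.
Unshelve. all: by end_near. Qed.

Lemma C1_coord (i : 'I_n) : C1 (fun x : 'rV[R]_n => x ord0 i : R^o).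
Proof.
split; first by move=> x; exact: differentiable_coord.
move=> v.
have -> : (fun x => 'D_v (fun x : 'rV[R]_n => x ord0 i : R^o) x) = cst (v ord0 i).
  by apply/funext => x; rewrite derive_coord.
exact: cst_continuous.
Qed.

Lemma derive_row f x v : C1 f ->
  'D_v f x = \sum_(i < n) v ord0 i * 'D_(basis_vec i) f x.
Proof.
move=> cf; rewrite deriveE; last exact: cf.1.
rewrite {1}[v]row_sum_delta linear_sum; apply: eq_bigr => i _.
by rewrite linearZ/= deriveE//; exact: cf.1.
Qed.

Lemma C1_snd (W : normedModType R) f : C1 f -> C1 (fun p : W * 'rV[R]_n => f p.2).
Proof.
move=> cf; have -> : (fun p : W * 'rV[R]_n => f p.2) = (fun p => f (snd p + 0)).
  by apply/funext => p; rewrite addr0.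
by apply: C1_affine cf => p; exact: cvg_snd.
Qed.

Lemma C1_fst (W : normedModType R) (f : W -> R^o) : C1 f -> C1 (fun p : W * 'rV[R]_n => f p.1).
Proof.
move=> cf; have -> : (fun p : W * 'rV[R]_n => f p.1) = (fun p => f (fst p + 0)).
  by apply/funext => p; rewrite addr0.
by apply: C1_affine cf => p; exact: cvg_fst.
Qed.

Lemma derive_snd (W : normedModType R) f (p v : W * 'rV[R]_n) :
  'D_v (fun p : W * 'rV[R]_n => f p.2) p = 'D_(v.2) f p.2.
Proof.
have -> : (fun p : W * 'rV[R]_n => f p.2) = (fun p => f (snd p + 0)).
  by apply/funext => q; rewrite addr0.
by rewrite derive_affine addr0.
Qed.

Lemma derive_fst (W : normedModType R) (f : W -> R^o) (p v : W * 'rV[R]_n) :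
  'D_v (fun p : W * 'rV[R]_n => f p.1) p = 'D_(v.1) f p.1.
Proof.
have -> : (fun p : W * 'rV[R]_n => f p.1) = (fun p => f (fst p + 0)).
  by apply/funext => q; rewrite addr0.
by rewrite derive_affine addr0.
Qed.

End coordinates.

(** * An explicit C^1 step in one variable *)

Section one_dim.
Context {R : realType}.

(** Piecewise quadratic functions with continuous derivative satisfy such a bound at their
    breakpoints too, so one-sided limits need not be compared. *)
Lemma is_derive_quadratic (F : R -> R) (t d C : R) :
  (forall h, `|F (t + h) - F t - h * d| <= C * h ^+ 2) ->
  is_derive t 1 (F : R^o -> R^o) d.
Proof.
move=> FC.
have H : h^-1 *: ((F \o shift t) (h *: (1 : R^o)) - F t) @[h --> 0^'] --> (d : R^o).
  apply/cvgrPdist_le => e e0; near=> h.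
  have h0 : h != 0 by near: h; exact: nbhs_dnbhs_neq.
  have hC : `|h| * `|C| <= e.
    have : `|h| <= e / (`|C| + 1).
      by near: h; apply: dnbhs0_le; rewrite divr_gt0// ltr_wpDl.
    rewrite ler_pdivlMr ?ltr_wpDl//.
    by apply: le_trans; rewrite ler_wpM2l// lerDl.
  apply: le_trans hC.
  rewrite /= [h *: _]mulr1 -[h^-1 *: _]/(h^-1 * _) [h + t]addrC.
  rewrite -(ler_pM2l (x := `|h|)) ?normr_gt0// -normrM mulrBr mulrA divff// mul1r.
  have -> : `|h| * (`|h| * `|C|) = `|C| * h ^+ 2.
    by rewrite mulrA -normrM -expr2 ger0_norm ?sqr_ge0// mulrC.
  by rewrite distrC (le_trans (FC h))// ler_wpM2r ?sqr_ge0// ler_norm.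
apply: DeriveDef; first by apply/cvg_ex; exists d.
exact: (cvg_lim (@norm_hausdorff R R^o) H).
Unshelve. all: by end_near. Qed.

Definition sq_pos (t : R) : R := (Num.max t 0) ^+ 2 / 2.

Lemma is_derive_sq_pos (t : R) : is_derive t 1 sq_pos (Num.max t 0).
Proof.
apply: (@is_derive_quadratic _ _ _ 1) => h; rewrite mul1r /sq_pos ler_norml.
by case: (leP t 0) => ?; case: (leP (t + h) 0) => ?; apply/andP; split; nra.
Qed.

(* The C^1 step from 0 to 1 is a second difference of [sq_pos], so its
   derivative is the hat function [hat] and its integer translates telescope. *)
Definition step (t : R) : R := sq_pos (t + 1) - 2 * sq_pos t + sq_pos (t - 1).

Definition hat (t : R) : R := Num.max (t + 1) 0 - 2 * Num.max t 0 + Num.max (t - 1) 0.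

Lemma is_derive_step (t : R) : is_derive t 1 step (hat t).
Proof.
have H (c : R) : is_derive t 1 (fun t => sq_pos (t + c)) (Num.max (t + c) 0).
  apply: (@is_derive_quadratic _ _ _ 1) => h; rewrite mul1r /sq_pos ler_norml.
  by case: (leP (t + c) 0) => ?; case: (leP (t + h + c) 0) => ?; apply/andP; split; nra.
exact: (is_deriveD (is_deriveB (H 1) (is_deriveZ 2 (is_derive_sq_pos t))) (H (- 1))).
Qed.

Lemma continuous_hat : continuous hat.
Proof.
have H0 : continuous (fun t : R => Num.max t 0).
  by move=> x; apply: (@continuous_max _ _ id (cst 0)); [exact: cvg_id|exact: cvg_cst].
have H (c : R) : continuous (fun t : R => Num.max (t + c) 0).
  move=> x; apply: (continuous_comp (f := fun t => t + c) (g := fun t => Num.max t 0)).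
    by apply: cvgD; [exact: cvg_id|exact: cvg_cst].
  exact: H0.
move=> x; apply: cvgD; last exact: (H (- 1)).
apply: cvgB; first exact: (H 1).
by apply: cvgM; [exact: cvg_cst|exact: H0].
Qed.

Lemma hat_ge0 t : 0 <= hat t.
Proof.
rewrite /hat; case: (leP (t + 1) 0) => ?; case: (leP t 0) => ?; case: (leP (t - 1) 0) => ?; lra.
Qed.

Lemma hat_le1 t : hat t <= 1.
Proof.
rewrite /hat; case: (leP (t + 1) 0) => ?; case: (leP t 0) => ?; case: (leP (t - 1) 0) => ?; lra.
Qed.

Lemma hat_eq0 t : 1 <= `|t| -> hat t = 0.
Proof.
rewrite ler_normr => /orP[]?; rewrite /hat;
case: (leP (t + 1) 0) => ?; case: (leP t 0) => ?; case: (leP (t - 1) 0) => ?; lra.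
Qed.

Lemma step0 t : t <= - 1 -> step t = 0.
Proof.
move=> ?; rewrite /step /sq_pos.
case: (leP (t + 1) 0) => ?; case: (leP t 0) => ?; case: (leP (t - 1) 0) => ?; lra.
Qed.

Lemma step1 t : 1 <= t -> step t = 1.
Proof.
move=> ?; rewrite /step /sq_pos.
by case: (leP (t + 1) 0) => ?; case: (leP t 0) => ?; case: (leP (t - 1) 0) => ?; nra.
Qed.

Lemma step_ge0 t : 0 <= step t.
Proof.
rewrite /step /sq_pos.
by case: (leP (t + 1) 0) => ?; case: (leP t 0) => ?; case: (leP (t - 1) 0) => ?; nra.
Qed.

Lemma step_le1 t : step t <= 1.
Proof.
rewrite /step /sq_pos.
by case: (leP (t + 1) 0) => ?; case: (leP t 0) => ?; case: (leP (t - 1) 0) => ?; nra.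
Qed.

Lemma step_gt0 t : - 1 < t -> 0 < step t.
Proof.
rewrite /step /sq_pos.
by case: (leP (t + 1) 0) => ?; case: (leP t 0) => ?; case: (leP (t - 1) 0) => ?; nra.
Qed.

Lemma step_nd s t : s <= t -> step s <= step t.
Proof.
rewrite le_eqVlt => /predU1P[->//|st].
have cstep : {within `[s, t], continuous step}.
  apply: continuous_subspaceT => x; apply: differentiable_continuous.
  by apply/derivable1_diffP; exact: (@ex_derive _ _ _ _ _ _ _ (is_derive_step x)).
have [c _ E] := MVT st (fun x _ => is_derive_step x) cstep.
by rewrite -subr_ge0 E mulr_ge0 ?hat_ge0// subr_ge0 ltW.
Qed.

Lemma step_lip s t : `|step t - step s| <= `|t - s|.
Proof.
wlog st : s t / s <= t.
  by move=> H; have [/H//|/ltW/H] := leP s t; rewrite distrC [leRHS]distrC.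
have cstep : {within `[s, t], continuous step}.
  apply: continuous_subspaceT => x; apply: differentiable_continuous.
  by apply/derivable1_diffP; exact: (@ex_derive _ _ _ _ _ _ _ (is_derive_step x)).
have [c _ E] := MVT_segment st (fun x _ => is_derive_step x) cstep.
by rewrite E normrM (ger0_norm (hat_ge0 _)) ler_piMl ?hat_le1.
Qed.

Lemma C1_step (V : normedModType R) (f : V -> R^o) : C1 f ->
  C1 (fun x => step (f x)) /\ forall x v, 'D_v (fun y => step (f y) : R^o) x = hat (f x) * 'D_v f x.
Proof.
by apply: C1_comp => x; [exact: is_derive_step|exact: continuous_hat].
Qed.

End one_dim.

(** * Norms, Lipschitz functions and their smooth approximation *)

Section log_sum_exp.
Context {R : realType} {T : Type}.
Variables (e : R) (m : nat).
Hypothesis e0 : 0 < e.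

(** A smooth substitute for the maximum of the [g j]; the parameter e measures the error. *)
Definition lse (g : 'I_m.+1 -> T -> R) (x : T) : R :=
  e * ln (\sum_(j < m.+1) expR (g j x / e)).

Implicit Types (g : 'I_m.+1 -> T -> R) (x y : T).

Lemma sum_expR_gt0 (a : 'I_m.+1 -> R) : 0 < \sum_(j < m.+1) expR (a j).
Proof.
rewrite big_ord_recl ltr_pwDl ?expR_gt0//.
by apply: sumr_ge0 => i _; exact: expR_ge0.
Qed.

Lemma lse_ge g j x : g j x <= lse g x.
Proof.
rewrite /lse -ler_pdivrMl// mulrC -ler_expR lnK ?posrE ?sum_expR_gt0//.
by rewrite (bigD1 j)//= lerDl; apply: sumr_ge0 => i _; exact: expR_ge0.
Qed.

(** The sum has [m + 1] terms, and [m + 1 <= exp m] gives the error [e * m] in place of the sharp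
    [e * ln (m + 1)]. *)
Lemma lse_le g x B : (forall j, g j x <= B) -> lse g x <= B + e * m%:R.
Proof.
move=> gB; rewrite /lse -ler_pdivlMl// mulrC -ler_expR lnK ?posrE ?sum_expR_gt0//.
rewrite mulrDl mulrAC divff ?gt_eqF// mul1r expRD.
apply: (@le_trans _ _ (\sum_(j < m.+1) expR (B / e))).
  by apply: ler_sum => j _; rewrite ler_expR ler_pM2r ?invr_gt0.
rewrite sumr_const card_ord -[X in X <= _]mulr_natr ler_wpM2l ?expR_ge0//.
by rewrite -natr1 addrC expR_ge1Dx.
Qed.

(** The soft maximum is monotone and commutes with the addition of constants; this makes it inherit
    a common Lipschitz constant of the family without loss. *)
Lemma lse_le_shift g x y c : (forall j, g j x <= g j y + c) -> lse g x <= lse g y + c.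
Proof.
move=> gc; rewrite /lse -lerBlDr -ler_pdivrMl// mulrBr mulKf ?gt_eqF//.
rewrite lerBlDr -ler_expR expRD !lnK ?posrE ?sum_expR_gt0// mulr_suml.
apply: ler_sum => j _; rewrite -expRD ler_expR [e^-1 * c]mulrC -mulrDl.
by rewrite ler_pM2r ?invr_gt0.
Qed.

Lemma lse_lip g x y c : (forall j, `|g j x - g j y| <= c) -> `|lse g x - lse g y| <= c.
Proof.
move=> gc; rewrite ler_distl lerBlDr.
by apply/andP; split; apply: lse_le_shift => j; move: (gc j);
  rewrite ler_distl lerBlDr => /andP[].
Qed.

End log_sum_exp.

Lemma C1_lse (R : realType) (V : normedModType R) (e : R) (m : nat)
    (g : 'I_m.+1 -> V -> R^o) : 0 < e -> (forall j, C1 (g j)) ->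
  C1 (lse e g : V -> R^o).
Proof.
move=> e0 cg.
have cs : C1 (fun x : V => \sum_(j < m.+1) expR (g j x / e) : R^o).
  apply: C1_sum => j.
  have cge : C1 (fun x => g j x / e : R^o).
    have := C1Z e^-1 (cg j); congr C1; apply/funext => x; exact: mulrC.
  apply: (C1_comp (h := expR) (dh := expR) _ _ cge).1 => x; last exact: continuous_expR.
have H1 (x : V) : is_derive (\sum_(j < m.+1) expR (g j x / e)) 1 (@ln R)
    (\sum_(j < m.+1) expR (g j x / e))^-1.
  exact: is_derive1_ln (sum_expR_gt0 _).
have H2 (x : V) : {for \sum_(j < m.+1) expR (g j x / e), continuous (@GRing.inv R)}.
  by apply: inv_continuous; rewrite gt_eqF// sum_expR_gt0.
exact: (C1Z e (C1_comp H1 H2 cs).1).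
Qed.

Lemma dist_le_continuous (R : realType) (V : normedModType R) (f : V -> R) (C : R) :
  0 <= C -> (forall x y, `|f x - f y| <= C * `|x - y|) -> continuous f.
Proof.
move=> C0 fC x; apply/cvgrPdist_le => e e0.
have C10 : 0 < C + 1 by rewrite ltr_wpDl.
have := @cvgr_dist_le _ _ _ (nbhs x) _ id x (@cvg_id _ (nbhs x)) (e / (C + 1)).
rewrite divr_gt0// => /(_ _ isT); apply: filterS => y.
rewrite ler_pdivlMr// => xy.
rewrite (le_trans (fC _ _))// (le_trans _ xy)// mulrC ler_wpM2l//.
by rewrite lerDl.
Qed.

Section norms.
Context {R : realType} {n : nat} {N : 'rV[R]_n -> R}.
Hypothesis hN : is_norm N.
Implicit Types (x y : 'rV[R]_n) (f g : 'rV[R]_n -> R).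

Lemma normN_ge0 x : 0 <= N x. Proof. by have [] := hN. Qed.

Lemma normNZ (a : R) x : N (a *: x) = `|a| * N x. Proof. by have [] := hN. Qed.

Lemma normND x y : N (x + y) <= N x + N y. Proof. by have [] := hN. Qed.

Lemma normN0 : N 0 = 0.
Proof. by have := normNZ 0 0; rewrite scale0r normr0 mul0r. Qed.

Lemma normNN x : N (- x) = N x.
Proof. by have := normNZ (-1) x; rewrite scaleN1r normrN1 mul1r. Qed.

Lemma normNB x y : N (x - y) = N (y - x).
Proof. by rewrite -normNN opprB. Qed.

Lemma normN_gt0 x : x != 0 -> 0 < N x.
Proof.
move=> x0; rewrite lt_neqAle normN_ge0 andbT eq_sym.
by apply: contra x0 => /eqP Nx; have [_ /(_ x Nx) -> _ _] := hN.
Qed.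

Lemma normN_sum (I : Type) (r : seq I) (F : I -> 'rV[R]_n) :
  N (\sum_(i <- r) F i) <= \sum_(i <- r) N (F i).
Proof.
elim: r => [|i r IH]; first by rewrite !big_nil normN0.
by rewrite !big_cons (le_trans (normND _ _))// lerD.
Qed.

Definition norm1 x : R := \sum_(i < n) `|x ord0 i|.

Definition KN : R := 1 + \sum_(i < n) N (basis_vec i).

Lemma KN_ge1 : 1 <= KN.
Proof. by rewrite lerDl; apply: sumr_ge0 => i _; exact: normN_ge0. Qed.

Lemma KN_ge0 : 0 <= KN. Proof. exact: le_trans KN_ge1. Qed.

Lemma le_basis_KN i : N (basis_vec i) <= KN.
Proof.
rewrite /KN (bigD1 i)//= addrCA lerDl addr_ge0//.
by apply: sumr_ge0 => j _; exact: normN_ge0.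
Qed.

Lemma normN_le1 x : N x <= KN * norm1 x.
Proof.
rewrite {1}[x]row_sum_delta (le_trans (normN_sum _ _))// mulr_sumr.
by apply: ler_sum => i _; rewrite normNZ mulrC ler_wpM2r// le_basis_KN.
Qed.

Lemma coord_le_norm x i : `|x ord0 i| <= `|x|.
Proof.
rewrite [leRHS]/Num.Def.normr/= mx_normrE.
exact: (le_bigmax _ (fun ij : 'I_1 * 'I_n => `|x ij.1 ij.2|) (ord0, i)).
Qed.

Lemma norm_le_norm1 x : `|x| <= norm1 x.
Proof.
rewrite [leLHS]/Num.Def.normr/= mx_normrE; apply/bigmax_leP; split.
  by apply: sumr_ge0 => i _.
move=> [i j] _ /=; rewrite (ord1 i) /norm1 (bigD1 j)//= lerDl.
by apply: sumr_ge0.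
Qed.

Lemma norm1_le_norm x : norm1 x <= n%:R * `|x|.
Proof.
rewrite mulr_natl -[X in _ *+ X]card_ord -sumr_const.
by apply: ler_sum => i _; exact: coord_le_norm.
Qed.

Lemma normN_le_norm : exists2 C : R, 0 <= C & forall x, N x <= C * `|x|.
Proof.
exists (KN * n%:R) => [|x]; first by rewrite mulr_ge0// KN_ge0.
rewrite (le_trans (normN_le1 x))// -mulrA ler_wpM2l ?KN_ge0//.
exact: norm1_le_norm.
Qed.

Lemma continuous_normN : continuous N.
Proof.
have [C C0 NC] := normN_le_norm; apply: (dist_le_continuous C0) => x y.
have tri a b : N a <= N b + N (a - b).
  by rewrite [leRHS]addrC -{1}(subrK b a) normND.
by rewrite (le_trans _ (NC _))// ler_distl lerBlDr tri normNB tri.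
Qed.

(** N attains a positive minimum on the unit sphere of the max norm, which is compact; homogeneity
    does the rest. *)
Lemma norm_le_normN : exists2 k : R, 0 < k & forall x, `|x| <= k * N x.
Proof.
pose S := [set x : 'rV[R]_n | `|x| = 1].
have cS : compact S.
  apply: bounded_closed_compact.
    exists 1; split; first exact: num_real.
    by move=> M M1 x /= ->; exact: ltW.
  have -> : S = (fun x : 'rV[R]_n => `|x|) @^-1` [set 1] by [].
  apply: closed_comp; last exact: closed_eq.
  by move=> x _; exact: norm_continuous.
(* The sphere is empty in dimension 0, where every vector is 0. *)
have [[x0 Sx0]|S0] := pselect (S !=set0); last first.
  exists 1 => // x; have [->|x0] := eqVneq x 0; first by rewrite normr0 normN0 mulr0.
  exfalso; apply: S0; exists (`|x|^-1 *: x); rewrite /S/= normrZ normrV ?unitfE ?normr_eq0//.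
  by rewrite normr_id mulVf// normr_eq0.
have [c /set_mem Sc cmin] := EVT_min_rV (ex_intro _ x0 Sx0) cS
  (continuous_subspaceT continuous_normN).
have c0 : c != 0 by apply/eqP => c0; move: Sc; rewrite /S/= c0 normr0 => /esym/eqP; rewrite oner_eq0.
exists (N c)^-1; first by rewrite invr_gt0 normN_gt0.
move=> x; have [->|nx0] := eqVneq x 0; first by rewrite normr0 normN0 mulr0.
have x_gt0 : 0 < `|x| by rewrite normr_gt0.
have : N c <= N (`|x|^-1 *: x).
  by apply: cmin; apply/mem_set; rewrite /S/= normrZ ger0_norm ?invr_ge0// mulVf// gt_eqF.
rewrite normNZ ger0_norm ?invr_ge0// ler_pdivlMl// => H.
by rewrite mulrC ler_pdivlMr ?normN_gt0.
Qed.

(* The constants [KN] and [kN] compare [N] with the l^1 norm. *)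
Definition kN : R := n%:R * projT1 (cid2 norm_le_normN).

Lemma norm1_le_N x : norm1 x <= kN * N x.
Proof.
rewrite /kN; case: cid2 => k k0 kP /=.
by rewrite (le_trans (norm1_le_norm x))// -mulrA ler_wpM2l.
Qed.

Lemma kN_ge0 : 0 <= kN.
Proof. by rewrite /kN; case: cid2 => k k0 kP /=; rewrite mulr_ge0// ltW. Qed.

Definition lipN (L : R) f := forall x y, `|f x - f y| <= L * N (x - y).

Definition bdd (M : R) f := forall x, `|f x| <= M.

Lemma lip_b_intro M L f : bdd M f -> lipN L f -> lip_b N f.
Proof. by move=> fM fL; split; [exists M|exists L]. Qed.

Lemma lip_bP f : lip_b N f -> exists C, [/\ 0 <= C, bdd C f & lipN C f].
Proof.
move=> [[M fM] [L fL]]; exists (Num.max `|M| `|L|); split.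
- by rewrite le_max normr_ge0.
- by move=> x; rewrite (le_trans (fM x))// le_max ler_norm.
- move=> x y; rewrite (le_trans (fL x y))// ler_wpM2r ?normN_ge0//.
  by rewrite le_max ler_norm orbT.
Qed.

Lemma lipN_le L L' f : L <= L' -> lipN L f -> lipN L' f.
Proof.
by move=> LL fL x y; rewrite (le_trans (fL x y))// ler_wpM2r ?normN_ge0.
Qed.

Lemma lipN_continuous L f : lipN L f -> continuous f.
Proof.
move=> fL; have [C C0 NC] := normN_le_norm.
have fL' : lipN `|L| f by apply: lipN_le fL; exact: ler_norm.
apply: (@dist_le_continuous _ _ _ (`|L| * C)) => [|x y]; first by rewrite mulr_ge0.
by rewrite (le_trans (fL' _ _))// -mulrA ler_wpM2l.
Qed.

Lemma lip_b_continuous f : lip_b N f -> continuous f.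
Proof. by move=> [_ [L]]; exact: lipN_continuous. Qed.

Lemma lip_b_lin (a : R) f g : lip_b N f -> lip_b N g -> lip_b N (fun x => a * f x + g x).
Proof.
move=> /lip_bP[C [C0 fC fL]] /lip_bP[C' [C0' gC gL]].
apply: (@lip_b_intro (`|a| * C + C') (`|a| * C + C')) => [x|x y].
  by rewrite (le_trans (ler_normD _ _))// normrM lerD// ler_wpM2l.
have -> : a * f x + g x - (a * f y + g y) = a * (f x - f y) + (g x - g y) by ring.
by rewrite (le_trans (ler_normD _ _))// normrM mulrDl -mulrA lerD// ler_wpM2l.
Qed.

Lemma lipN_mul C C' L L' f g : bdd C f -> lipN L f -> bdd C' g -> lipN L' g ->
  lipN (C * L' + C' * L) (fun x => f x * g x).
Proof.
move=> fC fL gC gL x y.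
have -> : f x * g x - f y * g y = f x * (g x - g y) + g y * (f x - f y) by ring.
rewrite (le_trans (ler_normD _ _))// !normrM mulrDl -!mulrA lerD// ler_pM//.
Qed.

Lemma lip_b_mul f g : lip_b N f -> lip_b N g -> lip_b N (fun x => f x * g x).
Proof.
move=> /lip_bP[C [C0 fC fL]] /lip_bP[C' [C0' gC gL]].
apply: (lip_b_intro (M := C * C')); last exact: (lipN_mul fC fL gC gL).
by move=> x; rewrite normrM ler_pM.
Qed.

Lemma lipN_coord i : lipN kN (fun x => x ord0 i).
Proof.
move=> x y; apply: le_trans (norm1_le_N _).
rewrite /norm1 (bigD1 i)//= !mxE lerDl.
by apply: sumr_ge0.
Qed.

Lemma lip_constP A L f : 0 <= L -> (forall x y, A x -> A y -> `|f x - f y| <= L * N (x - y)) ->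
  lip_const N A f <= L.
Proof.
move=> L0 fL; rewrite /lip_const; set S := [set r | _].
have [[r Sr]|S0] := pselect (S !=set0); last first.
  by have -> : S = set0 by [apply/eqP; apply: contra_notT S0 => /set0P]; rewrite sup0.
apply: ge_sup; first by exists r.
move=> _ [y [z [Ay Az yz ->]]]; rewrite ler_pdivrMr; first exact: fL.
by apply: normN_gt0; rewrite subr_eq0.
Qed.

Lemma lip_const_ge L f A x y : lipN L f -> A x -> A y ->
  `|f x - f y| <= lip_const N A f * N (x - y).
Proof.
move=> fL Ax Ay; have [->|xy] := eqVneq x y.
  by rewrite !subrr normr0 normN0 mulr0.
have Nxy : 0 < N (x - y) by apply: normN_gt0; rewrite subr_eq0.
rewrite -ler_pdivrMr//; apply: ub_le_sup; last by exists x, y.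
exists L => _ [y' [z' [_ _ yz' ->]]]; rewrite ler_pdivrMr; first exact: fL.
by apply: normN_gt0; rewrite subr_eq0.
Qed.

Lemma lip_const_ge0 A f : 0 <= lip_const N A f.
Proof.
rewrite /lip_const; set S := [set r | _].
have [hS|nhS] := pselect (has_sup S); last by rewrite sup_out.
have [[r Sr] ubS] := hS; apply: (@le_trans _ _ r); last exact: ub_le_sup.
by move: Sr => [y [z [_ _ _ ->]]]; rewrite divr_ge0// normN_ge0.
Qed.

Lemma lip_b_norm_le M L f : 0 <= M -> 0 <= L -> bdd M f -> lipN L f -> lip_b_norm N f <= M + L.
Proof.
move=> M0 L0 fM fL; rewrite lerD//; last by apply: lip_constP.
by apply: ge_sup; [exists `|f 0|; exists 0|move=> _ [x _ <-]; exact: fM].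
Qed.

Lemma lip_b_norm_ge C f : lip_b N f -> lip_b_norm N f <= C -> bdd C f /\ lipN C f.
Proof.
move=> /lip_bP[K [K0 fK fL]]; rewrite /lip_b_norm => fC.
have ub : has_ubound [set `|f x| | x in [set: 'rV[R]_n]] by exists K => _ [x _ <-].
have f1 : bdd (sup [set `|f x| | x in [set: 'rV[R]_n]]) f.
  by move=> x; apply: ub_le_sup => //; exists x.
have f2 : lipN (lip_const N setT f) f by move=> x y; exact: lip_const_ge fL _ _.
have s0 : 0 <= sup [set `|f x| | x in [set: 'rV[R]_n]] by apply: le_trans (f1 0).
split.
  by move=> x; rewrite (le_trans (f1 x))// (le_trans _ fC)// lerDl lip_const_ge0.
by apply: lipN_le f2; rewrite (le_trans _ fC)// lerDr.
Qed.

End norms.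

(** * Approximation of Lipschitz functions by C^1_c functions *)

Section smoothing.
Context {R : realType} {n : nat}.
Implicit Types (x y v : 'rV[R]_n).

Lemma norm1_ge0 x : 0 <= norm1 x.
Proof. exact: sumr_ge0. Qed.

(** A C^1 majorant of the l^1 norm: in each coordinate [|t|] is the maximum of t and -t, and this
    maximum is softened. It stands in for N, which need not be smooth; the constants [KN] and [kN]
    pay for the change of norm. *)
Definition softnorm (e : R) x : R :=
  \sum_(i < n) lse e (fun (j : 'I_2) x => (-1) ^+ j * x ord0 i) x.

Lemma softnorm_ge e x : 0 < e -> norm1 x <= softnorm e x.
Proof.
move=> e0; apply: ler_sum => i _; rewrite ler_norml lerNl; apply/andP; split.
  have := @lse_ge _ _ e 1 e0 (fun j x => (-1) ^+ j * x ord0 i) (Ordinal (isT : 1 < 2)%N) x.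
  by rewrite /= expr1 mulN1r.
have := @lse_ge _ _ e 1 e0 (fun j x => (-1) ^+ j * x ord0 i) (Ordinal (isT : 0 < 2)%N) x.
by rewrite /= expr0 mul1r.
Qed.

Lemma softnorm_le e x : 0 < e -> softnorm e x <= norm1 x + n%:R * e.
Proof.
move=> e0; rewrite mulr_natl -[X in _ *+ X]card_ord -sumr_const -big_split/=.
apply: ler_sum => i _; rewrite -[X in _ + X]mulr1.
apply: (@lse_le _ _ e 1) => // j.
by rewrite (le_trans (ler_norm _))// normrM normrX normrN1 expr1n mul1r.
Qed.

Lemma softnorm_dist e x y : 0 < e -> `|softnorm e x - softnorm e y| <= norm1 (x - y).
Proof.
move=> e0; rewrite /softnorm -sumrB (le_trans (ler_norm_sum _ _ _))//.
apply: ler_sum => i _; apply: lse_lip => // j.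
by rewrite -mulrBr normrM normrX normrN1 expr1n mul1r !mxE.
Qed.

Lemma C1_softnorm e : 0 < e -> C1 (softnorm e : _ -> R^o).
Proof.
move=> e0; apply: C1_sum => i; apply: C1_lse => // j.
exact: (C1Z _ (C1_coord i)).
Qed.

(** Equal to 1 where [softnorm 1 x <= k] and to 0 where [softnorm 1 x >= k + 2]. *)
Definition cutoff (k : nat) x : R := step (k%:R + 1 - softnorm 1 x).

Lemma C1_cutoff_derive k : C1 (cutoff k : _ -> R^o) /\
  forall x v, 'D_v (cutoff k : _ -> R^o) x =
    hat (k%:R + 1 - softnorm 1 x) * 'D_v (fun x => k%:R + 1 - softnorm 1 x : R^o) x.
Proof.
apply: C1_step; apply: C1D; first exact: C1_cst.
by apply: C1N; exact: C1_softnorm.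
Qed.

Lemma cutoff_ge0 k x : 0 <= cutoff k x. Proof. exact: step_ge0. Qed.

Lemma cutoff_le1 k x : cutoff k x <= 1. Proof. exact: step_le1. Qed.

Lemma norm_cutoff_le1 k x : `|cutoff k x| <= 1.
Proof. by rewrite ger0_norm ?cutoff_ge0// cutoff_le1. Qed.

Lemma compact_softnorm_le (c : R) : compact [set x : 'rV[R]_n | softnorm 1 x <= c].
Proof.
apply: bounded_closed_compact.
  exists c; split; first exact: num_real.
  move=> M cM x /= xc; rewrite (le_trans (norm_le_norm1 x))//.
  by rewrite (le_trans (softnorm_ge _ ltr01))// (le_trans xc)// ltW.
have -> : [set x | softnorm 1 x <= c] = softnorm 1 @^-1` [set t | t <= c] by [].
apply: closed_comp; last exact: closed_le.
by move=> x _; apply: (C1_continuous (C1_softnorm ltr01)).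
Qed.

Lemma C1c_cutoff k : C1c setT (cutoff k : _ -> R^o).
Proof.
apply: (C1c_intro (K := [set x | softnorm 1 x <= k%:R + 2])) => //.
- exact: (C1_cutoff_derive k).1.
- exact: compact_softnorm_le.
- move=> x /= /negP; rewrite -ltNge => xk; apply: step0; lra.
Qed.

Lemma near_cutoff x : \forall k \near \oo, cutoff k x = 1 /\
  forall v, 'D_v (cutoff k : _ -> R^o) x = 0.
Proof.
have := @nbhs_infty_ger R (softnorm 1 x); apply: filterS => k kx; split.
  by apply: step1; lra.
move=> v; rewrite (C1_cutoff_derive k).2 hat_eq0 ?mul0r//.
by rewrite ler_normr; apply/orP; left; lra.
Qed.

(** An enumeration of the rational points; codes of no vector give 0. *)
Definition rat_point (j : nat) : 'rV[R]_n :=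
  map_mx ratr (odflt 0 (unpickle j : option 'rV[rat]_n)).

Lemma rat_point_dense x (e : R) : 0 < e -> exists j, norm1 (x - rat_point j) <= e.
Proof.
move=> e0; pose d := e / (n%:R + 1).
have d0 : 0 < d by rewrite divr_gt0// ltr_wpDl.
have /choice[q qP] : forall i : 'I_n, exists q : rat, `|x ord0 i - ratr q| <= d.
  move=> i.
  have : x ord0 i - d < x ord0 i + d by lra.
  move=> /rat_in_itvoo[q]; rewrite in_itv/= => /andP[? ?]; exists q.
  by rewrite ler_norml; apply/andP; split; lra.
exists (pickle (\row_i q i)); rewrite /rat_point pickleK /=.
apply: (@le_trans _ _ (\sum_(i < n) d)).
  by apply: ler_sum => i _; rewrite !mxE.
rewrite sumr_const card_ord -mulr_natr mulrC /d mulrA.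
by rewrite ler_pdivrMr ?ltr_wpDl// mulrC mulrDr mulr1 lerDl ltW.
Qed.

Context {N : 'rV[R]_n -> R}.
Hypothesis hN : is_norm N.

Lemma lipN_cutoff k : lipN (N := N) (kN hN) (cutoff k).
Proof.
move=> x y; rewrite (le_trans (step_lip _ _))//.
have -> : k%:R + 1 - softnorm 1 x - (k%:R + 1 - softnorm 1 y) =
  softnorm 1 y - softnorm 1 x by ring.
by rewrite distrC (le_trans (softnorm_dist _ _ ltr01))// norm1_le_N.
Qed.

Lemma C1_lip_derive (f : 'rV[R]_n -> R^o) L x v : C1 f -> lipN (N := N) L f ->
  `|'D_v f x| <= L * N v.
Proof.
move=> cf fL; have df := @C1_derivable _ _ _ x v cf.
have <- := cvg_lim (@norm_hausdorff R R^o) (cvg_norm df).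
apply: limr_le; first by apply/cvg_ex; exists `|'D_v f x|; exact: cvg_norm df.
near=> h.
have h0 : h != 0 by near: h; exact: nbhs_dnbhs_neq.
rewrite /= -[h^-1 *: _]/(h^-1 * _) normrM normfV ler_pdivrMl ?normr_gt0//.
by rewrite (le_trans (fL _ _))// addrK (normNZ hN) mulrCA.
Unshelve. all: by end_near. Qed.

Lemma C1_partial_lip (f : 'rV[R]_n -> R^o) M : C1 f -> 0 <= M ->
  (forall i x, `|'D_(basis_vec i) f x| <= M) -> lipN (N := N) (M * kN hN) f.
Proof.
move=> cf M0 fM x y; have [s _ ->] := C1_mvt y x cf.
rewrite derive_row// (le_trans (ler_norm_sum _ _ _))// -mulrA.
apply: (@le_trans _ _ (M * norm1 (x - y))); last by rewrite ler_wpM2l// norm1_le_N.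
by rewrite mulr_sumr; apply: ler_sum => i _; rewrite normrM mulrC ler_wpM2r.
Qed.

Lemma C1c_partials_bounded U (f : 'rV[R]_n -> R^o) : C1c U f ->
  exists2 M : R, 0 <= M & forall i x, `|'D_(basis_vec i) f x| <= M.
Proof.
move=> cf; have [M MP] := choice (fun i => C1c_derive_bounded (basis_vec i) cf).
exists (\sum_i `|M i|) => [|i x]; first exact: sumr_ge0.
rewrite (le_trans (MP i x))// (bigD1 i)//= (le_trans (ler_norm _))// lerDl.
exact: sumr_ge0.
Qed.

Lemma C1c_lip_b U (f : 'rV[R]_n -> R^o) : C1c U f -> lip_b N f.
Proof.
move=> cf; have [M fM] := C1c_bounded cf.
have [M' M'0 fM'] := C1c_partials_bounded cf; have [c1 _ _] := cf.
exact: (lip_b_intro fM (C1_partial_lip c1 M'0 fM')).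
Qed.

Section softmin.
Variables (f : 'rV[R]_n -> R) (M L : R).
Hypotheses (L0 : 0 <= L) (fM : bdd M f) (fL : lipN (N := N) L f).

(** The soft minimum of [k + 1] functions errs by at most [k * eps k], which this choice keeps below
    [1 / (k + 1)]. *)
Let eps (k : nat) : R := (k.+1%:R ^+ 2)^-1.

Let eps_gt0 k : 0 < eps k. Proof. by rewrite invr_gt0 exprn_gt0. Qed.

(** A cone of the McShane formula, with apex near [(z, f z)]. The factor [KN] makes its slope in the
    l^1 norm large enough for the cone to stay above f. *)
Let cone (k : nat) (z : 'rV[R]_n) x : R := f z + L * KN (N := N) * softnorm (eps k) (x - z).

(** Signs are reversed because [lse] is a soft maximum. Index 0 carries the constant M, which keeps
    the minimum bounded above far from the apexes. *)
Let family (k : nat) (j : 'I_k.+1) x : R :=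
  if val j is i.+1 then - cone k (rat_point i) x else - M.

Definition softmin (k : nat) x : R := - lse (eps k) (@family k) x.

Let LK0 : 0 <= L * KN (N := N). Proof. by rewrite mulr_ge0// (KN_ge0 hN). Qed.

Let cone_ge k z x : f x <= cone k z x.
Proof.
rewrite /cone -lerBlDl (le_trans (ler_norm _))// (le_trans (fL _ _))//.
rewrite -mulrA ler_wpM2l// (le_trans (normN_le1 hN _))// ler_wpM2l ?(KN_ge0 hN)//.
exact: softnorm_ge.
Qed.

Let family_le k j x : family (k := k) j x <= - f x.
Proof.
rewrite /family; case: (val j) => [|i]; rewrite lerN2; last exact: cone_ge.
by rewrite (le_trans (ler_norm _)).
Qed.

Lemma softmin_ge k x : f x - k.+1%:R^-1 <= softmin k x.
Proof.
rewrite /softmin lerNr opprB addrC.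
have h := @lse_le _ _ (eps k) k (eps_gt0 k) (@family k) x (- f x) (fun j => family_le j x).
apply: (le_trans h); rewrite lerD2l /eps expr2 invfM -mulrA ler_piMr ?invr_ge0//.
by rewrite ler_pdivrMl// mulr1 ler_nat.
Qed.

Lemma softmin_leM k x : softmin k x <= M.
Proof. by rewrite lerNl; exact: (@lse_ge _ _ (eps k) k (eps_gt0 k) (@family k) ord0 x). Qed.

Lemma softmin_le_cone k i x : (i < k)%N -> softmin k x <= cone k (rat_point i) x.
Proof.
move=> ik; rewrite lerNl.
exact: (@lse_ge _ _ (eps k) k (eps_gt0 k) (@family k) (Ordinal (ik : i.+1 < k.+1)%N) x).
Qed.

Lemma softmin_bdd k : bdd (M + 1) (softmin k).
Proof.
move=> x; rewrite ler_norml (le_trans (softmin_leM k x)) ?lerDl// andbT.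
rewrite (le_trans _ (softmin_ge k x))// opprD lerB//.
  by have := fM x; rewrite ler_norml => /andP[].
by rewrite invf_le1// ler1n.
Qed.

Lemma softmin_lip k : lipN (N := N) (L * KN (N := N) * kN hN) (softmin k).
Proof.
move=> x y; rewrite /softmin opprK addrC.
apply: lse_lip => // -[[|i] ik]; rewrite /family /=.
  rewrite subrr normr0; exact: mulr_ge0 (mulr_ge0 LK0 (kN_ge0 hN)) (normN_ge0 hN _).
have -> : - cone k (rat_point i) y - - cone k (rat_point i) x =
    L * KN (N := N) * (softnorm (eps k) (x - rat_point i) - softnorm (eps k) (y - rat_point i)).
  by rewrite /cone; ring.
rewrite normrM ger0_norm// -mulrA ler_wpM2l//.
rewrite (le_trans (softnorm_dist _ _ (eps_gt0 k)))// opprB addrA subrK.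
exact: norm1_le_N.
Qed.

Lemma C1_softmin k : C1 (softmin k : _ -> R^o).
Proof.
apply: C1N; apply: C1_lse => // -[[|i] ik]; rewrite /family /=; first exact: C1_cst.
apply: C1N; apply: C1D; first exact: C1_cst.
exact: (C1Z _ (@C1_affine _ _ _ idfun (- rat_point i) (fun x => @cvg_id _ (nbhs x)) _
  (C1_softnorm (eps_gt0 k)))).
Qed.

Lemma softmin_cvg x : softmin k x @[k --> \oo] --> f x.
Proof.
apply/cvgrPdist_le => e e0.
pose c := L * KN (N := N); have c0 : 0 <= c by [].
(* The cone at a rational point within d of x exceeds [f x] by at most [2 * c * d] from the distance
   and [c * n * w] from the softening. Each is at most [e / 2]; the summands 1 keep the denominators
   positive when c is 0. *)
pose d := e / (2 * (2 * c + 1)); pose w := e / (2 * (c * n%:R + 1)).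
have d0 : 0 < d by rewrite divr_gt0// mulr_gt0// ltr_wpDl// mulr_ge0.
have cn0 : 0 <= c * n%:R by rewrite mulr_ge0.
have w0 : 0 < w by rewrite divr_gt0// mulr_gt0// ltr_wpDl.
have dE : 2 * (c * d) <= e / 2.
  have : d * (2 * (2 * c + 1)) = e by rewrite divfK// gt_eqF// mulr_gt0// ltr_wpDl// mulr_ge0.
  by move: d0; nra.
have wE : c * (n%:R * w) <= e / 2.
  have : w * (2 * (c * n%:R + 1)) = e by rewrite divfK// gt_eqF// mulr_gt0// ltr_wpDl.
  by move: w0; nra.
have [j zj] := rat_point_dense x d0.
have mw0 : 0 < Num.min e w by rewrite lt_min e0.
near=> k.
have kj : (j < k)%N by near: k; exists j.+1.
have : k.+1%:R^-1 < Num.min e w by near: k; exact: near_infty_natSinv_lt (PosNum mw0).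
rewrite lt_min => /andP[/ltW k1 /ltW k2].
have ek : eps k <= w.
  apply: le_trans k2.
  by rewrite /eps expr2 invfM ler_piMr ?invr_ge0// invf_le1// ler1n.
rewrite ler_distl; apply/andP; split; last first.
  by rewrite -lerBlDr (le_trans _ (softmin_ge k x))// lerB.
rewrite lerBlDr (le_trans (softmin_le_cone _ kj))// /cone -/c.
have Hz : f (rat_point j) <= f x + c * norm1 (x - rat_point j).
  rewrite -lerBlDl (le_trans (ler_norm _))// (le_trans (fL _ _))// (normNB hN).
  by rewrite -mulrA ler_wpM2l// (normN_le1 hN).
have Hs : c * softnorm (eps k) (x - rat_point j) <= c * d + c * (n%:R * w).
  rewrite -mulrDr ler_wpM2l// (le_trans (softnorm_le _ (eps_gt0 k)))// lerD//.
  by rewrite ler_wpM2l.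
have Hd : c * norm1 (x - rat_point j) <= c * d by rewrite ler_wpM2l.
move: Hz Hs Hd dE wE; lra.
Unshelve. all: by end_near. Qed.

End softmin.

(** The order of the quantifiers matters: C' is uniform over all f with bound C, and so is the
    domination of the charges built from the f_k. The last summand of C' is the product-rule
    constant for a cutoff times a soft minimum. *)
Lemma lip_b_C1c_approx (C : R) : exists C' : R, forall f : 'rV[R]_n -> R,
  bdd C f -> lipN (N := N) C f ->
  exists f_ : nat -> 'rV[R]_n -> R^o,
    [/\ forall k, C1c setT (f_ k), forall k, bdd C' (f_ k),
        forall k, lipN (N := N) C' (f_ k) & forall x, f_ k x @[k --> \oo] --> f x].
Proof.
pose C1 := `|C| * KN (N := N) * kN hN.
have kN0 := kN_ge0 hN; have C10 : 0 <= C1 := mulr_ge0 (mulr_ge0 (normr_ge0 C) (KN_ge0 hN)) kN0.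
have C20 : 0 <= (`|C| + 1) * kN hN by apply: (mulr_ge0 _ kN0); exact: addr_ge0.
exists (`|C| + 1 + (1 * C1 + (`|C| + 1) * kN hN)) => f fC fL.
have fC' : bdd `|C| f by move=> x; rewrite (le_trans (fC x))// ler_norm.
have fL' : lipN (N := N) `|C| f by apply: lipN_le fL => //; exact: ler_norm.
have [bc lc] := (softmin_bdd (normr_ge0 C) fC' fL', softmin_lip f `|C| (normr_ge0 C)).
exists (fun k x => cutoff k x * softmin f `|C| `|C| k x); split.
- by move=> k; exact: (C1cM (C1c_cutoff k) (C1_softmin f `|C| `|C| k)).
- move=> k x; rewrite normrM; apply: (@le_trans _ _ (1 * (`|C| + 1))).
    exact: ler_pM (normr_ge0 _) (normr_ge0 _) (norm_cutoff_le1 k x) (bc k x).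
  by rewrite mul1r lerDl mul1r addr_ge0.
- move=> k; have := lipN_mul (norm_cutoff_le1 k) (lipN_cutoff k) (bc k) (lc k).
  by apply: lipN_le => //; rewrite lerDr addr_ge0.
- move=> x; rewrite -[f x]mul1r; apply: cvgM; last exact: softmin_cvg.
  apply: cvg_near_cst; have := near_cutoff x; apply: filterS => k [] //.
Qed.

End smoothing.

(** * Test functions on the slab determine charges *)

Section spacetime_measurability.
Context {R : realType} {n : nat}.

Lemma spacetime_open_measurable (A : set (R * 'rV[R]_n)) : open A ->
  measurable (A : set (spacetime R n)).
Proof. by move=> oA; apply: sub_sigma_algebra. Qed.

Lemma open_slab (T : R) : open (slab n T).
Proof.
have -> : slab n T = fst @^-1` `]0, T[.
  by apply/seteqP; split => [[t x] []//|[t x] ?]; split.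
apply: open_comp; last exact: interval_open.
by move=> p _; exact: cvg_fst.
Qed.

Lemma measurable_slab (T : R) : measurable (slab n T : set (spacetime R n)).
Proof. by apply: spacetime_open_measurable; exact: open_slab. Qed.

Lemma spacetime_continuous_measurable (D : set (R * 'rV[R]_n)) (f : R * 'rV[R]_n -> R) :
  open D -> {in D, continuous f} -> measurable_fun (D : set (spacetime R n)) f.
Proof.
move=> oD cf; apply: (measurability _ (RGenOpens.measurableE R)).
move=> _ [_ [a [b ->] <-]]; apply: spacetime_open_measurable.
rewrite openE => p [Dp fp]; apply: filterI.
  by apply: open_nbhs_nbhs; split.
apply: (cf p (mem_set Dp)); exact: open_nbhs_nbhs.
Qed.

Lemma spacetime_continuous_bmeas (f : R * 'rV[R]_n -> R) (M : R) :
  continuous f -> (forall p, `|f p| <= M) -> bmeas (f : spacetime R n -> R).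
Proof.
move=> cf fM; split; last by exists M.
by apply: spacetime_continuous_measurable; [exact: openT|move=> p _; exact: cf].
Qed.

Lemma C1c_bmeas U (f : R^o * 'rV[R]_n -> R^o) : C1c U f -> bmeas (f : spacetime R n -> R).
Proof.
move=> cf; have [M fM] := C1c_bounded cf; have [c1 _ _] := cf.
exact: (@spacetime_continuous_bmeas f M (C1_continuous c1) fM).
Qed.

Lemma C1c_derive_bmeas U (f : R^o * 'rV[R]_n -> R^o) v : C1c U f ->
  bmeas ((fun p => 'D_v f p) : spacetime R n -> R).
Proof.
move=> cf; have [M fM] := C1c_derive_bounded v cf; have [c1 _ _] := cf.
exact: (@spacetime_continuous_bmeas (fun p => 'D_v f p) M (c1.2 v) fM).
Qed.

Lemma bmeas_snd (f : 'rV[R]_n -> R) (M : R) : continuous f -> (forall x, `|f x| <= M) ->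
  bmeas ((fun p => f p.2) : spacetime R n -> R).
Proof.
move=> cf fM; apply: (@spacetime_continuous_bmeas (fun p => f p.2) M) => // p.
by apply: (continuous_comp (f := snd)); [exact: cvg_snd|exact: cf].
Qed.

Lemma bmeas_fst (f : R -> R) (M : R) : continuous f -> (forall x, `|f x| <= M) ->
  bmeas ((fun p => f p.1) : spacetime R n -> R).
Proof.
move=> cf fM; apply: (@spacetime_continuous_bmeas (fun p => f p.1) M) => // p.
by apply: (continuous_comp (f := fst)); [exact: cvg_fst|exact: cf].
Qed.

Lemma C1c_outside (T : R) (f : R^o * 'rV[R]_n -> R^o) p : C1c (slab n T) f ->
  ~ slab n T p -> f p = 0.
Proof.
move=> cf np; apply: (C1c_eq0 cf); have [_ _ sub] := cf.
by move=> /sub.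
Qed.

Lemma C1c_derive_outside (T : R) (f : R^o * 'rV[R]_n -> R^o) p v : C1c (slab n T) f ->
  ~ slab n T p -> 'D_v f p = 0.
Proof.
move=> cf np; apply: (C1c_derive_eq0 _ cf); have [_ _ sub] := cf.
by move=> /sub.
Qed.

End spacetime_measurability.

Lemma indicB (U : Type) (R : realType) (A B : set U) : B `<=` A ->
  \1_(A `\` B) = (fun x => -1 * \1_B x + \1_A x) :> (U -> R).
Proof.
move=> BA; apply/funext => x; rewrite mulN1r addrC !indicE.
have [Bx|Bx] := pselect (B x).
  by rewrite (mem_set Bx) (mem_set (BA _ Bx)) memNset ?subrr// => -[].
rewrite (memNset Bx) subr0; have [Ax|Ax] := pselect (A x).
  by rewrite !mem_set.
by rewrite !memNset// => -[].
Qed.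

(** * Monotone class theorem with C^1_c test functions *)

Section slab_class.
Context {R : realType} {n : nat}.
Variable T : R.
Local Notation ST := (R^o * 'rV[R]_n)%type.
Local Notation SR := (R * 'rV[R]_n)%type.

Lemma C1_id : C1 (fun t : R^o => t).
Proof.
split=> // v; have -> : (fun t : R^o => 'D_v (fun t : R^o => t) t) = cst v.
  by apply/funext => t; rewrite derive_id.
exact: cst_continuous.
Qed.

(** In time it vanishes within [1 / (k + 1)] of either end of the interval, and the time factors are
    1 at distance [3 / (k + 1)] from both. *)
Definition slab_cutoff (k : nat) (p : ST) : R^o :=
  step (k.+1%:R * p.1 - 2) * step (k.+1%:R * (T - p.1) - 2) * cutoff k p.2.

Lemma C1c_slab_cutoff k : C1c (slab n T) (slab_cutoff k).
Proof.
have k0 : 0 < k.+1%:R :> R by rewrite ltr0n.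
pose K : set ST := `[k.+1%:R^-1, T - k.+1%:R^-1] `*` [set x | softnorm 1 x <= k%:R + 2].
apply: (C1c_intro (K := K)).
- apply: C1M; last exact: (@C1_snd R n R^o (cutoff k) (C1_cutoff_derive k).1).
  apply: C1M.
    apply: (@C1_fst R n R^o (fun t : R^o => step (k.+1%:R * t - 2) : R^o)).
    by apply: (C1_step _).1; apply: C1D; [apply: C1Z; exact: C1_id|exact: C1_cst].
  apply: (@C1_fst R n R^o (fun t : R^o => step (k.+1%:R * (T - t) - 2) : R^o)).
  apply: (C1_step _).1; apply: C1D; last exact: C1_cst.
  by apply: C1Z; apply: C1D; [exact: C1_cst|apply: C1N; exact: C1_id].
- by apply: compact_setX; [exact: segment_compact|exact: compact_softnorm_le].
- move=> [t x] [/=]; rewrite in_itv/= => /andP[t1 t2] _; split => //=.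
  have i0 : 0 < k.+1%:R^-1 :> R by rewrite invr_gt0.
  by rewrite in_itv/= (lt_le_trans i0 t1)/= (le_lt_trans t2)// gtrBl.
- suff H (t : R) x : ~ K (t, x) -> slab_cutoff k (t, x) = 0 by move=> [t x]; exact: H.
  move=> nK; rewrite /slab_cutoff/=.
  have [t1|t1] := leP t k.+1%:R^-1.
    have : k.+1%:R * t <= 1 by rewrite mulrC -ler_pdivlMr ?div1r.
    by move=> ?; rewrite step0 ?mul0r//; lra.
  have [t2|t2] := leP (T - k.+1%:R^-1) t.
    have : k.+1%:R * (T - t) <= 1 by rewrite mulrC -ler_pdivlMr// div1r lerBlDr -lerBlDl.
    move: (k.+1%:R * (T - t)) => z z1.
    by rewrite (@step0 _ (z - 2)) ?mulr0 ?mul0r//; lra.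
  have [x1|x1] := leP (softnorm 1 x) (k%:R + 2).
    by exfalso; apply: nK; split => //=; rewrite in_itv/= !ltW.
  by rewrite /cutoff (@step0 _ (k%:R + 1 - softnorm 1 x)) ?mulr0//; lra.
Qed.

Lemma slab_cutoff_ge0 k p : 0 <= slab_cutoff k p.
Proof. by rewrite !mulr_ge0// ?step_ge0. Qed.

Lemma slab_cutoff_le1 k p : slab_cutoff k p <= 1.
Proof.
by rewrite mulr_ile1// ?mulr_ge0 ?step_ge0 ?mulr_ile1 ?step_ge0 ?step_le1// ?cutoff_le1.
Qed.

Lemma near_slab_cutoff p : slab n T p -> \forall k \near \oo, slab_cutoff k p = 1.
Proof.
case: p => t x; move: (t : R) => {}t [/=]; rewrite in_itv/= => /andP[t0 tT] _.
have Tt : 0 < T - t by lra.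
near=> k.
have c1 : cutoff k x = 1.
  by near: k; have := near_cutoff x; apply: filterS => k [].
have k1 : 3 / t <= k%:R by near: k; exact: nbhs_infty_ger.
have k2 : 3 / (T - t) <= k%:R by near: k; exact: nbhs_infty_ger.
have H (s : R) : 0 < s -> 3 / s <= k%:R -> 1 <= k.+1%:R * s - 2.
  by move=> s0; rewrite ler_pdivrMr// -[k.+1%:R]natr1; nra.
by rewrite /slab_cutoff/= c1 (step1 (H _ t0 k1)) (step1 (H _ Tt k2)) !mul1r.
Unshelve. all: by end_near. Qed.

(** Squared Euclidean distance, chosen because it is a polynomial and hence C^1. *)
Definition sqdist (c p : SR) : R := (p.1 - c.1) ^+ 2 + \sum_(i < n) (p.2 ord0 i - c.2 ord0 i) ^+ 2.

Lemma C1_sqdist c : C1 (sqdist c : ST -> R^o).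
Proof.
apply: C1D.
  apply: (@C1_fst R n R^o (fun t : R^o => (t - c.1) ^+ 2 : R^o)).
  by apply: C1M; apply: C1D; solve [exact: C1_id|exact: C1_cst].
apply: C1_sum => i.
apply: (@C1_snd R n R^o (fun x => (x ord0 i - c.2 ord0 i) ^+ 2 : R^o)).
by apply: C1M; apply: C1D; solve [exact: C1_coord|exact: C1_cst].
Qed.

(* Positive exactly on the ball of center [c] and radius [r * sqrt 2]. *)
Definition bump (c : SR) (r : R) (p : SR) : R := step (1 - r ^- 2 * sqdist c p).

Lemma C1_bump c r : C1 (bump c r : ST -> R^o).
Proof.
apply: (C1_step _).1; apply: C1D; first exact: C1_cst.
by apply: C1N; apply: C1Z; exact: C1_sqdist.
Qed.

Lemma bump_neq0 c r p : 0 < r -> bump c r p != 0 -> sqdist c p < 2 * r ^+ 2.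
Proof.
move=> r0; apply: contra_neqT; rewrite -leNgt => h; apply: step0.
have : 2 <= r ^- 2 * sqdist c p by rewrite mulrC ler_pdivlMr// exprn_gt0.
by lra.
Qed.

Lemma bump_center c r p : 0 < r -> sqdist c p < r ^+ 2 -> bump c r p != 0.
Proof.
move=> r0 h; have h1 : r ^- 2 * sqdist c p < 1.
  by rewrite mulrC ltr_pdivrMr ?exprn_gt0// mul1r.
by rewrite gt_eqF// step_gt0// ltrBrDl -ltrBrDr opprK (lt_trans h1)// ltrDl.
Qed.

Lemma sqdist_fst c p r : 0 < r -> sqdist c p <= 2 * r ^+ 2 -> `|p.1 - c.1| <= 2 * r.
Proof.
move=> r0 h; have r2 : 0 <= 2 * r by rewrite mulr_ge0// ltW.
rewrite -ler_sqr ?nnegrE// real_normK ?num_real//.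
apply: (@le_trans _ _ (2 * r ^+ 2)); last by nra.
by apply: le_trans h; rewrite lerDl; apply: sumr_ge0 => i _; exact: sqr_ge0.
Qed.

Lemma sqdist_snd c p r i : 0 < r -> sqdist c p <= 2 * r ^+ 2 ->
  `|p.2 ord0 i - c.2 ord0 i| <= 2 * r.
Proof.
move=> r0 h; have r2 : 0 <= 2 * r by rewrite mulr_ge0// ltW.
rewrite -ler_sqr ?nnegrE// real_normK ?num_real//.
apply: (@le_trans _ _ (2 * r ^+ 2)); last by nra.
apply: le_trans h; rewrite /sqdist (bigD1 i)//= addrCA lerDl addr_ge0 ?sqr_ge0//.
by apply: sumr_ge0 => j _; exact: sqr_ge0.
Qed.

Lemma compact_sqdist c r : 0 < r -> compact [set p : ST | sqdist c p <= 2 * r ^+ 2].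
Proof.
move=> r0.
pose K : set SR := `[c.1 - 2 * r, c.1 + 2 * r] `*`
  [set x : 'rV[R]_n | forall i, x ord0 i \in `[c.2 ord0 i - 2 * r, c.2 ord0 i + 2 * r]].
have cK : compact K.
  apply: compact_setX; first exact: segment_compact.
  apply: (@rV_compact R n (fun i => `[c.2 ord0 i - 2 * r, c.2 ord0 i + 2 * r]%classic)) => i.
  exact: segment_compact.
apply: (subclosed_compact _ cK).
  have -> : [set p | sqdist c p <= 2 * r ^+ 2] = sqdist c @^-1` [set t | t <= 2 * r ^+ 2] by [].
  apply: closed_comp; last exact: closed_le.
  by move=> x _; apply: (C1_continuous (C1_sqdist c)).
move=> p h; split => [|i] /=; rewrite in_itv/= -ler_distl.
  exact: sqdist_fst h.
exact: sqdist_snd h.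
Qed.

Lemma C1c_bump c r (W : set ST) : 0 < r -> [set p | sqdist c p <= 2 * r ^+ 2] `<=` W ->
  C1c W (bump c r : ST -> R^o).
Proof.
move=> r0 cW; apply: C1c_intro cW _; [exact: C1_bump|exact: compact_sqdist|].
by move=> p; apply: contra_notP => /eqP /(bump_neq0 r0) /ltW.
Qed.

Lemma sqdist_le c p : sqdist c p <= (`|p.1 - c.1| + norm1 (p.2 - c.2)) ^+ 2.
Proof.
have H : \sum_(i < n) (p.2 ord0 i - c.2 ord0 i) ^+ 2 <= norm1 (p.2 - c.2) ^+ 2.
  rewrite expr2 {1}/norm1 mulr_suml; apply: ler_sum => i _.
  have -> : p.2 ord0 i - c.2 ord0 i = (p.2 - c.2) ord0 i by rewrite !mxE.
  rewrite -[leLHS]real_normK ?num_real// expr2 ler_wpM2l//.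
  by rewrite /norm1 (bigD1 i)//= lerDl; exact: sumr_ge0.
rewrite sqrrD real_normK ?num_real// -addrA lerD2l (le_trans H)// lerDr.
by rewrite mulrn_wge0// mulr_ge0// norm1_ge0.
Qed.

(** Enumerates centres and radii of a countable base of the topology; codes of no triple give a
    default ball. *)
Definition coded_center (j : nat) : SR * R :=
  let c := odflt (0, 0, 0%N) (unpickle j : option (rat * 'rV[rat]_n * nat)) in
  ((ratr c.1.1, map_mx ratr c.1.2), c.2.+1%:R^-1).

Lemma coded_center_gt0 j : 0 < (coded_center j).2.
Proof. by rewrite /= invr_gt0. Qed.

Lemma coded_center_open (W : set SR) p : open W -> W p -> exists j,
  sqdist (coded_center j).1 p < (coded_center j).2 ^+ 2 /\
  [set p | sqdist (coded_center j).1 p <= 2 * (coded_center j).2 ^+ 2] `<=` W.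
Proof.
rewrite openE => /(_ p) /[apply] /nbhs_ballP[d /= d0 pW].
(* With [r < d / 4] and a centre within [r / 4] of p in time and in space, p lies within [r / 2] of
   the centre. The closed set reaches at most [2 * r] from the centre in each coordinate, and
   [2 * r + r / 4 < d]. *)
have d40 : 0 < d / 4 by rewrite divr_gt0.
have [k _ /(_ k (leqnn k)) /= kd] := near_infty_natSinv_lt (PosNum d40).
pose r : R := k.+1%:R^-1; have r0 : 0 < r by rewrite invr_gt0.
have r40 : 0 < r / 4 by rewrite divr_gt0.
have [q qP] : exists q : rat, `|p.1 - ratr q| <= r / 4.
  have : (p.1 : R) - r / 4 < p.1 + r / 4 by lra.
  move=> /rat_in_itvoo[q]; rewrite in_itv/= => /andP[q1 q2]; exists q.
  by rewrite ler_distlC !ltW.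
have [m mP] := rat_point_dense p.2 r40.
pose z : 'rV[rat]_n := odflt 0 (unpickle m).
exists (pickle (q, z, k)); rewrite /coded_center pickleK /=.
have small : `|p.1 - ratr q| + norm1 (p.2 - map_mx ratr z) <= r / 2.
  by rewrite (le_trans (lerD qP mP))//; lra.
split.
  apply: (le_lt_trans (sqdist_le _ _)).
  apply: (@le_lt_trans _ _ ((r / 2) ^+ 2)).
    by rewrite ler_sqr ?nnegrE ?addr_ge0 ?norm1_ge0// divr_ge0// ltW.
  by rewrite ltr_sqr ?nnegrE ?divr_ge0 ?(ltW r0)// ltr_pdivrMr// ltr_pMr// ltr1n.
move=> p' /= h'; apply: pW; split => /=.
  have := sqdist_fst r0 h'; rewrite /= => h1.
  rewrite /ball/= -(subrK (ratr q) (p.1 : R)) -addrA (le_lt_trans (ler_normD _ _))//.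
  rewrite distrC in h1; rewrite (le_lt_trans (lerD qP h1))//.
  by move: kd; rewrite -/r; lra.
split => // i j; rewrite (ord1 i).
have := sqdist_snd j r0 h'; rewrite /= !mxE => h1.
have h2 : `|p.2 ord0 j - ratr (z ord0 j)| <= r / 4.
  apply: le_trans mP; rewrite /norm1 (bigD1 j)//= !mxE lerDl; exact: sumr_ge0.
rewrite /ball/= -(subrK (ratr (z ord0 j)) (p.2 ord0 j)) -addrA (le_lt_trans (ler_normD _ _))//.
rewrite distrC in h1; rewrite (le_lt_trans (lerD h2 h1))//.
by move: kd; rewrite -/r; lra.
Qed.

(** A generator stable under intersection, because products of test functions are test functions. *)
Definition support_sets : set (set ST) :=
  [set A | exists2 phi : ST -> R^o, C1c (slab n T) phi & A = [set p | phi p != 0]].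

Lemma support_setsI : setI_closed support_sets.
Proof.
move=> _ _ [f cf ->] [g cg ->]; exists (fun p => f p * g p).
  by apply: C1cM cf _; have [] := cg.
apply/seteqP; split => p /=; rewrite mulf_eq0 negb_or; first by move=> [-> ->].
by move=> /andP[].
Qed.

(** Second countability: W is the countable union of the nonvanishing sets of the coded bumps that
    fit into W. *)
Lemma open_support_sets (W : set ST) : open W -> W `<=` slab n T -> <<s support_sets >> W.
Proof.
move=> oW Wslab.
pose valid j := [set p | sqdist (coded_center j).1 p <= 2 * (coded_center j).2 ^+ 2] `<=` W.
pose B j : set ST := if pselect (valid j) then
  [set p | bump (coded_center j).1 (coded_center j).2 p != 0] else set0.
have -> : W = \bigcup_j B j.
  apply/seteqP; split => [p Wp|p [j _]].
    have [j [h1 h2]] := coded_center_open oW Wp; exists j => //.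
    by rewrite /B; case: pselect => //= _; apply: bump_center => //; exact: coded_center_gt0.
  rewrite /B; case: pselect => //= vj.
  by move=> /(bump_neq0 (coded_center_gt0 j)) /ltW /vj.
apply: sigma_algebra_bigcup => j; rewrite /B; case: pselect => [vj|nv].
  apply: sub_sigma_algebra.
  exists (bump (coded_center j).1 (coded_center j).2) => //.
  apply: C1c_sub Wslab; apply: C1c_bump vj; exact: coded_center_gt0.
exact: sigma_algebra0.
Qed.

Lemma measurable_support_sets (A : set (spacetime R n)) : measurable A ->
  <<s support_sets >> (A `&` slab n T).
Proof.
have sS : <<s support_sets >> (slab n T) by apply: open_support_sets => //; exact: open_slab.
move: A; apply: smallest_sub; last first.
  by move=> A oA /=; apply: open_support_sets; [apply: openI => //; exact: open_slab|exact: subIsetr].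
split => /=.
- by rewrite set0I; exact: sigma_algebra0.
- move=> A hA; rewrite setTD.
  have -> : ~` A `&` slab n T = slab n T `\` (A `&` slab n T).
    by apply/seteqP; split => [p [nA sp]|p [sp nAs]]; split => //; [case|move=> Ap; apply: nAs].
  exact: (@measurableD _ (g_sigma_algebraType support_sets) _ _ sS hA).
- move=> F hF; rewrite setI_bigcupl; exact: sigma_algebra_bigcup.
Qed.

(** A pi-lambda argument over [support_sets] gives the indicators of Borel subsets of the slab;
    [bp_closed_ind] then gives all bounded functions. Whatever is stable under bounded pointwise
    limits is thus tested on C^1_c functions alone. *)
Lemma bp_closed_slab (P : (spacetime R n -> R) -> Prop) : bp_closed P ->
  (forall phi : ST -> R^o, C1c (slab n T) phi -> P phi) ->
  forall g : spacetime R n -> R, bmeas g -> P (g \_ (slab n T)).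
Proof.
move=> [Plin Plim] PC1.
have mS : measurable (slab n T : set (spacetime R n)) by exact: measurable_slab.
have bi (A : set (spacetime R n)) : measurable A -> bmeas (\1_A : _ -> R).
  exact: bmeas_indic.
(* The trace on the slab is taken inside H, so that the lambda-system lives on the whole space. *)
pose H : set (set (spacetime R n)) := [set A : set (spacetime R n) | measurable A /\ P (\1_(A `&` slab n T) : spacetime R n -> R)].
have Hsupp : support_sets `<=` H.
  move=> _ [phi cphi ->]; have [c1 _ _] := cphi.
  have ophi : open [set p | phi p != 0].
    have -> : [set p | phi p != 0] = phi @^-1` [set t | t != 0] by [].
    apply: open_comp; first by move=> p _; exact: (C1_continuous c1).
    exact: open_neq.
  have mphi : measurable ([set p | phi p != 0] : set (spacetime R n)).
    exact: spacetime_open_measurable.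
  (* Squaring phi ignores its sign. The shift by 1 makes [psi k] vanish where phi does, and
     [psi k p] equals 1 once [k * phi p ^+ 2 >= 2]. *)
  pose psi (k : nat) (p : ST) : R^o := step (k%:R * (phi p * phi p) - 1).
  split => //.
  have cpsi k : C1c (slab n T) (psi k).
    have [_ cK KU] := cphi; apply: (C1c_intro _ cK KU).
      apply: (C1_step _).1; apply: C1D; last exact: C1_cst.
      by apply: C1Z; exact: (C1M c1 c1).
    move=> p np; rewrite /psi (C1c_eq0 cphi np) !mulr0 sub0r.
    exact: step0.
  have -> : [set p | phi p != 0] `&` slab n T = [set p | phi p != 0].
    apply/setIidPl => p /= /eqP; apply: contra_notP; exact: C1c_outside.
  apply: (Plim psi).
  - by exists 1 => k p; rewrite ger0_norm ?step_ge0 ?step_le1.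
  - by move=> k; exact: (C1c_bmeas (cpsi k)).
  - by move=> k; exact: PC1.
  - move=> p; have [phi0|phi0] := eqVneq (phi p) 0.
      rewrite indicE memNset; last by rewrite /= phi0 eqxx.
      under eq_fun do rewrite /psi phi0 !mulr0 sub0r (step0 (lexx _)).
      exact: cvg_cst.
    rewrite indicE mem_set//.
    have q0 : 0 < (phi p : R) ^+ 2 by rewrite lt_neqAle sqr_ge0 andbT eq_sym sqrf_eq0.
    apply: cvg_near_cst; have := @nbhs_infty_ger R (2 / (phi p : R) ^+ 2).
    apply: filterS => k; rewrite ler_pdivrMr// => hk.
    by apply: step1; rewrite lerBrDl -expr2 (le_trans _ hk).
(* This puts the whole space into H. *)
have H1 : P (\1_(slab n T : set (spacetime R n)) : _ -> R).
  apply: (Plim slab_cutoff).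
  - by exists 1 => k p; rewrite ger0_norm ?slab_cutoff_ge0 ?slab_cutoff_le1.
  - by move=> k; exact: (C1c_bmeas (C1c_slab_cutoff k)).
  - by move=> k; apply: PC1; exact: C1c_slab_cutoff.
  - move=> p; have [Sp|Sp] := pselect (slab n T p).
      by rewrite indicE mem_set//; apply: cvg_near_cst; exact: near_slab_cutoff.
    rewrite indicE memNset//.
    under eq_fun do rewrite (C1c_outside (C1c_slab_cutoff _) Sp).
    exact: cvg_cst.
have Hlam : lambda_system setT H.
  split => [A []//| |A B AB [mA PA] [mB PB]|F ndF HF].
  - by split; rewrite ?setTI.
  - split; first exact: measurableD.
    have -> : (A `\` B) `&` slab n T = (A `&` slab n T) `\` (B `&` slab n T).
      by apply/seteqP; split => [p [[Ap nBp] Sp]|p [[Ap Sp] nBp]];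
        split => //; [case|split => // Bp; exact: nBp].
    rewrite indicB; last exact: setSI.
    by apply: Plin => //; apply: bi; exact: measurableI.
  - have mF k : measurable (F k) by have [] := HF k.
    split; first exact: bigcupT_measurable.
    apply: (Plim (fun k => \1_(F k `&` slab n T))).
    + by exists 1 => k p; rewrite indicE; case: (_ \in _); rewrite ?normr0 ?normr1.
    + by move=> k; apply: bi; exact: measurableI.
    + by move=> k; have [] := HF k.
    + move=> p; have [[[k _ Fp] Sp]|NF] := pselect ((\bigcup_k F k `&` slab n T) p).
        rewrite indicE mem_set; last by split => //; exists k.
        apply: cvg_near_cst; exists k => // j /= kj.
        rewrite indicE mem_set//; split => //.
        by have /subsetPset := ndF _ _ kj; exact.
      rewrite indicE memNset//.
      apply: cvg_near_cst; apply: nearW => k; rewrite indicE memNset// => -[Fp Sp].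
      by apply: NF; split => //; exists k.
have sub : <<s support_sets >> `<=` H.
  by apply: lambda_system_subset => //; exact: support_setsI.
have P'closed : bp_closed (fun g : spacetime R n -> R => P (g \_ (slab n T))).
  split.
    move=> a f g bf bg Pf Pg.
    have -> : (fun p => a * f p + g p) \_ (slab n T) =
        (fun p => a * (f \_ (slab n T)) p + (g \_ (slab n T)) p).
      by apply/funext => p; rewrite !patchE; case: ifPn; rewrite // mulr0 addr0.
    by apply: Plin => //; exact: bmeas_restrict.
  move=> g_ g [M gM] bg Pg gg; apply: (Plim (fun k => g_ k \_ (slab n T))) => //.
  - exists M => k p; rewrite patchE; case: ifPn => // _.
    by rewrite normr0; exact: le_trans (normr_ge0 _) (gM 0%N p).
  - by move=> k; exact: bmeas_restrict.
  - move=> p; rewrite /patch; case: ifPn => _; [exact: gg|exact: cvg_cst].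
apply: bp_closed_ind => // A mA.
have [_] := sub _ (measurable_support_sets mA).
rewrite -setIA setIid; congr P; apply/funext => p.
by rewrite patchE indicE in_setI; case: ifPn => Sp; rewrite ?andbT ?andbF.
Qed.

End slab_class.

Section slab_charges.
Context {R : realType} {n : nat} {T : R}.
Local Notation ST := (R^o * 'rV[R]_n)%type.
Local Notation X := (spacetime R n).
Implicit Types (s : {charge set X -> \bar R}) (g h : X -> R) (L : (X -> R) -> R).

Let mS : measurable (slab n T : set X) := measurable_slab T.

Lemma restrict_indic (A B : set X) : (\1_A : X -> R) \_ B = \1_(A `&` B).
Proof. by rewrite patch_indic indicI. Qed.

Lemma bp_fun_restrict L (A : set X) : measurable A -> bp_fun L -> bp_fun (fun g => L (g \_ A)).
Proof.
move=> mA bL; have -> : (fun g => L (g \_ A)) = fun g => L (fun p => \1_A p * g p).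
  by apply/funext => g; congr L; apply/funext => p; rewrite patch_indic mulrC.
by apply: bp_fun_mul => //; exact: bmeas_indic.
Qed.

Lemma cint_restrict_slab s g : on_slab T s -> bmeas g -> cint s (g \_ (slab n T)) = cint s g.
Proof.
move=> sT; apply: (bp_fun_eq (L := fun g => cint s (g \_ (slab n T))) (L' := cint s)).
- by apply: bp_fun_restrict => //; exact: bp_fun_cint.
- exact: bp_fun_cint.
- move=> A mA; rewrite restrict_indic !cint_indic//; last exact: measurableI.
  by rewrite (sT A mA).
Qed.

Lemma bp_fun_eq_slab L L' : bp_fun L -> bp_fun L' ->
  (forall phi : ST -> R^o, C1c (slab n T) phi -> L phi = L' phi) ->
  forall g, bmeas g -> L (g \_ (slab n T)) = L' (g \_ (slab n T)).
Proof.
by move=> bL bL' LL'; apply: (bp_closed_slab (P := fun g => L g = L' g)) => //; exact: bp_closed_eq.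
Qed.

(** The uniqueness principle behind the identities between charges on the slab: both sides are
    continuous, so test functions decide. *)
Lemma eq_charge_slab s (L : (X -> R) -> R) : on_slab T s -> bp_fun L ->
  (forall g, bmeas g -> L (g \_ (slab n T)) = L g) ->
  (forall phi : ST -> R^o, C1c (slab n T) phi -> cint s phi = L phi) ->
  forall g, bmeas g -> cint s g = L g.
Proof.
move=> sT bL LT sL g bg; rewrite -(cint_restrict_slab sT bg) -(LT _ bg).
by apply: bp_fun_eq_slab bg => //; exact: bp_fun_cint.
Qed.

Lemma restrict_C1c (phi : ST -> R^o) : C1c (slab n T) phi ->
  (phi : X -> R) \_ (slab n T) = phi.
Proof.
move=> cphi; apply/funext => p; rewrite patchE; case: ifPn => // /negP Sp.
by rewrite (C1c_outside cphi)// => /mem_set.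
Qed.

Lemma restrict_C1c_derive (phi : ST -> R^o) v : C1c (slab n T) phi ->
  ((fun p => 'D_v phi p) : X -> R) \_ (slab n T) = (fun p => 'D_v phi p).
Proof.
move=> cphi; apply/funext => p; rewrite patchE; case: ifPn => // /negP Sp.
by rewrite (C1c_derive_outside _ cphi)// => /mem_set.
Qed.

Lemma cint_charge_ext s s' : (forall A, measurable A -> s A = s' A) ->
  forall g, bmeas g -> cint s g = cint s' g.
Proof.
move=> ss'; apply: (cint_unique (L := cint s')); first exact: bp_fun_cint.
by move=> A mA; rewrite ss'// cint_indicE.
Qed.

Lemma restrict_mul_indic (A : set X) g : g \_ A = (fun p => g p * \1_A p).
Proof. by apply/funext => p; rewrite patch_indic. Qed.

End slab_charges.

Lemma cvg_sumr (R : realType) (I : Type) (r : seq I) (u : I -> nat -> R) (l : I -> R) :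
  (forall i, u i k @[k --> \oo] --> l i) ->
  \sum_(i <- r) u i k @[k --> \oo] --> \sum_(i <- r) l i.
Proof.
move=> ul; elim: r => [|i r IH].
  by rewrite big_nil; under eq_fun do rewrite big_nil; exact: cvg_cst.
by rewrite big_cons; under eq_fun do rewrite big_cons; exact: cvgD.
Qed.

(** * The derivation of a vector field *)

Section field_to_derivation.
Context {R : realType} {n : nat} {N : 'rV[R]_n -> R} {T : R}.
Hypothesis hN : is_norm N.
Variable mu : {finite_measure set (spacetime R n) -> \bar R}.
Variable nu : 'I_n -> {charge set (spacetime R n) -> \bar R}.
Hypothesis nuT : forall i, on_slab T (nu i).
Hypothesis munu : solves_field T mu nu.
Local Notation ST := (R^o * 'rV[R]_n)%type.
Local Notation X := (spacetime R n).
Implicit Types (f : 'rV[R]_n -> R) (g h : X -> R) (phi : ST -> R^o).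

Definition gradient_int f g : R :=
  \sum_(i < n) cint (nu i) (fun p => 'D_(basis_vec i) (f : _ -> R^o) p.2 * g p).

Definition field_norm g : R := \sum_(i < n) charge_norm (nu i) g.

Lemma bmeas_lip f : lip_b N f -> bmeas ((fun p => f p.2) : X -> R).
Proof.
move=> lf; have [[M fM] _] := lf.
exact: bmeas_snd (lip_b_continuous hN lf) fM.
Qed.

Lemma bmeas_gradient U f i : C1c U (f : _ -> R^o) ->
  bmeas ((fun p => 'D_(basis_vec i) (f : _ -> R^o) p.2) : X -> R).
Proof.
move=> cf; have [M fM] := C1c_derive_bounded (basis_vec i) cf.
have [c1 _ _] := cf; exact: bmeas_snd (c1.2 _) fM.
Qed.

Lemma bp_fun_gradient_int U f : C1c U (f : _ -> R^o) -> bp_fun (gradient_int f).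
Proof.
move=> cf; apply: bp_fun_bigsum => i; apply: bp_fun_mul; last exact: bp_fun_cint.
exact: bmeas_gradient cf.
Qed.

(** Each partial derivative is at most [L * KN], so the bound depends on f only through its
    Lipschitz constant. *)
Lemma gradient_int_le U f L g : C1c U (f : _ -> R^o) -> 0 <= L -> lipN (N := N) L f ->
  bmeas g -> `|gradient_int f g| <= L * KN (N := N) * field_norm g.
Proof.
move=> cf L0 fL bg; have [c1 _ _] := cf.
rewrite (le_trans (ler_norm_sum _ _ _))// mulr_sumr; apply: ler_sum => i _.
have bd : bmeas (fun p : X => 'D_(basis_vec i) (f : _ -> R^o) p.2 * g p).
  by apply: bmeasM => //; exact: bmeas_gradient cf.
have LK : 0 <= L * KN (N := N) by rewrite mulr_ge0// (KN_ge0 hN).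
rewrite (le_trans (cint_charge_norm _ bd))//.
rewrite -{1}(ger0_norm LK) -charge_normZ//; apply: le_charge_norm => //.
  exact: bmeasZ.
move=> p; rewrite !normrM; apply: ler_pM => //.
rewrite -normrM (ger0_norm LK) (le_trans (C1_lip_derive hN _ _ c1 fL))//.
by rewrite ler_wpM2l// (le_basis_KN hN).
Qed.

Lemma bp_gauge_field_norm (C : R) : bp_gauge (fun g => C * field_norm g).
Proof.
by apply: bp_gauge_scale; apply: bp_gauge_bigsum => i; exact: bp_gauge_charge_norm.
Qed.

(* Minus the distribution [f * (d_t phi dmu + grad phi . dnu)], which is
   [phi * grad f . dnu] for smooth [f] by the continuity equation. *)
Definition weak_int f phi : R :=
  - Rintegral mu setT (fun p => f p.2 * d_t phi p) -
  \sum_(i < n) cint (nu i) (fun p => f p.2 * d_x i phi p).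

Lemma derive_mul_snd phi f (p v : ST) : C1 phi -> C1 (f : _ -> R^o) ->
  'D_v (fun p : ST => phi p * f p.2 : R^o) p =
  phi p * 'D_(v.2) (f : _ -> R^o) p.2 + f p.2 * 'D_v phi p.
Proof.
move=> cphi cf; have cs : C1 (fun p : ST => f p.2 : R^o) by exact: (@C1_snd R n R^o _ cf).
by rewrite (derive_mul _ _ cphi cs) (@derive_snd R n R^o (f : _ -> R^o)).
Qed.

(** The equation is tested with [phi(t, x) f(x)]: the time derivative does not act on f, and the
    product rule splits the spatial part. *)
Lemma gradient_int_weak f phi : C1 (f : _ -> R^o) -> (exists U, C1c U (f : _ -> R^o)) ->
  C1c (slab n T) phi -> gradient_int f phi = weak_int f phi.
Proof.
move=> cf [U Uf] cphi; have [c1 _ _] := cphi.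
have cs : C1 (fun p : ST => f p.2 : R^o) by exact: (@C1_snd R n R^o _ cf).
have cpf : C1c (slab n T) (fun p : ST => phi p * f p.2 : R^o) := C1cM cphi cs.
have := munu cpf; rewrite Rintegral_mkcond.
rewrite (restrict_C1c_derive _ cpf) => H.
have bf : bmeas ((fun p => f p.2) : X -> R).
  by have [M fM] := C1c_bounded Uf; exact: bmeas_snd (C1_continuous cf) fM.
have E1 : Rintegral mu setT (fun p => 'D_((1 : R^o), (0 : 'rV[R]_n)) (fun p : ST => phi p * f p.2 : R^o) p) =
    Rintegral mu setT (fun p => f p.2 * d_t phi p).
  apply: eq_Rintegral => p _; rewrite derive_mul_snd//= derive0 mulr0 add0r.
  by [].
have E2 i : charge_int (nu i) (slab n T) (d_x i (fun p : ST => phi p * f p.2 : R^o)) =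
    cint (nu i) (fun p => 'D_(basis_vec i) (f : _ -> R^o) p.2 * phi p) +
    cint (nu i) (fun p => f p.2 * d_x i phi p).
  rewrite charge_int_restrict (restrict_C1c_derive _ cpf) -(bp_funD (bp_fun_cint (nu i))).
  - congr (cint (nu i)); apply/funext => p.
    by rewrite derive_mul_snd//= mulrC.
  - by apply: bmeasM; [exact: bmeas_gradient Uf|exact: C1c_bmeas cphi].
  - by apply: bmeasM => //; exact: C1c_derive_bmeas cphi.
move: H; rewrite E1; under eq_bigr do rewrite E2; rewrite big_split/=.
rewrite /weak_int /gradient_int => /eqP.
by rewrite addrCA addr_eq0 opprD => /eqP.
Qed.

Lemma weak_int_cvg (f_ : nat -> 'rV[R]_n -> R) f (C : R) phi :
  (forall k, continuous (f_ k)) -> (forall k, bdd C (f_ k)) ->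
  (forall x, f_ k x @[k --> \oo] --> f x) -> C1c (slab n T) phi ->
  weak_int (f_ k) phi @[k --> \oo] --> weak_int f phi.
Proof.
move=> cf fC ff cphi.
have H v L : bp_fun L ->
    L (fun p : X => f_ k p.2 * 'D_v phi p) @[k --> \oo] --> L (fun p : X => f p.2 * 'D_v phi p).
  move=> bL; apply: bL.2.
  - have [M phiM] := C1c_derive_bounded v cphi.
    exists (C * M) => k p; rewrite normrM.
    exact: ler_pM (normr_ge0 _) (normr_ge0 _) (fC k _) (phiM _).
  - move=> k; apply: bmeasM; last exact: C1c_derive_bmeas cphi.
    exact: bmeas_snd (cf k) (fC k).
  - by move=> p; apply: cvgM; [exact: ff|exact: cvg_cst].
apply: cvgB; first by apply: cvgN; apply: H; exact: bp_fun_Rintegral.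
by apply: cvg_sumr => i; apply: H; exact: bp_fun_cint.
Qed.

(** Absolute value taken, since the approximation constant comes from an existence statement that
    asserts no sign. *)
Definition dom_const (C : R) : R := `|projT1 (cid (lip_b_C1c_approx hN C))| * KN (N := N).

(** Characterises [D f] without reference to an approximating sequence, so that independence of the
    sequence is a uniqueness statement. *)
Definition weak_derivative f (s : {charge set X -> \bar R}) :=
  on_slab T s /\ forall phi, C1c (slab n T) phi -> cint s phi = weak_int f phi.

Lemma weak_derivative_uniq f s s' : weak_derivative f s -> weak_derivative f s' ->
  forall g, bmeas g -> cint s g = cint s' g.
Proof.
move=> [sT sf] [s'T s'f]; apply: (eq_charge_slab sT); first exact: bp_fun_cint.
- by move=> g; exact: cint_restrict_slab.
- by move=> phi cphi; rewrite sf// s'f.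
Qed.

(** On test functions the charges [grad f_k . nu] agree with [weak_int (f_ k)] and converge; the
    common gauge spreads this to all bounded Borel functions. Restriction to the slab is built into
    the functionals [L_], which puts the limit charge on the slab. *)
Lemma weak_derivative_exists_dom (C : R) f : bdd C f -> lipN (N := N) C f ->
  exists2 s, weak_derivative f s &
    forall g, bmeas g -> `|cint s g| <= dom_const C * field_norm (g \_ (slab n T)).
Proof.
move=> fC fL; rewrite /dom_const; case: cid => C' /= /(_ f fC fL)[f_ [cf bf lf ff]].
have lf' k : lipN (N := N) `|C'| (f_ k) by apply: (lipN_le hN _ (lf k)); exact: ler_norm.
have [mS bS] := (measurable_slab (n := n) T, fun g (bg : bmeas g) => bmeas_restrict (measurable_slab (n := n) T) bg).
have bG k := bp_fun_gradient_int (cf k).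
have dG k g (bg : bmeas g) := gradient_int_le (cf k) (normr_ge0 C') (lf' k) bg.
have gq := bp_gauge_field_norm (`|C'| * KN (N := N)).
have wG k phi : C1c (slab n T) phi -> gradient_int (f_ k) phi = weak_int (f_ k) phi.
  by move=> cphi; apply: gradient_int_weak => //; [have [] := cf k|exists setT].
have cG phi : C1c (slab n T) phi -> gradient_int (f_ k) phi @[k --> \oo] --> weak_int f phi.
  move=> cphi; under eq_fun do rewrite wG//.
  apply: (weak_int_cvg (C := C')) => // k; have [c1 _ _] := cf k.
  exact: C1_continuous c1.
have cvgG g : bmeas g -> cvg (gradient_int (f_ k) (g \_ (slab n T)) @[k --> \oo]).
  apply: (bp_closed_slab (P := fun g => cvg (gradient_int (f_ k) g @[k --> \oo]))).
    exact: bp_closed_cvg bG gq dG.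
  by move=> phi cphi; apply/cvg_ex; exists (weak_int f phi); exact: cG.
pose L_ k g := gradient_int (f_ k) (g \_ (slab n T)).
have bL k : bp_fun (L_ k) by exact: bp_fun_restrict.
have bL' : bp_fun (fun g => lim (L_ k g @[k --> \oo])).
  apply: (@bp_fun_lim _ _ _ L_ (fun g => `|C'| * KN (N := N) * field_norm (g \_ (slab n T)))) => //.
  - move=> g_ [M gM] bg gg; apply: (gq (fun k => g_ k \_ (slab n T))).
    + exists M => k p; rewrite patchE; case: ifPn => // _.
      by rewrite normr0; exact: le_trans (normr_ge0 _) (gM 0%N p).
    + by move=> k; exact: bS.
    + by move=> p; rewrite /patch; case: (boolP (p \in slab n T)) => _; [exact: gg|exact: cvg_cst].
  - by move=> k g bg; apply: dG; exact: bS.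
have [s sE] := charge_of_bp_fun bL'.
have cs := cint_unique bL' sE.
exists s; first split.
- move=> A mA; rewrite !sE//; last exact: measurableI.
  by rewrite /L_ !restrict_indic -setIA setIid.
- move=> phi cphi; rewrite cs; last exact: C1c_bmeas cphi.
  by apply: (cvg_lim (@Rhausdorff R)); rewrite /L_ (restrict_C1c cphi); exact: cG.
- move=> g bg; rewrite cs//.
  have <- := cvg_lim (@Rhausdorff R) (cvg_norm (cvgG _ bg)).
  apply: limr_le; last by apply: nearW => k; apply: dG; exact: bS.
  by apply/cvg_ex; exists `|lim (L_ k g @[k --> \oo])|; exact: cvg_norm (cvgG _ bg).
Qed.

End field_to_derivation.

Section field_to_derivation_theorem.
Context {R : realType} {n : nat} {N : 'rV[R]_n -> R} {T : R}.
Hypothesis hN : is_norm N.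
Variable mu : {finite_measure set (spacetime R n) -> \bar R}.
Hypothesis muT : on_slab T mu.
Variable nu : 'I_n -> {charge set (spacetime R n) -> \bar R}.
Hypothesis nuT : forall i, on_slab T (nu i).
Hypothesis munu : solves_field T mu nu.
Local Notation ST := (R^o * 'rV[R]_n)%type.
Local Notation X := (spacetime R n).
Implicit Types (f g : 'rV[R]_n -> R) (h : X -> R) (phi : ST -> R^o).

(** By uniqueness, every weak derivative of f inherits the bound of the constructed one. *)
Lemma weak_derivative_dominated (C : R) f s : bdd C f -> lipN (N := N) C f ->
  weak_derivative (T := T) mu nu f s ->
  forall h, bmeas h -> `|cint s h| <= dom_const hN C * field_norm nu (h \_ (slab n T)).
Proof.
move=> fC fL fs g bg; have [s' fs' ds'] := weak_derivative_exists_dom hN munu fC fL.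
by rewrite (weak_derivative_uniq fs fs')// ds'.
Qed.

Lemma weak_derivative_exists : exists D : ('rV[R]_n -> R) -> {charge set X -> \bar R},
  forall f, lip_b N f -> weak_derivative (T := T) mu nu f (D f).
Proof.
suff /choice[D DP] : forall f, exists s, lip_b N f -> weak_derivative (T := T) mu nu f s.
  by exists D.
move=> f; have [lf|nlf] := pselect (lip_b N f); last by exists czero.
have [C [_ fC fL]] := lip_bP hN lf.
by have [s fs _] := weak_derivative_exists_dom hN munu fC fL; exists s.
Qed.

Variable D : ('rV[R]_n -> R) -> {charge set X -> \bar R}.
Hypothesis DP : forall f, lip_b N f -> weak_derivative (T := T) mu nu f (D f).

Let mS : measurable (slab n T : set X) := measurable_slab T.

(** The domination constant depends on C alone, hence serves all [D (f_ k)] and [D f]; convergence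
    on test functions is [weak_int_cvg]. *)
Lemma weak_derivative_setwise_cvg (C : R) (f_ : nat -> 'rV[R]_n -> R) f :
  (forall k, bdd C (f_ k)) -> (forall k, lipN (N := N) C (f_ k)) ->
  bdd C f -> lipN (N := N) C f -> (forall x, f_ k x @[k --> \oo] --> f x) ->
  forall h, bmeas h -> cint (D (f_ k)) h @[k --> \oo] --> cint (D f) h.
Proof.
move=> bf lf fC fL ff.
have lbf k : lip_b N (f_ k) := lip_b_intro (bf k) (lf k).
have lb : lip_b N f := lip_b_intro fC fL.
have [DfT Df] := DP lb.
suff H : forall g : X -> R, bmeas g ->
    cint (D (f_ k)) (g \_ (slab n T)) @[k --> \oo] --> cint (D f) (g \_ (slab n T)).
  move=> g bg; have := H g bg; rewrite (cint_restrict_slab DfT bg).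
  by under eq_fun do rewrite (cint_restrict_slab (DP (lbf _)).1 bg).
have gq : bp_gauge (fun g : X -> R => dom_const hN C * field_norm nu (g \_ (slab n T))).
  move=> g_ [M gM] bg_ gg.
  apply: (bp_gauge_field_norm nu (dom_const hN C) (g_ := fun k => g_ k \_ (slab n T))).
  + exists M => k p; rewrite patchE; case: ifPn => // _.
    by rewrite normr0; exact: le_trans (normr_ge0 _) (gM 0%N p).
  + by move=> k; exact: bmeas_restrict.
  + by move=> p; rewrite /patch; case: (boolP (p \in slab n T)) => _; [exact: gg|exact: cvg_cst].
apply: (bp_closed_slab (P := fun g : X -> R => cint (D (f_ k)) g @[k --> \oo] --> cint (D f) g)).
  apply: bp_closed_cvg_to gq _ _ _ _.
  - by move=> k; exact: bp_fun_cint.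
  - by move=> k g' bg'; exact: weak_derivative_dominated (DP (lbf k)) g' bg'.
  - exact: bp_fun_cint.
  - by move=> g' bg'; exact: weak_derivative_dominated (DP lb) g' bg'.
move=> phi cphi; rewrite Df//; under eq_fun do rewrite (DP (lbf _)).2//.
apply: weak_int_cvg bf ff cphi => k; exact: lip_b_continuous (lbf k).
Qed.

Lemma weak_int_lin (a : R) f g phi : lip_b N f -> lip_b N g -> C1c (slab n T) phi ->
  weak_int mu nu (fun x => a * f x + g x) phi = a * weak_int mu nu f phi + weak_int mu nu g phi.
Proof.
move=> lf lg cphi.
have H v L : bp_fun L -> L (fun p : X => (a * f p.2 + g p.2) * 'D_v phi p) =
    a * L (fun p : X => f p.2 * 'D_v phi p) + L (fun p : X => g p.2 * 'D_v phi p).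
  move=> bL; rewrite -bL.1.
  - by congr L; apply/funext => p; rewrite mulrDl mulrA.
  - by apply: bmeasM; [exact: (bmeas_lip hN lf)|exact: C1c_derive_bmeas cphi].
  - by apply: bmeasM; [exact: (bmeas_lip hN lg)|exact: C1c_derive_bmeas cphi].
rewrite /weak_int (H _ _ (bp_fun_Rintegral mu)).
under eq_bigr => i _ do rewrite (H _ _ (bp_fun_cint (nu i))).
by rewrite big_split/= -mulr_sumr; ring.
Qed.

Lemma weak_derivative_linear (a : R) f g h : lip_b N f -> lip_b N g -> bmeas h ->
  cint (D (fun x => a * f x + g x)) h = a * cint (D f) h + cint (D g) h.
Proof.
move=> lf lg; have [Df Dfw] := DP lf; have [Dg Dgw] := DP lg.
have [Dl Dlw] := DP (lip_b_lin hN a lf lg).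
move: h; apply: (eq_charge_slab (L := fun h => a * cint (D f) h + cint (D g) h) Dl).
- by apply: bp_fun_add; [apply: bp_fun_scale|]; exact: bp_fun_cint.
- by move=> h bh; rewrite !cint_restrict_slab.
- by move=> phi cphi; rewrite Dlw// Dfw// Dgw// weak_int_lin.
Qed.

Lemma weak_derivative_smooth f h : C1c setT (f : _ -> R^o) -> bmeas h ->
  cint (D f) h = gradient_int nu f h.
Proof.
move=> cf; have [c1 _ _] := cf; have lf := C1c_lip_b hN cf; have [Df Dfw] := DP lf.
move: h; apply: (eq_charge_slab (L := gradient_int nu f) Df).
- exact: bp_fun_gradient_int cf.
- move=> h bh; apply: eq_bigr => i _.
  have bg := bmeas_gradient i cf.
  rewrite -[RHS](cint_restrict_slab (nuT i)); last exact: bmeasM.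
  congr (cint (nu i)); apply/funext => p; rewrite !patchE.
  by case: ifPn; rewrite // mulr0.
- by move=> phi cphi; rewrite Dfw// (gradient_int_weak munu c1 _ cphi)//; exists setT.
Qed.

Lemma lip_b_approx f : lip_b N f -> exists C : R, exists f_ : nat -> 'rV[R]_n -> R^o,
    [/\ forall k, C1c setT (f_ k), forall k, bdd C (f_ k) /\ lipN (N := N) C (f_ k),
        bdd C f /\ lipN (N := N) C f & forall x, f_ k x @[k --> \oo] --> f x].
Proof.
move=> lf; have [C [C0 fC fL]] := lip_bP hN lf.
have [C' /(_ f fC fL)[f_ [cf bf lf_ ff]]] := lip_b_C1c_approx hN C.
exists (Num.max C C'), f_; split => //.
- move=> k; split; first by move=> x; rewrite (le_trans (bf k x))// le_max lexx orbT.
  by apply: (lipN_le hN _ (lf_ k)); rewrite le_max lexx orbT.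
- split; first by move=> x; rewrite (le_trans (fC x))// le_max lexx.
  by apply: (lipN_le hN _ fL); rewrite le_max lexx.
Qed.

(** Only f is smoothed. Testing the weak derivative of g with [phi f_k] gives the rule for [f_k g];
    then [weak_int] converges pointwise under the integral, and [D (f_ k)] converges setwise. The
    function g stays Lipschitz throughout. *)
Lemma weak_derivative_leibniz f g h : lip_b N f -> lip_b N g -> bmeas h ->
  cint (D (fun x => f x * g x)) h =
  cint (D g) (fun p => f p.2 * h p) + cint (D f) (fun p => g p.2 * h p).
Proof.
move=> lf lg; have [Df Dfw] := DP lf; have [Dg Dgw] := DP lg.
have [Dl Dlw] := DP (lip_b_mul hN lf lg).
have [bf bg] := (bmeas_lip hN lf, bmeas_lip hN lg).
have rm (F h' : X -> R) : (fun p => F p * (h' \_ (slab n T)) p) =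
    (fun p => F p * h' p) \_ (slab n T).
  by apply/funext => p; rewrite !patchE; case: ifPn; rewrite // mulr0.
move: h; apply: (eq_charge_slab (L := fun h : X -> R => cint (D g) (fun p => f p.2 * h p) +
    cint (D f) (fun p => g p.2 * h p)) Dl).
- by apply: bp_fun_add; apply: bp_fun_mul => //; exact: bp_fun_cint.
- by move=> h bh; rewrite !rm !cint_restrict_slab//; exact: bmeasM.
move=> phi cphi; rewrite Dlw//.
have [C [f_ [cf bl [fC fL] ff]]] := lip_b_approx lf.
have bphi := C1c_bmeas cphi.
have lf_ k : lip_b N (f_ k) := C1c_lip_b hN (cf k).
have bf_ k := bmeas_lip hN (lf_ k).
have E k : cint (D g) (fun p => f_ k p.2 * phi p) =
    weak_int mu nu (fun x => f_ k x * g x) phi - cint (D (f_ k)) (fun p => g p.2 * phi p).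
  have [c1 _ _] := cf k; have [p1 _ _] := cphi.
  have cs : C1 (fun p : ST => f_ k p.2 : R^o) by exact: (@C1_snd R n R^o _ c1).
  have cpf : C1c (slab n T) (fun p : ST => phi p * f_ k p.2 : R^o) := C1cM cphi cs.
  rewrite (_ : (fun p => f_ k p.2 * phi p) = (fun p : ST => phi p * f_ k p.2 : R^o)); last first.
    by apply/funext => p; rewrite mulrC.
  rewrite Dgw// (weak_derivative_smooth (cf k)); last exact: bmeasM.
  (* The terms with derivatives of phi make up [weak_int] of the product [f_k g]; those with
     derivatives of f_k make up [D (f_ k)] tested with [g phi]. *)
  have dE (v p : ST) : g p.2 * 'D_v (fun p : ST => phi p * f_ k p.2 : R^o) p =
      f_ k p.2 * g p.2 * 'D_v phi p + 'D_(v.2) (f_ k) p.2 * (g p.2 * phi p).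
    by rewrite derive_mul_snd//; ring.
  have E1 : Rintegral mu setT (fun p => g p.2 * d_t (fun p : ST => phi p * f_ k p.2 : R^o) p) =
      Rintegral mu setT (fun p => f_ k p.2 * g p.2 * d_t phi p).
    by apply: eq_Rintegral => p _; rewrite [LHS]dE/= derive0 mul0r addr0.
  have E2 i : cint (nu i) (fun p => g p.2 * d_x i (fun p : ST => phi p * f_ k p.2 : R^o) p) =
      cint (nu i) (fun p => f_ k p.2 * g p.2 * d_x i phi p) +
      cint (nu i) (fun p => 'D_(basis_vec i) (f_ k) p.2 * (g p.2 * phi p)).
    rewrite -(bp_funD (bp_fun_cint (nu i))).
    - by congr (cint (nu i)); apply/funext => p; rewrite [LHS]dE.
    - by apply: bmeasM; [exact: bmeasM|exact: C1c_derive_bmeas cphi].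
    - by apply: bmeasM; [exact: bmeas_gradient (cf k)|exact: bmeasM].
  have E3 : \sum_(i < n) cint (nu i) (fun p => g p.2 * d_x i (fun p : ST => phi p * f_ k p.2 : R^o) p) =
      \sum_(i < n) cint (nu i) (fun p => f_ k p.2 * g p.2 * d_x i phi p) +
      gradient_int nu (f_ k) (fun p => g p.2 * phi p).
    by rewrite /gradient_int -big_split; apply: eq_bigr => i _; exact: E2.
  by rewrite {1}/weak_int E1 E3 opprD addrA.
have E' : cint (D g) (fun p => f p.2 * phi p) =
    weak_int mu nu (fun x => f x * g x) phi - cint (D f) (fun p => g p.2 * phi p).
  have L1 : cint (D g) (fun p => f_ k p.2 * phi p) @[k --> \oo] --> cint (D g) (fun p => f p.2 * phi p).
    apply: (bp_fun_cint (D g)).2.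
    - have [M phiM] := C1c_bounded cphi.
      exists (C * M) => k p; rewrite normrM.
      exact: ler_pM (normr_ge0 _) (normr_ge0 _) ((bl k).1 _) (phiM _).
    - by move=> k; exact: bmeasM.
    - by move=> p; apply: cvgM; [exact: ff|exact: cvg_cst].
  have L2 : cint (D g) (fun p => f_ k p.2 * phi p) @[k --> \oo] -->
      weak_int mu nu (fun x => f x * g x) phi - cint (D f) (fun p => g p.2 * phi p).
    rewrite (funext E); apply: cvgB.
      have [Cg [_ gC _]] := lip_bP hN lg.
      apply: (weak_int_cvg (C := C * Cg)) cphi.
      - by move=> k; exact: lip_b_continuous (lip_b_mul hN (lf_ k) lg).
      - move=> k x; rewrite normrM.
        exact: ler_pM (normr_ge0 _) (normr_ge0 _) ((bl k).1 _) (gC _).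
      - by move=> x; apply: cvgM; [exact: ff|exact: cvg_cst].
    apply: (weak_derivative_setwise_cvg (C := C)) => //; last exact: bmeasM.
    - by move=> k; exact: (bl k).1.
    - by move=> k; exact: (bl k).2.
  exact: (cvg_unique (@Rhausdorff R) L1 L2).
by rewrite E' subrK.
Qed.

End field_to_derivation_theorem.

(** * Products of a function of time and a function of space *)

Section tensor.
Context {R : realType} {n : nat} {T : R}.
Local Notation ST := (R^o * 'rV[R]_n)%type.

Lemma C1c_tensor (xi : R^o -> R^o) (f : 'rV[R]_n -> R^o) : C1c `]0, T[ xi -> C1c setT f ->
  C1c (slab n T) (fun p : ST => xi p.1 * f p.2).
Proof.
move=> cxi cf; have [x1 xK xU] := cxi; have [f1 fK _] := cf.
apply: (C1c_intro (K := closure [set t | xi t != 0] `*` closure [set x | f x != 0])).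
- by apply: C1M; [exact: (@C1_fst R n R^o _ x1)|exact: (@C1_snd R n R^o _ f1)].
- exact: compact_setX.
- by move=> p [p1 _]; split => //; exact: xU.
- move=> p np; have [px|px] := pselect (closure [set t | xi t != 0] p.1).
    by rewrite (C1c_eq0 cf) ?mulr0// => pf; apply: np; split.
  by rewrite (C1c_eq0 cxi) ?mul0r.
Qed.

Lemma derive_tensor (xi : R^o -> R^o) (f : 'rV[R]_n -> R^o) (p v : ST) : C1 xi -> C1 f ->
  'D_v (fun p : ST => xi p.1 * f p.2 : R^o) p =
  xi p.1 * 'D_(v.2) f p.2 + f p.2 * 'D_(v.1) xi p.1.
Proof.
move=> cx cf; rewrite (derive_mul _ _ (@C1_fst R n R^o _ cx) (@C1_snd R n R^o _ cf)).
by rewrite (@derive_snd R n R^o f) (@derive_fst R n R^o xi).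
Qed.

Lemma C1c_bmeas_fst U (xi : R^o -> R^o) : C1c U xi ->
  bmeas ((fun p => xi p.1) : spacetime R n -> R).
Proof.
move=> cx; have [M xM] := C1c_bounded cx; have [x1 _ _] := cx.
exact: bmeas_fst (C1_continuous x1) xM.
Qed.

Lemma C1c_derive_bmeas_fst U (xi : R^o -> R^o) : C1c U xi ->
  bmeas ((fun p => 'D_(1 : R^o) xi p.1) : spacetime R n -> R).
Proof.
move=> cx; have [M xM] := C1c_derive_bounded (1 : R^o) cx; have [x1 _ _] := cx.
exact: bmeas_fst (x1.2 (1 : R^o)) xM.
Qed.

Lemma restrict_fst (xi : R^o -> R^o) (h : spacetime R n -> R) :
  (forall t, ~ `]0, T[%classic t -> xi t = 0) ->
  (fun p => xi p.1 * h p) \_ (slab n T) = (fun p => xi p.1 * h p) :> (spacetime R n -> R).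
Proof.
move=> x0; apply/funext => p; rewrite patchE; case: ifPn => // /negP Sp.
by rewrite x0 ?mul0r// => p1; apply: Sp; apply: mem_set; split.
Qed.

End tensor.

Section field_to_derivation.
Context {R : realType} {n : nat} {N : 'rV[R]_n -> R} {T : R}.
Hypothesis hN : is_norm N.
Variable mu : {finite_measure set (spacetime R n) -> \bar R}.
Variable nu : 'I_n -> {charge set (spacetime R n) -> \bar R}.
Hypothesis nuT : forall i, on_slab T (nu i).
Hypothesis munu : solves_field T mu nu.
Local Notation ST := (R^o * 'rV[R]_n)%type.
Local Notation X := (spacetime R n).
Variable D : ('rV[R]_n -> R) -> {charge set X -> \bar R}.
Hypothesis DP : forall f, lip_b N f -> weak_derivative (T := T) mu nu f (D f).

Let mS : measurable (slab n T : set X) := measurable_slab T.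

Lemma weak_derivative_derivation : derivation N T D.
Proof.
split.
- by move=> f lf; have [] := DP lf.
- move=> a f g A lf lg mA; rewrite !cint_indicE//.
  by rewrite (weak_derivative_linear hN DP a lf lg) ?EFinD ?EFinM//; exact: bmeas_indic.
- move=> f g A lf lg mA; rewrite cint_indicE//.
  rewrite (weak_derivative_leibniz hN nuT munu DP lf lg); last exact: bmeas_indic.
  by rewrite !charge_int_restrict !restrict_mul_indic.
Qed.

Lemma weak_derivative_directional : directional nu D.
Proof.
move=> f cf A mA; rewrite cint_indicE// (weak_derivative_smooth hN nuT munu DP cf); last exact: bmeas_indic.
by congr (_%:E); apply: eq_bigr => i _; rewrite charge_int_restrict restrict_mul_indic.
Qed.

Lemma bmeas_within_slab (g : X -> R) : {within slab n T, continuous (g : R * 'rV[R]_n -> R)} ->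
  (exists M : R, forall p, slab n T p -> `|g p| <= M) ->
  bmeas (g \_ (slab n T : set X)).
Proof.
rewrite continuous_open_subspace; last exact: open_slab.
move=> cg [M gM]; split.
  apply/(measurable_restrictT _ mS).
  by apply: spacetime_continuous_measurable => //; exact: open_slab.
exists (Num.max M 0) => p; rewrite patchE; case: ifPn => Sp.
  by rewrite le_max gM//; exact: set_mem.
by rewrite normr0 le_max lexx orbT.
Qed.

(** The pointwise limit inherits the bound C, and setwise convergence applies; continuity of g on
    the slab makes its extension by zero Borel. *)
Lemma weak_derivative_weak_star : weak_star_continuous N T D.
Proof.
move=> f_ f lf_ lf [C fC] ff g cg bg.
have bC k := lip_b_norm_ge hN (lf_ k) (fC k).
have fC' : bdd C f.
  move=> x; have <- := cvg_lim (@Rhausdorff R) (cvg_norm (ff x)).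
  apply: limr_le; first by apply/cvg_ex; exists `|f x|; exact: cvg_norm (ff x).
  by apply: nearW => k; exact: (bC k).1.
have fL' : lipN (N := N) C f.
  move=> x y; have h : (f_ k x - f_ k y) @[k --> \oo] --> f x - f y by exact: cvgB.
  have <- := cvg_lim (@Rhausdorff R) (cvg_norm h).
  apply: limr_le; first by apply/cvg_ex; exists `|f x - f y|; exact: cvg_norm h.
  by apply: nearW => k; exact: (bC k).2.
rewrite charge_int_restrict; under eq_fun do rewrite charge_int_restrict.
apply: (weak_derivative_setwise_cvg hN munu DP (C := C)) => //.
- by move=> k; exact: (bC k).1.
- by move=> k; exact: (bC k).2.
- exact: bmeas_within_slab.
Qed.

(** Being directional, D and D' agree on the C^1_c approximants of f, whose Lip_b norms are bounded;
    both limits are then identified on test functions. *)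
Lemma weak_derivative_unique (D' : ('rV[R]_n -> R) -> {charge set X -> \bar R}) :
  derivation N T D' -> weak_star_continuous N T D' -> directional nu D' -> eq_on_lip_b N D' D.
Proof.
move=> [D'T _ _] wD' dD' f A lf mA; rewrite !cint_indicE//; congr (_%:E).
have [C [f_ [cf bl [fC fL] ff]]] := lip_b_approx hN lf.
have lf_ k : lip_b N (f_ k) := C1c_lip_b hN (cf k).
have DD k g : bmeas g -> cint (D' (f_ k)) g = cint (D (f_ k)) g.
  apply: cint_charge_ext => B mB.
  by rewrite dD'// weak_derivative_directional.
have bA : bmeas (\1_A : X -> R) := bmeas_indic mA.
move: (\1_A : X -> R) bA; apply: (eq_charge_slab (D'T _ lf)); first exact: bp_fun_cint.
  by move=> g bg; apply: cint_restrict_slab => //; have [] := DP lf.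
move=> phi cphi; have bphi := C1c_bmeas cphi.
have C0 : 0 <= C by exact: le_trans (normr_ge0 _) (fC 0).
have [c1 _ _] := cphi.
have L1 : cint (D (f_ k)) phi @[k --> \oo] --> cint (D f) phi.
  apply: (weak_derivative_setwise_cvg hN munu DP (C := C)) => // k; [exact: (bl k).1|exact: (bl k).2].
have [M phiM] := C1c_bounded cphi.
have L2 : cint (D (f_ k)) phi @[k --> \oo] --> cint (D' f) phi.
  have : charge_int (D' (f_ k)) (slab n T) phi @[k --> \oo] --> charge_int (D' f) (slab n T) phi.
    apply: wD' => //.
    - by exists (C + C) => k; apply: (lip_b_norm_le hN) => //; [exact: (bl k).1|exact: (bl k).2].
    - by apply: continuous_subspaceT; exact: C1_continuous c1.
    - by exists M.
  rewrite charge_int_restrict (restrict_C1c cphi).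
  have -> : (fun k => charge_int (D' (f_ k)) (slab n T) phi) = fun k => cint (D (f_ k)) phi.
    by apply/funext => k; rewrite charge_int_restrict (restrict_C1c cphi) DD.
  by [].
exact: (cvg_unique (@Rhausdorff R) L2 L1).
Qed.

(** The function xi of time alone has no compact support in space: it is multiplied by the cutoffs
    in x, which are removed in the limit. *)
Lemma weak_derivative_solves : solves_derivation N T mu D.
Proof.
move=> xi f cx lf; have [x1 _ xU] := cx; have [DfT Dfw] := DP lf.
have bf := bmeas_lip hN lf; have bx := C1c_bmeas_fst (n := n) cx.
have bx' := C1c_derive_bmeas_fst (n := n) cx.
have xout t : ~ `]0, T[%classic t -> xi t = 0.
  by move=> nt; apply: (C1c_eq0 cx) => /xU.
have xout' t : ~ `]0, T[%classic t -> 'D_(1 : R^o) xi t = 0.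
  by move=> nt; apply: (C1c_derive_eq0 _ cx) => /xU.
have -> : Rintegral mu (slab n T) (fun p => derive1 xi p.1 * f p.2) =
    Rintegral mu setT (fun p => 'D_(1 : R^o) xi p.1 * f p.2).
  rewrite Rintegral_mkcond -(restrict_fst (fun p : X => f p.2) xout').
  by congr (Rintegral mu setT (_ \_ _)); apply/funext => p; rewrite derive1E.
have -> : charge_int (D f) (slab n T) (fun p => xi p.1) = cint (D f) (fun p => xi p.1).
  by rewrite charge_int_restrict cint_restrict_slab.
pose phi (k : nat) (p : ST) : R^o := xi p.1 * cutoff k p.2.
have cphi k : C1c (slab n T) (phi k) := C1c_tensor cx (C1c_cutoff k).
have lim1 (L : (X -> R) -> R) (F : R -> R) (G : nat -> 'rV[R]_n -> R) (G' : 'rV[R]_n -> R) (M : R) :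
    bp_fun L -> bmeas ((fun p => F p.1) : X -> R) -> (forall k, continuous (G k)) ->
    (forall k x, `|G k x| <= M) -> (forall x, \forall k \near \oo, G k x = G' x) ->
    L (fun p : X => F p.1 * G k p.2) @[k --> \oo] --> L (fun p : X => F p.1 * G' p.2).
  move=> bL bF cG GM GG; apply: bL.2.
  - have [K FK] := bF.2; exists (K * M) => k p; rewrite normrM.
    exact: ler_pM (normr_ge0 _) (normr_ge0 _) (FK _) (GM _ _).
  - by move=> k; apply: bmeasM => //; exact: bmeas_snd (cG k) (GM k).
  - move=> p; apply: cvgM; first exact: cvg_cst.
    by apply: cvg_near_cst; exact: GG.
have cc k : continuous (cutoff k : 'rV[R]_n -> R) := C1_continuous (C1_cutoff_derive k).1.
have near1 x : \forall k \near \oo, cutoff k x = 1 :> R.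
  by have := near_cutoff x; apply: filterS => k [].
have L1 : cint (D f) (phi k) @[k --> \oo] --> cint (D f) (fun p => xi p.1).
  rewrite [X in _ --> cint _ X](_ : _ = (fun p : X => xi p.1 * cst 1 p.2)); last first.
    by apply/funext => p; rewrite mulr1.
  by apply: (lim1 (cint (D f)) xi (fun k => cutoff k) (cst 1) 1) => //;
    [exact: bp_fun_cint|exact: norm_cutoff_le1].
have bpf (L : (X -> R) -> R) : bp_fun L ->
    bp_fun (fun g : X -> R => L (fun p => f p.2 * g p)).
  by move=> bL; exact: bp_fun_mul.
have L2 : weak_int mu nu f (phi k) @[k --> \oo] -->
    - Rintegral mu setT (fun p => 'D_(1 : R^o) xi p.1 * f p.2).
  rewrite -[X in _ --> X]subr0; apply: cvgB.
    apply: cvgN.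
    have -> : Rintegral mu setT (fun p : X => 'D_(1 : R^o) xi p.1 * f p.2) =
        Rintegral mu setT (fun p : X => f p.2 * ('D_(1 : R^o) xi p.1 * cst 1 p.2)).
      by congr Rintegral; apply/funext => p; rewrite mulr1 mulrC.
    have -> : (fun k => Rintegral mu setT (fun p : X => f p.2 * d_t (phi k) p)) =
        (fun k => Rintegral mu setT (fun p : X => f p.2 * ('D_(1 : R^o) xi p.1 * cutoff k p.2))).
      apply/funext => k; congr Rintegral; apply/funext => p.
      rewrite /d_t (derive_tensor _ _ x1 (C1_cutoff_derive k).1)/= derive0 mulr0 add0r.
      by rewrite [cutoff _ _ * _]mulrC.
    apply: (lim1 (fun g : X -> R => Rintegral mu setT (fun p => f p.2 * g p))
      (fun t => 'D_(1 : R^o) xi t) (fun k => cutoff k) (cst 1) 1) => //.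
      by apply: bpf; exact: bp_fun_Rintegral.
    exact: norm_cutoff_le1.
  (* Each spatial term tends to 0: the partial derivatives of the cutoffs are bounded uniformly in k
     and eventually vanish at each point. *)
  rewrite -[X in _ --> X](@big1_eq _ 0 +%R _ (index_enum 'I_n) xpredT).
  apply: (cvg_sumr (u := fun i k => cint (nu i) (fun p : X => f p.2 * d_x i (phi k) p))) => i.
  have -> : (fun k => cint (nu i) (fun p : X => f p.2 * d_x i (phi k) p)) =
      (fun k => cint (nu i) (fun p : X => f p.2 * (xi p.1 * 'D_(basis_vec i) (cutoff k : _ -> R^o) p.2))).
    apply/funext => k; congr (cint _); apply/funext => p.
    by rewrite /d_x (derive_tensor _ _ x1 (C1_cutoff_derive k).1)/= derive0 mulr0 addr0.
  have Z : cint (nu i) (fun p : X => f p.2 * (xi p.1 * cst 0 p.2)) = 0.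
    transitivity (cint (nu i) (cst 0)); last exact: bp_fun0 (bp_fun_cint (nu i)).
    by congr (cint _); apply/funext => p; rewrite !mulr0.
  rewrite -[X in _ --> X]Z.
  apply: (lim1 (fun g : X -> R => cint (nu i) (fun p => f p.2 * g p)) xi
    (fun k => (fun x => 'D_(basis_vec i) (cutoff k : _ -> R^o) x)) (cst 0) (kN hN * N (basis_vec i))) => //.
  - by apply: bpf; exact: bp_fun_cint.
  - by move=> k; have [_] := (C1_cutoff_derive (R := R) (n := n) k).1; exact.
  - move=> k x; apply: C1_lip_derive => //; [exact: (C1_cutoff_derive k).1|exact: lipN_cutoff].
  - by move=> x; have := near_cutoff x; apply: filterS => k [_ ->].
have L1' : cint (D f) (phi k) @[k --> \oo] --> - Rintegral mu setT (fun p => 'D_(1 : R^o) xi p.1 * f p.2).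
  by rewrite (_ : (fun k => _) = (fun k => weak_int mu nu f (phi k)))//; apply/funext => k; exact: Dfw.
by rewrite (cvg_unique (@Rhausdorff R) L1 L1') subrr.
Qed.

End field_to_derivation.

(** * The vector field of a derivation *)

Section asymptotic_lipschitz.
Context {R : realType} {n : nat} {N : 'rV[R]_n -> R}.
Hypothesis hN : is_norm N.
Implicit Types (f : 'rV[R]_n -> R) (x : 'rV[R]_n).

Lemma le_lip_const (A B : set 'rV[R]_n) L f : lipN (N := N) L f -> A `<=` B ->
  lip_const N A f <= lip_const N B f.
Proof.
move=> fL AB; apply: (lip_constP hN); first exact: lip_const_ge0.
by move=> y z Ay Az; apply: (lip_const_ge hN fL); exact: AB.
Qed.

Lemma lip_a_is_cvg L f x : lipN (N := N) L f ->
  cvg (lip_const N [set y | N (y - x) < r] f @[r --> 0^'+]).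
Proof.
move=> fL; apply: nondecreasing_at_right_is_cvgr.
  apply: nearW => b r s _ _ rs; apply: le_lip_const fL _.
  by move=> y /= yr; exact: lt_le_trans rs.
by apply: nearW => b; exists 0 => _ [r _ <-]; exact: lip_const_ge0.
Qed.

Lemma lip_a_ge0 L f x : lipN (N := N) L f -> 0 <= lip_a N f x.
Proof.
move=> fL; apply: limr_ge; first exact: lip_a_is_cvg fL.
by apply: nearW => r; exact: lip_const_ge0.
Qed.

Lemma lip_a_le L f x (r c : R) : lipN (N := N) L f -> 0 < r -> 0 <= c ->
  (forall y z, N (y - x) < r -> N (z - x) < r -> `|f y - f z| <= c * N (y - z)) ->
  lip_a N f x <= c.
Proof.
move=> fL r0 c0 fc; apply: limr_le; first exact: lip_a_is_cvg fL.
near=> s; apply: (lip_constP hN) => // y z /= ys zs; apply: fc.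
- by apply: (lt_le_trans ys); near: s; exact: nbhs_right_le.
- by apply: (lt_le_trans zs); near: s; exact: nbhs_right_le.
Unshelve. all: by end_near. Qed.

Lemma lip_a_le_lip L f x : 0 <= L -> lipN (N := N) L f -> lip_a N f x <= L.
Proof. by move=> L0 fL; apply: (lip_a_le fL ltr01 L0) => y z _ _; exact: fL. Qed.

End asymptotic_lipschitz.

Import HBNNSimple.

Lemma ge0_le_integral_pointwise d (X : measurableType d) (R : realType)
    (m : {measure set X -> \bar R}) (A : set X) (f g : X -> \bar R) :
  (forall x, A x -> 0 <= f x)%E -> (forall x, A x -> f x <= g x)%E ->
  (\int[m]_(x in A) f x <= \int[m]_(x in A) g x)%E.
Proof.
move=> f0 fg; rewrite !ge0_integralE//; last first.
  by move=> x Ax; exact: le_trans (f0 x Ax) (fg x Ax).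
apply: ge_ereal_sup => _ [h/= hf] <-; apply: ereal_sup_ubound; exists h => // x.
apply: (le_trans (hf x)); rewrite /patch; case: ifPn => // /set_mem; exact: fg.
Qed.

(** * Locality of a finite-mass derivation and the construction of the components *)

Section finite_mass_bounds.
Context {R : realType} {n : nat} {N : 'rV[R]_n -> R} {T : R}.
Hypothesis hN : is_norm N.
Local Notation X := (spacetime R n).
Variable D : ('rV[R]_n -> R) -> {charge set X -> \bar R}.
Hypothesis dD : derivation N T D.
Variable lambda : {finite_measure set X -> \bar R}.
Hypothesis Dlambda : forall f A, lip_b N f -> measurable A ->
  (Defs.total_variation (D f) A <= \int[lambda]_(p in A) (lip_a N f p.2)%:E)%E.
Implicit Types (f : 'rV[R]_n -> R) (A : set X).

Lemma total_variation_le f A (c : R) : lip_b N f -> measurable A -> 0 <= c ->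
  (forall p, A p -> lip_a N f p.2 <= c) ->
  (Defs.total_variation (D f) A <= c%:E * lambda A)%E.
Proof.
move=> lf mA c0 fc; apply: (le_trans (Dlambda lf mA)).
rewrite -integral_cst//; have [C [_ _ fL]] := lip_bP hN lf.
apply: ge0_le_integral_pointwise => p Ap; rewrite lee_fin; last exact: fc.
exact: lip_a_ge0 fL.
Qed.

Lemma cint_indic_le f A (c : R) : lip_b N f -> measurable A -> 0 <= c ->
  (forall p, A p -> lip_a N f p.2 <= c) ->
  `|cint (D f) \1_A| <= c * fine (lambda A).
Proof.
move=> lf mA c0 fc; have := total_variation_le lf mA c0 fc.
have := abse_charge_variation (hahnP (D f)) mA => /le_trans /[apply].
rewrite cint_indicE// -[lambda A]fineK; last exact: fin_num_measure.
by rewrite -EFinM lee_fin.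
Qed.

Lemma cint_derivation_lin (a : R) f g h : lip_b N f -> lip_b N g -> bmeas h ->
  cint (D (fun x => a * f x + g x)) h = a * cint (D f) h + cint (D g) h.
Proof.
move=> lf lg; have [_ lin _] := dD.
apply: (cint_unique (L := fun h => a * cint (D f) h + cint (D g) h)).
  by apply: bp_fun_add; [apply: bp_fun_scale|]; exact: bp_fun_cint.
by move=> A mA; rewrite lin// !cint_indicE// EFinD EFinM.
Qed.

(** Near each point of A the difference [f - g] vanishes, so its asymptotic Lipschitz constant is 0
    on A and its charge has no mass there. *)
Lemma cint_local f g A h : lip_b N f -> lip_b N g -> measurable A -> bmeas h ->
  (forall p, A p -> exists2 r, 0 < r & forall y, N (y - p.2) < r -> f y = g y) ->
  cint (D f) (h \_ A) = cint (D g) (h \_ A).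
Proof.
move=> lf lg mA bh fg.
have lh := lip_b_lin hN (-1) lg lf.
suff H : forall h, bmeas h -> cint (D (fun x => -1 * g x + f x)) (h \_ A) = 0.
  have := H h bh; rewrite cint_derivation_lin//; last exact: bmeas_restrict.
  by rewrite mulN1r addrC => /eqP; rewrite subr_eq0 => /eqP.
apply: (bp_fun_eq (L := fun h => cint (D (fun x => -1 * g x + f x)) (h \_ A)) (L' := fun _ => 0)).
- by apply: bp_fun_restrict => //; exact: bp_fun_cint.
- by split; [move=> *; rewrite mulr0 addr0|move=> *; exact: cvg_cst].
move=> B mB; rewrite restrict_indic; apply/eqP; rewrite -normr_le0.
have mBA : measurable (B `&` A) by exact: measurableI.
rewrite (le_trans (@cint_indic_le _ _ 0 lh mBA (lexx _) _)) ?mul0r//.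
move=> p [_ Ap]; have [r r0 fgr] := fg p Ap; have [C [_ _ hL]] := lip_bP hN lh.
apply: (lip_a_le hN hL r0 (lexx _)) => y z yr zr.
by rewrite !fgr// !mulN1r !addNr subrr normr0 mul0r.
Qed.

(* The coordinate functions are not bounded: the components of the field are
   obtained from their truncations. *)
Definition clamp (i : 'I_n) (k : nat) (x : 'rV[R]_n) : R :=
  Num.max (- k%:R) (Num.min k%:R (x ord0 i)).

Lemma clamp_id i k (x : 'rV[R]_n) : `|x ord0 i| <= k%:R -> clamp i k x = x ord0 i.
Proof. by rewrite ler_norml => /andP[h1 h2]; rewrite /clamp min_r// max_r. Qed.

Lemma clamp_dist i k (x y : 'rV[R]_n) : `|clamp i k x - clamp i k y| <= `|x ord0 i - y ord0 i|.
Proof.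
have k0 : 0 <= k%:R :> R by [].
rewrite /clamp; set a := x ord0 i; set b := y ord0 i.
wlog ab : a b / a <= b.
  by move=> H; have [/H//|/ltW/H] := leP a b; rewrite distrC [leRHS]distrC.
rewrite [leRHS]distrC [leRHS]ger0_norm ?subr_ge0// ler_norml.
have kk : - k%:R <= k%:R :> R by rewrite (le_trans _ k0)// oppr_le0.
case: (leP k%:R a) => ?; case: (leP k%:R b) => ?; rewrite ?(max_r kk).
- by rewrite !subrr oppr_le0 subr_ge0 ab.
- by exfalso; lra.
- by case: (leP (- k%:R) a) => ?; apply/andP; split; lra.
- case: (leP (- k%:R) a) => ?; case: (leP (- k%:R) b) => ?; apply/andP; split; lra.
Qed.

Lemma clamp_lip i k : lipN (N := N) (kN hN) (clamp i k).
Proof.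
move=> x y; apply: (le_trans (clamp_dist i k x y)); exact: lipN_coord.
Qed.

Lemma clamp_bdd i k : bdd k%:R (clamp i k).
Proof.
move=> x; have k0 : 0 <= k%:R :> R by [].
by rewrite ler_norml /clamp le_max lexx/= ge_max ge_min lexx/= (le_trans _ k0) ?oppr_le0.
Qed.

Lemma lip_b_clamp i k : lip_b N (clamp i k).
Proof. exact: lip_b_intro (clamp_bdd i k) (clamp_lip i k). Qed.

(** An l^1 ball in space, in spite of the name. It is open, so that a clamp coincides with its
    coordinate in a neighbourhood of each of its points. *)
Definition cube (k : nat) : set X := [set p | norm1 p.2 < k%:R].

Lemma measurable_cube k : measurable (cube k).
Proof.
apply: spacetime_open_measurable.
have cn : continuous (fun p : R * 'rV[R]_n => norm1 p.2).
  have cn1 : continuous (@norm1 R n).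
    apply: (@dist_le_continuous R 'rV[R]_n _ n%:R) => // x y.
    apply: le_trans (norm1_le_norm _).
    rewrite /norm1 -sumrB (le_trans (ler_norm_sum _ _ _))//.
    by apply: ler_sum => i _; rewrite (le_trans (ler_dist_dist _ _))// !mxE.
  by move=> p; apply: (continuous_comp (f := snd)); [exact: cvg_snd|exact: cn1].
have -> : cube k = (fun p : R * 'rV[R]_n => norm1 p.2) @^-1` [set t | t < k%:R] by [].
by apply: open_comp; [move=> p _; exact: cn|exact: open_lt].
Qed.

Lemma clamp_local j k p : (j <= k)%N -> cube j p ->
  exists2 r, 0 < r & forall i y, N (y - p.2) < r -> clamp i k y = y ord0 i.
Proof.
rewrite /cube/= => jk pj; have kN1 : 0 < kN hN + 1 by rewrite ltr_wpDl// kN_ge0.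
exists ((j%:R - norm1 p.2) / (kN hN + 1)); first by rewrite divr_gt0// subr_gt0.
move=> i y; rewrite ltr_pdivlMr// => yr; apply: clamp_id.
have h1 : `|p.2 ord0 i| <= norm1 p.2 by rewrite /norm1 (bigD1 i)//= lerDl; exact: sumr_ge0.
have h2 := @lipN_coord R n N hN i y p.2; rewrite /= in h2.
have h3 : kN hN * N (y - p.2) <= N (y - p.2) * (kN hN + 1).
  by rewrite mulrC ler_wpM2l ?(normN_ge0 hN)// lerDl.
have h4 : j%:R <= k%:R :> R by rewrite ler_nat.
have h5 : `|y ord0 i| <= `|p.2 ord0 i| + `|y ord0 i - p.2 ord0 i|.
  by rewrite -{1}(subrK (p.2 ord0 i) (y ord0 i)) addrC (le_trans (ler_normD _ _)).
lra.
Qed.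

Lemma restrict_cube_cvg (g : X -> R) p : (g \_ (cube k)) p @[k --> \oo] --> g p.
Proof.
apply: cvg_near_cst; have := @nbhs_infty_gtr R (norm1 p.2); apply: filterS => k hk.
by rewrite patchE mem_set.
Qed.

Lemma bmeas_restrict_cube (g : X -> R) : bmeas g ->
  (exists M : R, forall k p, `|(g \_ (cube k)) p| <= M) /\
  (forall k, bmeas (g \_ (cube k))).
Proof.
move=> bg; split; last by move=> k; apply: bmeas_restrict => //; exact: measurable_cube.
have [M gM] := bg.2; exists M => k p; rewrite patchE; case: ifPn => // _.
by rewrite normr0 (le_trans _ (gM p)).
Qed.

(** The clamps share the Lipschitz constant [kN]; the factor 2 is that of [cint_dominated]. *)
Definition mass_gauge (g : X -> R) : R :=
  2 * kN hN * Rintegral lambda setT (fun p => `|g p|).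

Lemma bp_gauge_mass : bp_gauge mass_gauge.
Proof. by apply: bp_gauge_scale; exact: bp_gauge_Rintegral. Qed.

Lemma cint_clamp_le i k g : bmeas g -> `|cint (D (clamp i k)) g| <= mass_gauge g.
Proof.
move=> bg; apply: cint_dominated => //; first exact: kN_ge0.
move=> A mA; apply: (total_variation_le (lip_b_clamp i k) mA (kN_ge0 hN)) => p _.
exact: (lip_a_le_lip hN _ (kN_ge0 hN) (clamp_lip i k)).
Qed.

Lemma cint_clamp_cube i j k g : (j <= k)%N -> bmeas g ->
  cint (D (clamp i k)) (g \_ (cube j)) = cint (D (clamp i j)) (g \_ (cube j)).
Proof.
move=> jk bg; apply: cint_local bg _; [exact: lip_b_clamp|exact: lip_b_clamp|exact: measurable_cube|].
move=> p pj; have [r r0 H] := clamp_local jk pj; have [s s0 H'] := clamp_local (leqnn j) pj.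
exists (Num.min r s); first by rewrite lt_min r0.
by move=> y; rewrite lt_min => /andP[yr ys]; rewrite H// H'.
Qed.

(** On a fixed cube the sequence in k is eventually constant by locality. The cubes exhaust space,
    and the common gauge extends convergence to all bounded functions. *)
Lemma clamp_charge i : exists s : {charge set X -> \bar R},
  [/\ on_slab T s, forall g, bmeas g -> `|cint s g| <= mass_gauge g &
      forall k g, bmeas g -> cint s (g \_ (cube k)) = cint (D (clamp i k)) (g \_ (cube k))].
Proof.
have bD k : bp_fun (cint (D (clamp i k))) := bp_fun_cint _.
have dDk k g := @cint_clamp_le i k g.
have cube_near j g : bmeas g -> \forall k \near \oo,
    cint (D (clamp i k)) (g \_ (cube j)) = cint (D (clamp i j)) (g \_ (cube j)).
  move=> bg; near=> k; apply: cint_clamp_cube => //; near: k; exact: nbhs_infty_ge.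
have cD g : bmeas g -> cvg (cint (D (clamp i k)) g @[k --> \oo]).
  move=> bg; have [bd bk] := bmeas_restrict_cube bg.
  have cj j : cvg (cint (D (clamp i k)) (g \_ (cube j)) @[k --> \oo]).
    by apply/cvg_ex; eexists; apply: cvg_near_cst; exact: cube_near.
  have [_] := bp_closed_cvg bD bp_gauge_mass dDk; apply; [exact: bd|exact: bk|exact: cj|].
  exact: restrict_cube_cvg.
have bL := bp_fun_lim bD bp_gauge_mass dDk cD.
have [s sE] := charge_of_bp_fun bL; have cs := cint_unique bL sE.
exists s; split.
- move=> A mA; rewrite !sE//; last by apply: measurableI => //; exact: measurable_slab.
  have [DT _ _] := dD.
  have -> // : (fun k => cint (D (clamp i k)) \1_A) =
    (fun k => cint (D (clamp i k)) \1_(A `&` slab n T)).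
  apply/funext => k; rewrite !cint_indic//; last by apply: measurableI => //; exact: measurable_slab.
  by rewrite (DT _ (lip_b_clamp i k) A mA).
- move=> g bg; rewrite cs//.
  have <- := cvg_lim (@Rhausdorff R) (cvg_norm (cD _ bg)).
  apply: limr_le; last by apply: nearW => k; exact: dDk.
  by apply/cvg_ex; eexists; exact: cvg_norm (cD _ bg).
- move=> k g bg; rewrite cs; last by apply: bmeas_restrict => //; exact: measurable_cube.
  by apply: (cvg_lim (@Rhausdorff R)); apply: cvg_near_cst; exact: cube_near.
Unshelve. all: by end_near. Qed.

End finite_mass_bounds.

(** * Cutting a set into cells on which finitely many functions are nearly constant *)

Section partition.
Context {d : measure_display} {X : measurableType d} {R : realType}.
Variable Q : set X -> Prop.
Hypothesis QU : forall A B, measurable A -> measurable B -> A `&` B = set0 ->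
  Q A -> Q B -> Q (A `|` B).

(** B is built up from the slices where g lies in consecutive intervals of length e, so additivity
    of Q on two disjoint sets suffices. *)
Lemma level_partition (g : X -> R) (e : R) (B : set X) : bmeas g -> 0 < e -> measurable B ->
  (forall A, measurable A -> A `<=` B -> (exists a, forall p, A p -> `|g p - a| <= e) -> Q A) ->
  Q B.
Proof.
move=> bg e0 mB H; have [M gM] := bg.2.
pose S (j : nat) : set X := B `&` [set p | g p < - M + j%:R * e].
have mlt (c : R) : measurable [set p | g p < c].
  rewrite -[X in measurable X]setTI.
  by apply: (@measurable_fun_ltr _ _ _ setT g (cst c)) => //; exact: bg.1.
have mS j : measurable (S j) by exact: measurableI.
have QS j : Q (S j).
  elim: j => [|j IH].
    apply: H => //; first exact: subIsetl.
    exists 0 => p [_ /=]; rewrite mul0r addr0 => /lt_le_trans.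
    by have := gM p; rewrite ler_norml => /andP[h _] /(_ _ h); rewrite ltxx.
  have -> : S j.+1 = S j `|` (S j.+1 `\` S j).
    rewrite setDUK// => p [Bp /= pj]; split => //=; apply: (lt_le_trans pj).
    by rewrite lerD2l ler_wpM2r ?ler_nat// ltW.
  apply: QU => //; [exact: measurableD|by rewrite setDE setICA setICr setI0|].
  apply: H; [exact: measurableD|by move=> p [[]]|].
  exists (- M + j%:R * e) => p [[Bp /= pj] npj].
  have pj' : - M + j%:R * e <= g p by rewrite leNgt; apply/negP => h; exact: npj.
  rewrite ger0_norm ?subr_ge0// lerBlDl.
  by move: pj; rewrite -[j.+1%:R]natr1; set u := j%:R; lra.
(* The values of g span at most [2 * M], so this many slices exhaust B. *)
have [j jM] : exists j : nat, 2 * M < j%:R * e.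
  exists (Num.truncn (2 * M / e)).+1; rewrite -ltr_pdivrMr//; exact: truncnS_gt.
suff -> : B = S j by exact: QS.
apply/seteqP; split=> [p Bp|p []//]; split => //=.
have := gM p; rewrite ler_norml => /andP[_ h].
by move: jM; set u := _ * e; lra.
Qed.

Lemma levels_partition (I : finType) (g : I -> X -> R) (e : R) (B : set X) :
  (forall i, bmeas (g i)) -> 0 < e -> measurable B ->
  (forall A (a : I -> R), measurable A -> A `<=` B ->
     (forall i p, A p -> `|g i p - a i| <= e) -> Q A) ->
  Q B.
Proof.
move=> bg e0 mB H.
(* The list s holds the functions still to be sliced; all others already oscillate little on A. *)
suff P (s : seq I) A : measurable A -> A `<=` B ->
    (forall i, i \notin s -> exists a, forall p, A p -> `|g i p - a| <= e) -> Q A.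
  by apply: (P (enum I)) => // i; rewrite mem_enum.
elim: s A => [|i s IH] A mA AB osc.
  have /choice[a aP] : forall i, exists a, forall p, A p -> `|g i p - a| <= e.
    by move=> i; exact: osc.
  exact: (H A a).
apply: (level_partition (bg i) e0 mA) => A' mA' A'A osc'; apply: IH => //.
  exact: subset_trans AB.
move=> i'; have [->//|i'i i's] := eqVneq i' i.
have [|a aP] := osc i'; first by rewrite in_cons negb_or i'i.
by exists a => p /A'A; exact: aP.
Qed.

End partition.

Section norm_balls.
Context {R : realType} {n : nat} {N : 'rV[R]_n -> R}.
Hypothesis hN : is_norm N.

Lemma nbhs_norm_ball (x : 'rV[R]_n) (P : set 'rV[R]_n) : nbhs x P ->
  exists2 r, 0 < r & forall y, N (y - x) < r -> P y.
Proof.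
move=> /nbhs_normP[e /= e0 eP]; have K1 : 0 < kN hN + 1 by rewrite ltr_wpDl// kN_ge0.
exists (e / (kN hN + 1)); first exact: divr_gt0.
move=> y; rewrite ltr_pdivlMr// => ye; apply: eP; rewrite /= distrC.
apply: le_lt_trans ye; rewrite (le_trans (norm_le_norm1 _))// (le_trans (norm1_le_N hN _))//.
by rewrite mulrC ler_wpM2l ?(normN_ge0 hN)// lerDl.
Qed.

Lemma normN_segment (x y z : 'rV[R]_n) r (s : R) : 0 <= s <= 1 -> N (y - x) < r -> N (z - x) < r ->
  N (y + s *: (z - y) - x) < r.
Proof.
move=> /andP[s0 s1] yr zr.
have -> : y + s *: (z - y) - x = (1 - s) *: (y - x) + s *: (z - x).
  by rewrite scalerBl scale1r !scalerBr; apply/rowP => i; rewrite !mxE; ring.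
rewrite (le_lt_trans (normND hN _ _))// !(normNZ hN) !ger0_norm ?subr_ge0//.
(* The strict inequality comes from the summand with factor s, hence the separate case. *)
have [->|s0'] := eqVneq s 0; first by rewrite subr0 mul1r mul0r addr0.
have sp : 0 < s by rewrite lt_neqAle eq_sym s0'.
have -> : r = (1 - s) * r + s * r by ring.
by rewrite ler_ltD ?ltr_pM2l// ler_wpM2l ?subr_ge0// ltW.
Qed.

End norm_balls.

(** * Comparison of the derivation with the field on small cells *)

Section directional_derivation.
Context {R : realType} {n : nat} {N : 'rV[R]_n -> R} {T : R}.
Hypothesis hN : is_norm N.
Local Notation X := (spacetime R n).
Variable D : ('rV[R]_n -> R) -> {charge set X -> \bar R}.
Hypothesis dD : derivation N T D.
Variable lambda : {finite_measure set X -> \bar R}.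
Hypothesis Dlambda : forall f A, lip_b N f -> measurable A ->
  (Defs.total_variation (D f) A <= \int[lambda]_(p in A) (lip_a N f p.2)%:E)%E.
Variable nu : 'I_n -> {charge set X -> \bar R}.
Hypothesis nu_mass : forall i g, bmeas g ->
  `|cint (nu i) g| <= mass_gauge hN lambda g.
Hypothesis nu_cube : forall i k g, bmeas g ->
  cint (nu i) (g \_ (cube k)) = cint (D (clamp i k)) (g \_ (cube k)).
Implicit Types (f : 'rV[R]_n -> R) (A B : set X).

Lemma cint_derivation_sum (I : Type) (s : seq I) (a : I -> R) (F : I -> 'rV[R]_n -> R) f h :
  (forall i, lip_b N (F i)) -> lip_b N f -> bmeas h ->
  lip_b N (fun x => \sum_(i <- s) a i * F i x + f x) /\
  cint (D (fun x => \sum_(i <- s) a i * F i x + f x)) h =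
    \sum_(i <- s) a i * cint (D (F i)) h + cint (D f) h.
Proof.
move=> lF lf bh; elim: s => [|i s [lS SE]].
  rewrite !big_nil add0r.
  have -> // : (fun x => \sum_(i <- [::]) a i * F i x + f x) = f.
  by apply/funext => x; rewrite big_nil add0r.
have -> : (fun x => \sum_(j <- i :: s) a j * F j x + f x) =
    (fun x => a i * F i x + (\sum_(j <- s) a j * F j x + f x)).
  by apply/funext => x; rewrite big_cons addrA.
split; first exact: lip_b_lin.
by rewrite (cint_derivation_lin dD)// SE big_cons addrA.
Qed.

(* Near a point where the gradient of f is e-close to a, the function
   f - a . x has an N-Lipschitz constant of order e. *)
Lemma lip_a_gradient_cell (f : 'rV[R]_n -> R^o) (a : 'I_n -> R) (e : R) k (x : 'rV[R]_n) :
  C1 f -> lip_b N f -> 0 < e -> norm1 x < k%:R ->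
  (forall i, `|'D_(basis_vec i) f x - a i| <= e) ->
  lip_a N (fun y => \sum_(i <- enum 'I_n) - a i * clamp i k y + f y) x <= 2 * e * kN hN.
Proof.
move=> cf lf e0 xk fa.
have lh : lip_b N (fun y => \sum_(i <- enum 'I_n) - a i * clamp i k y + f y).
  have lc i := @lip_b_clamp R n N hN i k.
  exact: (cint_derivation_sum _ (fun i => - a i) lc lf (bmeas_cst 0)).1.
have [C [_ _ hL]] := lip_bP hN lh.
have nx : nbhs x [set y | forall i, `|'D_(basis_vec i) f y - 'D_(basis_vec i) f x| < e].
  apply: (filter_forall (F := nbhs x)
    (f := fun i => [set y | `|'D_(basis_vec i) f y - 'D_(basis_vec i) f x| < e])) => i.
  have := cf.2 (basis_vec i) x => /cvgrPdist_lt/(_ e e0).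
  by apply: filterS => y; rewrite distrC.
have [r r0 rP] := nbhs_norm_ball hN nx.
have [t t0 tP] := clamp_local hN (leqnn k) (xk : cube k ((0 : R), x)).
have rt0 : 0 < Num.min r t by rewrite lt_min r0.
have c0 : 0 <= 2 * e * kN hN by apply: mulr_ge0; [apply: mulr_ge0 => //; exact: ltW|exact: kN_ge0].
apply: (lip_a_le hN hL rt0 c0).
move=> y z. rewrite lt_min => /andP[yr yt].
rewrite lt_min => /andP[zr zt].
have -> : (\sum_(i <- enum 'I_n) - a i * clamp i k y + f y) -
    (\sum_(i <- enum 'I_n) - a i * clamp i k z + f z) =
    (f y - f z) - \sum_(i < n) a i * (y - z) ord0 i.
  rewrite !big_enum/=.
  have hc u : N (u - x) < t -> \sum_(i < n) - a i * clamp i k u = - \sum_(i < n) a i * u ord0 i.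
    move=> ut; rewrite -sumrN; apply: eq_bigr => i _; by rewrite (tP i u ut) mulNr.
  rewrite !hc//.
  have -> : \sum_(i < n) a i * (y - z) ord0 i =
      \sum_(i < n) a i * y ord0 i - \sum_(i < n) a i * z ord0 i.
    by rewrite -sumrB; apply: eq_bigr => i _; rewrite !mxE mulrBr.
  set u := \sum_(i < n) _; set v := \sum_(i < n) _.
  by ring.
have [q q01 ->] := C1_mvt z y cf; have qr := normN_segment hN q01 zr yr.
rewrite derive_row// -sumrB (le_trans (ler_norm_sum _ _ _))//.
apply: (@le_trans _ _ (2 * e * norm1 (y - z))); last first.
  by rewrite -[leRHS]mulrA ler_wpM2l ?(norm1_le_N hN)// mulr_ge0// ltW.
rewrite mulr_sumr; apply: ler_sum => i _.
rewrite [a i * _]mulrC -mulrBr normrM mulrC ler_wpM2r//.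
rewrite -(subrK ('D_(basis_vec i) f x) ('D_(basis_vec i) f (z + q *: (y - z)))) -addrA.
rewrite (le_trans (ler_normD _ _))//.
(* One e for the variation of the gradient near x, one for its distance from a at x. *)
have -> : 2 * e = e + e by ring.
by rewrite lerD// ltW// rP.
Qed.

(** On B the difference is that of [D (f - a . x)] and [(grad f - a) . nu]. The first is at most
    [2 * e * kN * lambda B] by the estimate of [lip_a]; the gauge gives the same bound for each of
    the n components of the second. *)
Lemma directional_cell (f : 'rV[R]_n -> R^o) (a : 'I_n -> R) (e : R) k B :
  C1c setT f -> 0 < e -> measurable B -> B `<=` cube k ->
  (forall i p, B p -> `|'D_(basis_vec i) f p.2 - a i| <= e) ->
  `|cint (D f) \1_B - gradient_int nu f \1_B| <=
  2 * e * kN hN * (1 + n%:R) * fine (lambda B).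
Proof.
move=> cf e0 mB Bk fa; have [c1 _ _] := cf.
have lf := C1c_lip_b hN cf.
have lc i := @lip_b_clamp R n N hN i k.
have bB := @bmeas_indic _ X R B mB.
have [lh hE] := cint_derivation_sum (enum 'I_n) (fun i => - a i) lc lf bB.
have c0 : 0 <= 2 * e * kN hN by apply: mulr_ge0; [apply: mulr_ge0 => //; exact: ltW|exact: kN_ge0].
have h1 := cint_indic_le hN Dlambda lh mB c0 (fun p Bp =>
  lip_a_gradient_cell c1 lf e0 (Bk p Bp) (fun i => fa i p Bp)).
have BE : (\1_B : X -> R) = (\1_B : X -> R) \_ (cube k).
  by rewrite restrict_indic setIidl.
have nuE i : cint (D (clamp i k)) \1_B = cint (nu i) \1_B by rewrite BE nu_cube.
have bg i := bmeas_gradient i cf.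
have bgB i : bmeas (fun p : X => ('D_(basis_vec i) f p.2 - a i) * \1_B p).
  by apply: bmeasM => //; apply: bmeasB => //; exact: bmeas_cst.
have -> : cint (D f) \1_B - gradient_int nu f \1_B =
    cint (D (fun x => \sum_(i <- enum 'I_n) - a i * clamp i k x + f x)) \1_B -
    \sum_(i < n) cint (nu i) (fun p => ('D_(basis_vec i) f p.2 - a i) * \1_B p).
  have -> : \sum_(i < n) cint (nu i) (fun p => ('D_(basis_vec i) f p.2 - a i) * \1_B p) =
      \sum_(i < n) - a i * cint (nu i) \1_B + gradient_int nu f \1_B.
    rewrite -big_split/=; apply: eq_bigr => i _.
    rewrite -(bp_fun_cint (nu i)).1//; last exact: bmeasM.
    by congr cint; apply/funext => p; rewrite mulrDl addrC.
  rewrite hE big_enum/= (eq_bigr (fun i => - a i * cint (nu i) \1_B)); last first.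
    by move=> i _; rewrite nuE.
  set u := \sum_(i < n) _; set v := gradient_int _ _ _; set w := cint _ _.
  by ring.
rewrite (le_trans (ler_normB _ _))// mulrDr mulr1 mulrDl lerD//.
rewrite (le_trans (ler_norm_sum _ _ _))//.
apply: (@le_trans _ _ (\sum_(i < n) 2 * e * kN hN * fine (lambda B))); last first.
  by rewrite sumr_const card_ord -[leLHS]mulr_natr mulrAC.
apply: ler_sum => i _; rewrite (le_trans (nu_mass i (bgB i)))//.
have -> : 2 * e * kN hN * fine (lambda B) = 2 * kN hN * (e * fine (lambda B)) by ring.
rewrite /mass_gauge ler_wpM2l//; first by apply: mulr_ge0 => //; exact: kN_ge0.
have <- : Rintegral lambda setT (fun p => e * (\1_B : X -> R) p) = e * fine (lambda B).
  rewrite (bp_funZ e (bp_fun_Rintegral _))//.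
  by rewrite /Rintegral integral_indic// setIT.
apply: le_Rintegral => //; [exact: bmeas_integrable (bmeas_norm _)|exact: bmeas_integrable (bmeasZ _ _)|].
move=> p _; rewrite normrM indicE; case: (boolP (p \in B)) => [/set_mem Bp|_].
  by rewrite normr1 !mulr1 fa.
by rewrite normr0 !mulr0.
Qed.

Lemma cint_gradient_int (f : 'rV[R]_n -> R^o) g : C1c setT f -> bmeas g ->
  cint (D f) g = gradient_int nu f g.
Proof.
move=> cf; have bF := bp_fun_cint (D f); have bG := bp_fun_gradient_int nu cf.
move: g; apply: (bp_fun_eq bF bG) => A mA.
have bA := @bmeas_indic _ X R A mA; have [bd bk] := bmeas_restrict_cube bA.
have cA p := @restrict_cube_cvg R n (\1_A : X -> R) p.
have cF := bF.2 _ _ bd bk cA; have cG := bG.2 _ _ bd bk cA.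
suff E k : cint (D f) ((\1_A : X -> R) \_ (cube k)) = gradient_int nu f ((\1_A : X -> R) \_ (cube k)).
  by move: cF; under eq_fun do rewrite E; move=> /(cvg_unique (@Rhausdorff R)); exact.
rewrite restrict_indic; set B := A `&` cube k.
have mB : measurable B by apply: measurableI => //; exact: measurable_cube.
apply/eqP; rewrite -subr_eq0 -normr_le0; apply/ler_addgt0Pl => c c0; rewrite addr0.
(* The error over all of B is [e * K]; taking [K + 1] as divisor keeps e positive and the error
   below c. *)
pose K := 2 * kN hN * (1 + n%:R) * fine (lambda B).
have K0 : 0 <= K.
  by apply: mulr_ge0; [apply: mulr_ge0 => //; apply: mulr_ge0 => //; exact: kN_ge0|exact: fine_ge0].
have K1 : 0 < K + 1 by rewrite ltr_wpDl.
pose e := c / (K + 1); have e0 : 0 < e by exact: divr_gt0.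
suff H : `|cint (D f) \1_B - gradient_int nu f \1_B| <= 2 * e * kN hN * (1 + n%:R) * fine (lambda B).
  apply: (le_trans H); have -> : 2 * e * kN hN * (1 + n%:R) * fine (lambda B) = e * K by rewrite /K; ring.
  by rewrite /e mulrAC ler_pdivrMr// ler_wpM2l ?ltW// ltrDl.
have bg i := @bmeas_gradient R n setT f i cf.
(* The bound is proportional to [lambda A'], so it adds up over disjoint cells whatever their
   number. *)
pose Q (A' : set X) := `|cint (D f) \1_A' - gradient_int nu f \1_A'| <=
  2 * e * kN hN * (1 + n%:R) * fine (lambda A').
apply: (@levels_partition _ X R Q _ _ _ e B bg e0 mB).
  move=> A1 A2 m1 m2 A12 Q1 Q2; rewrite /Q.
  have b1 := @bmeas_indic _ X R A1 m1; have b2 := @bmeas_indic _ X R A2 m2.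
  have HL L : bp_fun L -> L (\1_(A1 `|` A2) : X -> R) = L \1_A1 + L \1_A2.
    move=> bL; rewrite -bp_funD//; congr L.
    apply/funext => p; rewrite !indicE in_setU; case: (boolP (p \in A1)) => [/set_mem p1|_]//=; last by rewrite add0r.
    case: (boolP (p \in A2)) => [/set_mem p2|_]//=; last by rewrite addr0.
    by have : (A1 `&` A2) p by []; rewrite A12.
  rewrite (HL _ bF) (HL _ bG) measureU// fineD ?fin_num_measure// mulrDr opprD addrACA.
  by rewrite (le_trans (ler_normD _ _))// lerD.
move=> A' a mA' A'B fa; apply: (@directional_cell f a e k) => //.
by move=> p /A'B [].
Qed.

Lemma directional_of_clamps : directional nu D.
Proof.
move=> f cf A mA; rewrite cint_indicE// cint_gradient_int//; last exact: bmeas_indic.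
congr EFin; apply: eq_bigr => i _; rewrite charge_int_restrict; congr cint.
by rewrite restrict_mul_indic.
Qed.

End directional_derivation.

(** * The continuity equation for the vector field *)

Section kernels.
Context {R : realType}.

(* Moving averages: the increments of c over unit steps form a partition of
   unity, each member of which is supported near an integer. *)
Section moving_average.
Variable c : R -> R.
Hypothesis c_nd : forall s t, s <= t -> c s <= c t.
Hypothesis c0 : forall t, t <= - 1 -> c t = 0.
Hypothesis c1 : forall t, 1 <= t -> c t = 1.

Lemma moving_average_approx m (s : R) (q : nat -> R) (g e : R) : 0 <= e ->
  (forall j, `|j%:R - s| <= 2 -> `|q j - g| <= e) ->
  (1 <= s /\ s + 1 <= m%:R) \/ g = 0 ->
  `|\sum_(j < m) (c (s - j%:R) - c (s - j.+1%:R)) * q j - g| <= e.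
Proof.
move=> e0 qg sg.
have c01 t : 0 <= c t <= 1.
  apply/andP; split.
    by rewrite -(c0 (t := Num.min t (- 1))) ?ge_min ?lexx ?orbT// c_nd// ge_min lexx.
  by rewrite -(c1 (t := Num.max t 1)) ?le_max ?lexx ?orbT// c_nd// le_max lexx.
have K0 j : 0 <= c (s - j%:R) - c (s - j.+1%:R).
  by rewrite subr_ge0 c_nd// lerB// ler_nat.
have KS : \sum_(j < m) (c (s - j%:R) - c (s - j.+1%:R)) = c s - c (s - m%:R).
  elim: m {sg} => [|m IH]; first by rewrite big_ord0 subr0 subrr.
  by rewrite big_ord_recr/= IH addrA subrK.
have -> : \sum_(j < m) (c (s - j%:R) - c (s - j.+1%:R)) * q j - g =
    \sum_(j < m) (c (s - j%:R) - c (s - j.+1%:R)) * (q j - g) +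
    ((c s - c (s - m%:R)) * g - g).
  rewrite -KS mulr_suml addrA; congr (_ - _); rewrite -big_split/=.
  by apply: eq_bigr => j _; ring.
(* The weights sum to [c s - c (s - m)], which is 1 away from both ends of the index range;
   elsewhere g is 0. *)
have -> : (c s - c (s - m%:R)) * g - g = 0.
  case: sg => [[s1 sm]|->]; last by rewrite mulr0 subr0.
  by rewrite c1// c0 ?subr0 ?mul1r ?subrr//; lra.
rewrite addr0 (le_trans (ler_norm_sum _ _ _))//.
apply: (@le_trans _ _ (\sum_(j < m) (c (s - j%:R) - c (s - j.+1%:R)) * e)); last first.
  rewrite -mulr_suml KS ler_piMl//.
  by have := c01 s; have := c01 (s - m%:R); move=> /andP[h1 h2] /andP[h3 h4]; lra.
apply: ler_sum => j _; rewrite normrM (ger0_norm (K0 j)).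
(* Beyond distance 2 both values of c are 0 or both are 1, so the weight vanishes. *)
have [sj|] := leP `|j%:R - s| 2; first by rewrite ler_wpM2l// qg.
have jS : j.+1%:R = j%:R + 1 :> R by rewrite natr1.
rewrite ltr_normr jS => /orP[]; set u := j%:R => h.
  have -> : c (s - u) = 0 by apply: c0; lra.
  have -> : c (s - (u + 1)) = 0 by apply: c0; lra.
  by rewrite subrr !mul0r.
have -> : c (s - u) = 1 by apply: c1; lra.
have -> : c (s - (u + 1)) = 1 by apply: c1; lra.
by rewrite subrr !mul0r.
Qed.

End moving_average.

(** Its unit increments are the hats, that is, the derivatives of [step]. So the time derivative of
    a spline sum is again a moving average, now with kernel [ramp]. *)
Definition ramp (t : R) : R := Num.max t 0 - Num.max (t - 1) 0.

Lemma ramp_nd s t : s <= t -> ramp s <= ramp t.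
Proof.
by rewrite /ramp; case: (leP s 0) => ?; case: (leP t 0) => ?; case: (leP (s - 1) 0) => ?;
  case: (leP (t - 1) 0) => ?; lra.
Qed.

Lemma ramp0 t : t <= - 1 -> ramp t = 0.
Proof. by rewrite /ramp; case: (leP t 0) => ?; case: (leP (t - 1) 0) => ?; lra. Qed.

Lemma ramp1 t : 1 <= t -> ramp t = 1.
Proof. by rewrite /ramp; case: (leP t 0) => ?; case: (leP (t - 1) 0) => ?; lra. Qed.

Lemma hat_ramp t : hat t = ramp (t + 1) - ramp t.
Proof. by rewrite /hat /ramp addrK; ring. Qed.

End kernels.

Section slices.
Context {R : realType} {n : nat} {T : R}.
Local Notation ST := (R^o * 'rV[R]_n)%type.
Local Notation X := (spacetime R n).
Variable phi : ST -> R^o.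
Hypothesis cphi : C1c (slab n T) phi.

Definition slice (t : R) (x : 'rV[R]_n) : R^o := phi (t, x).

Lemma derive_slice (t : R) (x v : 'rV[R]_n) :
  'D_v (slice t) x = 'D_((0 : R^o), v) phi (t, x).
Proof.
rewrite /derive.
have -> // : (fun h : R => h^-1 *: ((slice t \o shift x) (h *: v) - slice t x)) =
  (fun h : R => h^-1 *: ((phi \o shift ((t : R^o), x)) (h *: ((0 : R^o), v)) - phi (t, x))).
apply/funext => h; rewrite /= /slice; congr (_ *: (phi _ - _)).
by congr pair; rewrite /= scaler0 add0r.
Qed.

Lemma continuous_slice (W : topologicalType) (g : ST -> W) (t : R) : continuous g ->
  continuous (fun x => g (t, x)).
Proof.
move=> cg x; apply: (continuous_comp (f := fun x => ((t : R^o), x)) (g := g)); last exact: cg.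
by apply: differentiable_continuous; exact: differentiable_pair.
Qed.

Lemma C1c_slice t : C1c setT (slice t).
Proof.
have [c1 cK _] := cphi.
apply: (C1c_intro (K := snd @` closure [set p | phi p != 0])) => //.
- split.
    move=> x; apply: (differentiable_comp (f := fun x => ((t : R^o), x)) (g := phi)).
      exact: differentiable_pair.
    exact: c1.1.
  move=> v; have -> : (fun x => 'D_v (slice t) x) = fun x => 'D_((0 : R^o), v) phi (t, x).
    by apply/funext => x; exact: derive_slice.
  exact: continuous_slice (c1.2 _).
- apply: continuous_compact => //; apply: continuous_subspaceT => p; exact: cvg_snd.
- move=> x nx; apply: (C1c_eq0 cphi) => tx; apply: nx; by exists (t, x).
Qed.

(** Time attains its extrema on the compact support, inside the open interval. The margin leaves
    room for the splines whose coefficients are not 0. *)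
Lemma slab_margin : exists2 d : R, 0 < d &
  forall p, phi p != 0 -> d <= p.1 /\ p.1 + d <= T.
Proof.
have [c1 cK KT] := cphi; set K := closure _ in cK KT.
have KP p : phi p != 0 -> K p by move=> pp; exact: (@subset_closure _ [set p | phi p != 0]).
have [[p0 Kp0]|K0] := pselect (K !=set0); last first.
  by exists 1 => // p pp; exfalso; apply: K0; exists p; exact: KP.
have cf : {within K, continuous (fst : ST -> R)}.
  by apply: continuous_subspaceT => p; exact: cvg_fst.
have K1 : K !=set0 by exists p0.
have [a /set_mem Ka aP] := compact_EVT_min K1 cK cf.
have [b /set_mem Kb bP] := compact_EVT_max K1 cK cf.
have := (KT _ Ka).1; have := (KT _ Kb).1; rewrite /= !in_itv/= => /andP[b0 bT] /andP[a0 aT].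
exists (Num.min a.1 (T - b.1)); first by rewrite lt_min a0 subr_gt0.
move=> p /KP Kp; have := aP p (mem_set Kp); have := bP p (mem_set Kp) => pb pa.
split; first by rewrite ge_min pa.
rewrite addrC -lerBrDr; apply: (@le_trans _ _ (T - b.1)); first by rewrite ge_min lexx orbT.
by rewrite lerB.
Qed.

End slices.

Section bsplines.
Context {R : realType}.

(* The B-spline of mesh 1/k.+1 centred at (j + 1/2)/k.+1. *)
Definition bspline (k j : nat) (t : R) : R :=
  step (k.+1%:R * t - j%:R) - step (k.+1%:R * t - j.+1%:R).

Lemma C1_bspline k j : C1 (bspline k j : R^o -> R^o) /\ forall t : R^o,
  'D_(1 : R^o) (bspline k j : R^o -> R^o) t =
  k.+1%:R * (hat (k.+1%:R * t - j%:R) - hat (k.+1%:R * t - j.+1%:R)).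
Proof.
have H (c : R) : C1 (fun t : R^o => k.+1%:R * t + c : R^o) /\
    forall t : R^o, 'D_(1 : R^o) (fun t : R^o => k.+1%:R * t + c : R^o) t = k.+1%:R.
  split; first by apply: C1D; [exact: C1Z C1_id|exact: C1_cst].
  move=> t; rewrite (derive_lin _ _ _ C1_id (C1_cst c)) derive_cst addr0 derive_id.
  exact: mulr1.
have [A1 A1d] := C1_step (H (- j%:R)).1; have [B1 B1d] := C1_step (H (- j.+1%:R)).1.
have E : (bspline k j : R^o -> R^o) =
    fun t : R^o => -1 * step (k.+1%:R * t - j.+1%:R) + step (k.+1%:R * t - j%:R).
  by apply/funext => t; rewrite mulN1r addrC.
have B1' := C1Z (-1) B1.
rewrite E; split; first exact: C1D B1' A1.
move=> t; rewrite (derive_lin _ _ _ B1 A1) A1d B1d !(H _).2.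
by ring.
Qed.

Lemma bspline_bound k j t : `|bspline k j t| <= 1.
Proof.
have h1 := step_ge0 (k.+1%:R * t - j%:R); have h2 := step_le1 (k.+1%:R * t - j%:R).
have h3 := step_ge0 (k.+1%:R * t - j.+1%:R); have h4 := step_le1 (k.+1%:R * t - j.+1%:R).
by rewrite /bspline ler_norml; apply/andP; split; lra.
Qed.

Lemma C1c_bspline k j (T : R) : 2 < j.+1%:R :> R -> j.+1%:R + 1 < k.+1%:R * T ->
  C1c `]0, T[ (bspline k j : R^o -> R^o).
Proof.
have k0 : 0 < k.+1%:R :> R by [].
have jS : j.+1%:R = j%:R + 1 :> R by rewrite natr1.
(* In the variable [k.+1 * t] the two steps rise on [[j - 1, j + 1]] and [[j, j + 2]]; outside the
   union they cancel. *)
move=> j2 jT; apply: (@C1c_intro R R^o _ `[(j%:R - 1) / k.+1%:R, (j%:R + 2) / k.+1%:R]%classic).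
- exact: (C1_bspline k j).1.
- exact: segment_compact.
- move=> t /=; rewrite !in_itv/= ler_pdivrMr// ler_pdivlMr// => /andP[h1 h2].
  apply/andP; split.
    by rewrite -(pmulr_lgt0 _ k0); move: h1 j2; rewrite jS; set u := t * _; lra.
  by rewrite -(ltr_pM2l k0); move: h2 jT; rewrite jS mulrC; set u := _ * t; lra.
- move=> t /=; rewrite in_itv/= ler_pdivrMr// ler_pdivlMr// => /negP; rewrite negb_and -!ltNge.
  rewrite /bspline jS [t * _]mulrC; set s := _ * t => /orP[]h.
    by rewrite !step0 ?subrr//; lra.
  by rewrite !step1 ?subrr//; lra.
Qed.

End bsplines.

Section derivation_to_field.
Context {R : realType} {n : nat} {N : 'rV[R]_n -> R} {T : R}.
Hypothesis hN : is_norm N.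
Local Notation ST := (R^o * 'rV[R]_n)%type.
Local Notation X := (spacetime R n).
Variable mu : {finite_measure set (spacetime R n) -> \bar R}.
Variable nu : 'I_n -> {charge set (spacetime R n) -> \bar R}.
Variable D : ('rV[R]_n -> R) -> {charge set X -> \bar R}.
Hypothesis dirD : directional nu D.
Hypothesis muD : solves_derivation N T mu D.

Lemma cint_directional (f : 'rV[R]_n -> R^o) g : C1c setT f -> bmeas g ->
  cint (D f) g = gradient_int nu f g.
Proof.
move=> cf; move: g; apply: (cint_unique (bp_fun_gradient_int nu cf)) => A mA.
rewrite dirD//; congr EFin; apply: eq_bigr => i _.
by rewrite charge_int_restrict restrict_mul_indic.
Qed.

Lemma solves_tensor (b : R^o -> R^o) (f : 'rV[R]_n -> R^o) : C1c `]0, T[ b -> C1c setT f ->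
  Rintegral mu setT (fun p : X => 'D_(1 : R^o) b p.1 * f p.2) +
  \sum_(i < n) cint (nu i) (fun p : X => b p.1 * 'D_(basis_vec i) f p.2) = 0.
Proof.
move=> cb cf; have [_ _ bU] := cb; have lf := C1c_lip_b hN cf.
have bout t : ~ `]0, T[%classic t -> b t = 0.
  by move=> nt; apply: (C1c_eq0 cb) => /bU.
have bout' t : ~ `]0, T[%classic t -> 'D_(1 : R^o) b t = 0.
  by move=> nt; apply: (C1c_derive_eq0 _ cb) => /bU.
have E1 : Rintegral mu (slab n T) (fun p => derive1 b p.1 * f p.2) =
    Rintegral mu setT (fun p : X => 'D_(1 : R^o) b p.1 * f p.2).
  rewrite Rintegral_mkcond -(restrict_fst (fun p : X => f p.2) bout').
  by congr (Rintegral mu setT (_ \_ _)); apply/funext => p; rewrite derive1E.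
have bb := @C1c_bmeas_fst R n _ b cb.
have E2 : charge_int (D f) (slab n T) (fun p => b p.1) =
    \sum_(i < n) cint (nu i) (fun p : X => b p.1 * 'D_(basis_vec i) f p.2).
  have E3 : ((fun p => b p.1) : X -> R) \_ (slab n T) = (fun p => b p.1).
    have bE : ((fun p => b p.1) : X -> R) = (fun p => b p.1 * cst 1 p).
      by apply/funext => p; exact/esym/mulr1.
    rewrite bE; exact: (restrict_fst (cst 1) bout).
  rewrite charge_int_restrict.
  rewrite E3.
  rewrite (cint_directional cf bb).
  apply: eq_bigr => i _.
  congr (cint (nu i) _).
  by apply/funext => p; exact: mulrC.
by rewrite -E1 -E2; exact: muD.
Qed.

End derivation_to_field.

Section spline_samples.
Context {R : realType} {n : nat} {T : R}.
Local Notation ST := (R^o * 'rV[R]_n)%type.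

(* The last node [spline_count k / k.+1] is beyond T. *)
Definition spline_count (k : nat) : nat := (k.+1 * (Num.truncn T).+1 + 2)%N.

(** Used with [step] and [a = 0] for the space derivatives, with [ramp] and [a = 1] for the time
    derivative. The sampling time is free within a mesh interval because the mean value theorem does
    not locate it. *)
Lemma moving_average_cvg (c : R -> R) (g : ST -> R) (M a : R) (q : nat -> nat -> ST -> R) :
  (forall s t, s <= t -> c s <= c t) -> (forall t, t <= - 1 -> c t = 0) ->
  (forall t, 1 <= t -> c t = 1) ->
  continuous g -> (forall p, `|g p| <= M) -> (forall p, ~ slab n T p -> g p = 0) ->
  0 <= a <= 1 ->
  (forall k j p, exists2 t : R, j%:R <= k.+1%:R * t <= j.+1%:R & q k j p = g (t, p.2)) ->
  let U k p := \sum_(j < spline_count k)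
    (c (k.+1%:R * p.1 + a - j%:R) - c (k.+1%:R * p.1 + a - j.+1%:R)) * q k j p in
  (forall k p, `|U k p| <= M) /\ forall p, U k p @[k --> \oo] --> g p.
Proof.
move=> cnd c0 c1 cg gM g0 /andP[a0 a1] qg U; split=> [k p|p].
  rewrite -[U k p]subr0.
  apply: (@moving_average_approx R c cnd c0 c1 _ _ (fun j => q k j p)); last by right.
    exact: le_trans (normr_ge0 _) (gM p).
  by move=> j _; rewrite subr0; have [t _ ->] := qg k j p.
apply/cvgrPdist_le => e e0.
have gpE : g (p.1, p.2) = g p by case: (p).
have gp : {for p.1 : R^o, continuous (fun t : R^o => g (t, p.2))}.
  apply: (continuous_comp (f := fun t : R^o => (t, p.2)) (g := g)); last exact: cg.
  by apply: differentiable_continuous; exact: differentiable_pair.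
have := gp => /cvgrPdist_le/(_ e e0)/nbhs_normP[d /= d0 dP]; rewrite gpE in dP.
(* In units of the mesh, 2 for the reach of the kernel, 1 for the shift a and 1 for the sampling
   interval. *)
near=> k; have kd : 4 < k.+1%:R * d.
  rewrite -ltr_pdivrMr//; apply: (@lt_trans _ _ k%:R); last by rewrite ltr_nat.
  by near: k; exact: nbhs_infty_gtr.
rewrite distrC.
apply: (@moving_average_approx R c cnd c0 c1 _ _ (fun j => q k j p)); first exact: ltW.
  move=> j js; have [t /andP[t1 t2] ->] := qg k j p; rewrite distrC; apply: dP => /=.
  rewrite -(ltr_pM2l (x := k.+1%:R))//; apply: le_lt_trans kd.
  rewrite -{1}[k.+1%:R]ger0_norm// -normrM mulrBr; move: js t1 t2.
  have -> : j.+1%:R = j%:R + 1 :> R by rewrite natr1.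
  rewrite !ler_norml; set u := _ * t; set v := _ * p.1; set w := j%:R.
  by move=> /andP[h1 h2] h3 h4; apply/andP; split; lra.
have [Sp|/g0 ->] := pselect (slab n T p); last by right.
left; have := Sp.1; rewrite /= in_itv/= => /andP[p0 pT]; split.
  apply: (@le_trans _ _ (k.+1%:R * p.1)); last by rewrite lerDl.
  rewrite -ler_pdivrMr//; apply: (@le_trans _ _ k%:R); last by rewrite ler_nat.
  by near: k; exact: nbhs_infty_ger.
rewrite /spline_count natrD natrM.
have h : k.+1%:R * p.1 <= k.+1%:R * (Num.truncn T).+1%:R.
  by rewrite ler_wpM2l// ltW// (lt_trans pT)// truncnS_gt.
by move: h; set u := _ * p.1; set v := _ * _; lra.
Unshelve. all: by end_near. Qed.

End spline_samples.

Arguments spline_count {R} T k.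

Lemma sumr_Abel (R : comPzRingType) (a f : nat -> R) m :
  \sum_(j < m) (a j - a j.+1) * f j.+1 =
  \sum_(j < m) a j * (f j.+1 - f j) + a 0%N * f 0%N - a m * f m.
Proof.
elim: m => [|m IH]; first by rewrite !big_ord0 add0r subrr.
by rewrite !big_ord_recr/= IH; ring.
Qed.

Lemma derive_scale (R : realType) (V : normedModType R) (f : V -> R^o) (a : R) (x v : V) :
  C1 f -> 'D_(a *: v) f x = a * 'D_v f x.
Proof. by move=> cf; rewrite !deriveE; [exact: linearZ|exact: cf.1|exact: cf.1]. Qed.

Section derivation_to_field.
Context {R : realType} {n : nat} {N : 'rV[R]_n -> R} {T : R}.
Hypothesis hN : is_norm N.
Local Notation ST := (R^o * 'rV[R]_n)%type.
Local Notation X := (spacetime R n).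
Variable mu : {finite_measure set (spacetime R n) -> \bar R}.
Variable nu : 'I_n -> {charge set (spacetime R n) -> \bar R}.
Variable D : ('rV[R]_n -> R) -> {charge set X -> \bar R}.
Hypothesis dirD : directional nu D.
Hypothesis muD : solves_derivation N T mu D.
Variable phi : ST -> R^o.
Hypothesis cphi : C1c (slab n T) phi.

Let node (k j : nat) : R := j%:R / k.+1%:R.
Let node_slice k j : 'rV[R]_n -> R^o := slice phi (node k j).

Let term_t k j (p : X) : R := 'D_(1 : R^o) (bspline k j : R^o -> R^o) p.1 * node_slice k j.+1 p.2.
Let term_x i k j (p : X) : R := bspline k j p.1 * 'D_(basis_vec i) (node_slice k j.+1) p.2.

(** If the slice is not identically 0, its node is at distance at least d from both ends of the time
    interval, and [3 < k.+1 * d] keeps the spline inside; otherwise both terms vanish. *)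
Let spline_term (d : R) k j : (forall p, phi p != 0 -> d <= p.1 /\ p.1 + d <= T) ->
  3 < k.+1%:R * d ->
  Rintegral mu setT (term_t k j) + \sum_(i < n) cint (nu i) (term_x i k j) = 0.
Proof.
move=> dP kd; have k0 : 0 < k.+1%:R :> R by [].
have [[x x0]|nx] := pselect (exists x, node_slice k j.+1 x != 0).
  have [/= d1 d2] := dP _ x0; apply: (solves_tensor hN dirD muD); last exact: C1c_slice cphi _.
  have E : k.+1%:R * node k j.+1 = j.+1%:R by rewrite /node mulrC divfK// gt_eqF.
  move: d1; rewrite -(ler_pM2l k0) E => d1.
  move: d2; rewrite -(ler_pM2l k0) mulrDr E => d2.
  by apply: C1c_bspline; lra.
have E : node_slice k j.+1 = cst 0.
  by apply/funext => x; apply/eqP; apply/negPn/negP => x0; apply: nx; exists x.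
have -> : term_t k j = cst 0 by apply/funext => p; rewrite /term_t E /= mulr0.
rewrite (bp_fun0 (bp_fun_Rintegral _)) add0r big1// => i _.
have -> : term_x i k j = cst 0 by apply/funext => p; rewrite /term_x E derive_cst mulr0.
exact: bp_fun0 (bp_fun_cint _).
Qed.

Let bmeas_term_t k j : bmeas (term_t k j).
Proof.
have [b1 bd] := @C1_bspline R k j; have cs := C1c_slice cphi (node k j.+1).
have [M sM] := C1c_bounded cs; have [s1 _ _] := cs.
apply: bmeasM; last exact: bmeas_snd (C1_continuous s1) sM.
apply: (@bmeas_fst R n _ k.+1%:R (b1.2 (1 : R^o))) => t; rewrite bd normrM ger0_norm//.
rewrite ler_piMr// ler_norml.
have := hat_ge0 (k.+1%:R * t - j%:R); have := hat_ge0 (k.+1%:R * t - j.+1%:R).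
have := hat_le1 (k.+1%:R * t - j%:R); have := hat_le1 (k.+1%:R * t - j.+1%:R).
by set u := hat _; set v := hat _ => *; apply/andP; split; lra.
Qed.

Let bmeas_term_x i k j : bmeas (term_x i k j).
Proof.
have [b1 bd] := @C1_bspline R k j; have cs := C1c_slice cphi (node k j.+1).
apply: bmeasM; last exact: bmeas_gradient cs.
exact: (@bmeas_fst R n _ 1 (C1_continuous b1) (bspline_bound k j)).
Qed.

Let node_bounds k j : j%:R <= k.+1%:R * node k j.+1 <= j.+1%:R.
Proof.
rewrite /node mulrC divfK; last by rewrite gt_eqF.
by rewrite lexx ler_nat leqnSn.
Qed.

Let spline_x i M : (forall p, `|'D_((0 : R^o), basis_vec i) phi p| <= M) ->
  let U k p := \sum_(j < spline_count T k) term_x i k j p in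
  (forall k p, `|U k p| <= M) /\ forall p, U k p @[k --> \oo] --> 'D_((0 : R^o), basis_vec i) phi p.
Proof.
move=> dM; have [c1 _ _] := cphi.
have := @moving_average_cvg R n T step (fun p => 'D_((0 : R^o), basis_vec i) phi p) M 0
  (fun k j p => 'D_((0 : R^o), basis_vec i) phi (node k j.+1, p.2))
  (@step_nd R) (@step0 R) (@step1 R) (c1.2 _) dM.
have -> // : (fun k p => \sum_(j < spline_count T k)
    (step (k.+1%:R * p.1 + 0 - j%:R) - step (k.+1%:R * p.1 + 0 - j.+1%:R)) *
    'D_((0 : R^o), basis_vec i) phi (node k j.+1, p.2)) =
  (fun k (p : X) => \sum_(j < spline_count T k) term_x i k j p).
  apply/funext => k; apply/funext => p; apply: eq_bigr => j _.
  by rewrite /term_x derive_slice addr0.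
apply; [by move=> p np; exact: C1c_derive_outside cphi np|by rewrite lexx ler01|].
by move=> k j p; exists (node k j.+1); first exact: node_bounds.
Qed.

Let time_mvt k j (x : 'rV[R]_n) : exists2 t : R, j%:R <= k.+1%:R * t <= j.+1%:R &
  k.+1%:R * (phi (node k j.+1, x) - phi (node k j, x)) = 'D_((1 : R^o), (0 : 'rV[R]_n)) phi (t, x).
Proof.
have [c1 _ _] := cphi; have k0 : k.+1%:R != 0 :> R by [].
have [s /andP[s0 s1] E] := C1_mvt ((node k j : R^o), x) ((node k j.+1 : R^o), x) c1.
have v : ((node k j.+1 : R^o), x) - ((node k j : R^o), x) =
    k.+1%:R^-1 *: ((1 : R^o), (0 : 'rV[R]_n)).
  congr pair; rewrite /= ?subrr ?scaler0// /node -mulrBl -[j.+1%:R]natr1 addrAC subrr add0r.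
  by rewrite mul1r [RHS]mulr1.
exists (node k j + s / k.+1%:R).
  have -> : k.+1%:R * (node k j + s / k.+1%:R) = j%:R + s by rewrite /node; field.
  by rewrite -[j.+1%:R]natr1 lerDl s0 lerD2l.
rewrite E v (derive_scale _ _ _ c1) mulrA divff// mul1r.
have -> // : ((node k j : R^o), x) + s *: (k.+1%:R^-1 *: ((1 : R^o), (0 : 'rV[R]_n))) =
  ((node k j + s / k.+1%:R : R^o), x).
congr pair; rewrite /= ?scaler0 ?addr0//.
by rewrite -[_ *: (1 : R^o)]/(_ * 1) mulr1.
Qed.

(** The derivative of a spline is a difference of two consecutive hats; summation by parts moves the
    difference onto the node values, and [time_mvt] turns it into a time derivative of phi. *)
Let spline_t M : (forall p, `|'D_((1 : R^o), (0 : 'rV[R]_n)) phi p| <= M) ->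
  let U k p := \sum_(j < spline_count T k) term_t k j p in
  (forall k p, `|U k p| <= M) /\
  forall p, U k p @[k --> \oo] --> 'D_((1 : R^o), (0 : 'rV[R]_n)) phi p.
Proof.
move=> dM; have [c1 _ _] := cphi.
pose q k j (p : ST) := k.+1%:R * (phi (node k j.+1, p.2) - phi (node k j, p.2)).
have := @moving_average_cvg R n T ramp (fun p => 'D_((1 : R^o), (0 : 'rV[R]_n)) phi p) M 1 q
  (@ramp_nd R) (@ramp0 R) (@ramp1 R) (c1.2 _) dM.
have -> // : (fun k p => \sum_(j < spline_count T k)
    (ramp (k.+1%:R * p.1 + 1 - j%:R) - ramp (k.+1%:R * p.1 + 1 - j.+1%:R)) * q k j p) =
  (fun k (p : X) => \sum_(j < spline_count T k) term_t k j p).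
  apply/funext => k; apply/funext => p.
  pose a j := hat (k.+1%:R * p.1 - j%:R); pose f j := k.+1%:R * phi (node k j, p.2).
  transitivity (\sum_(j < spline_count T k) a j * (f j.+1 - f j)).
    apply: eq_bigr => j _; rewrite /a hat_ramp /f /q mulrBr; congr ((_ - _) * _); congr ramp.
      by rewrite addrAC.
    by rewrite -[j.+1%:R]natr1; ring.
  transitivity (\sum_(j < spline_count T k) (a j - a j.+1) * f j.+1); last first.
    apply: eq_bigr => j _; rewrite /term_t (C1_bspline k j).2 /f /node_slice /slice mulrA.
    by congr (_ * _); exact: mulrC.
  rewrite sumr_Abel.
  (* The boundary terms vanish because the first node is the time 0 and the last lies beyond T. *)
  have -> : f 0%N = 0.
    rewrite /f (C1c_outside cphi) ?mulr0// => -[/=].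
    by rewrite in_itv/= /node mul0r ltxx.
  have -> : f (spline_count T k) = 0.
    rewrite /f (C1c_outside cphi) ?mulr0// => -[/=].
    rewrite in_itv/= => /andP[_]; rewrite ltNge => /negP h _; apply: h; rewrite /node ler_pdivlMr//.
    rewrite natrD natrM mulrC (le_trans _ (_ : k.+1%:R * (Num.truncn T).+1%:R <= _))// ?lerDl//.
    by rewrite ler_wpM2l// ltW// truncnS_gt.
  by rewrite !mulr0 subr0 addr0.
apply; [by move=> p np; exact: C1c_derive_outside cphi np|by rewrite lexx ler01|].
by move=> k j p; exact: time_mvt.
Qed.

(** For k large the equation holds exactly for the spline sum, term by term; both of its sides pass
    to the limit under bounded pointwise convergence of the derivatives. *)
Lemma solves_field_C1c : Rintegral mu (slab n T) (d_t phi) +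
  \sum_(i < n) charge_int (nu i) (slab n T) (d_x i phi) = 0.
Proof.
rewrite Rintegral_mkcond (restrict_C1c_derive _ cphi).
under eq_bigr do rewrite charge_int_restrict (restrict_C1c_derive _ cphi).
have [Mt tM] := C1c_derive_bounded ((1 : R^o), (0 : 'rV[R]_n)) cphi.
have [bt ct] := spline_t tM.
have bst k : bmeas ((fun p => \sum_(j < spline_count T k) term_t k j p) : X -> R).
  by apply: bmeas_sum => j; exact: bmeas_term_t.
have bsx i k : bmeas ((fun p => \sum_(j < spline_count T k) term_x i k j p) : X -> R).
  by apply: bmeas_sum => j; exact: bmeas_term_x.
have Lt := (bp_fun_Rintegral mu).2 _ _ (ex_intro _ Mt bt) bst ct.
have Lx i : cint (nu i) (fun p => \sum_(j < spline_count T k) term_x i k j p) @[k --> \oo] -->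
    cint (nu i) (fun p => 'D_((0 : R^o), basis_vec i) phi p).
  have [Mi iM] := C1c_derive_bounded ((0 : R^o), basis_vec i) cphi.
  have [bx cx] := spline_x iM.
  exact: (bp_fun_cint (nu i)).2 _ _ (ex_intro _ Mi bx) (bsx i) cx.
have := cvgD Lt (cvg_sumr (r := index_enum 'I_n) Lx).
have [d d0 dP] := slab_margin cphi => L.
suff L0 : Rintegral mu setT (fun p => \sum_(j < spline_count T k) term_t k j p) +
    \sum_(i < n) cint (nu i) (fun p => \sum_(j < spline_count T k) term_x i k j p)
    @[k --> \oo] --> (0 : R) by exact: (cvg_unique (@Rhausdorff R) (L _) L0).
apply: cvg_near_cst; near=> k.
have kd : 3 < k.+1%:R * d.
  rewrite -ltr_pdivrMr//; apply: (@lt_trans _ _ k%:R); last by rewrite ltr_nat.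
  by near: k; exact: nbhs_infty_gtr.
have -> := bp_fun_sum (index_enum 'I_(spline_count T k)) (bp_fun_Rintegral mu)
  (fun j => bmeas_term_t k j).
have Ex i := bp_fun_sum (index_enum 'I_(spline_count T k)) (bp_fun_cint (nu i))
  (fun j => bmeas_term_x i k j).
under [X in _ + X]eq_bigr do rewrite Ex.
rewrite exchange_big/= -big_split/= big1// => j _; exact: spline_term dP kd.
Unshelve. all: by end_near. Qed.

End derivation_to_field.

Theorem theorem3p23 (R : realType) (n : nat) (N : 'rV[R]_n -> R) (T : R)
    (mu : {finite_measure set (spacetime R n) -> \bar R}) :
  is_norm N -> 0 < T -> on_slab T mu ->
  (forall nu : 'I_n -> {charge set (spacetime R n) -> \bar R},
     (forall i, on_slab T (nu i)) ->
     solves_field T mu nu ->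
     exists D : ('rV[R]_n -> R) -> {charge set (spacetime R n) -> \bar R},
       [/\ [/\ derivation N T D, weak_star_continuous N T D & directional nu D],
           (forall D' : ('rV[R]_n -> R) ->
                        {charge set (spacetime R n) -> \bar R},
              derivation N T D' -> weak_star_continuous N T D' ->
              directional nu D' -> eq_on_lip_b N D' D) &
           solves_derivation N T mu D]) /\
  (forall D : ('rV[R]_n -> R) -> {charge set (spacetime R n) -> \bar R},
     derivation N T D -> finite_mass N T D -> solves_derivation N T mu D ->
     exists nu : 'I_n -> {charge set (spacetime R n) -> \bar R},
       [/\ forall i, on_slab T (nu i), directional nu D &
           solves_field T mu nu]).
Proof.
move=> hN _ _; split=> [nu nuT munu|D dD [lambda [_ Dlambda]] muD].
  have [D DP] := weak_derivative_exists (N := N) hN munu; exists D; split.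
  - split; [exact (weak_derivative_derivation hN nuT munu DP)|exact (weak_derivative_weak_star hN munu DP)|].
    exact (weak_derivative_directional hN nuT munu DP).
  - exact (weak_derivative_unique hN nuT munu DP).
  - exact (weak_derivative_solves hN DP).
(* The components are chosen first; that D is directional along them is what transfers the equation
   from D to nu. *)
have /choice[nu nuP] := clamp_charge hN dD Dlambda.
have nu_mass i : forall g, bmeas g -> `|cint (nu i) g| <= mass_gauge hN lambda g.
  by have [_ + _] := nuP i.
have nu_cube i := let: And3 _ _ h := nuP i in h.
have dirD : directional nu D := directional_of_clamps dD Dlambda nu_mass nu_cube.
exists nu; split=> // [i|phi cphi]; first by have [] := nuP i.
exact (solves_field_C1c hN dirD muD cphi).
Qed.
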